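(* Let $n\ge 1$ be an integer. For every $s\in(0,1)$, $$BV^s(\mathbb{R}^n)\not\subset X_s,$$ where $X_s:=[\mathcal{H}^1(\mathbb{R}^n),BV(\mathbb{R}^n)]_s$ is the complex interpolation space of exponent $s$ between the real Hardy space $\mathcal{H}^1(\mathbb{R}^n)$ and the space $BV(\mathbb{R}^n)$ of functions of bounded variation, and $BV^s(\mathbb{R}^n)$ is the space of functions with bounded fractional variation of order $s$.
   Context: Functions are complex-valued, and Banach spaces are over $\mathbb{C}$. **Fractional divergence and $BV^s$.** For $s\in(0,1)$ and $\varphi\in C_c^\infty(\mathbb{R}^n;\mathbb{R}^n)$, the fractional divergence is $$\mathrm{div}^s\varphi(x):=c_{n,s}\int_{\mathbb{R}^n}\frac{\varphi(x)-\varphi(y)}{|x-y|^{n+s}}\cdot\frac{x-y}{|x-y|}\,dy,\qquad x\in\mathbb{R}^n,$$ where $c_{n,s}>0$ is a normalizing constant depending only on $n$ and $s$. The fractional variation of $f\in L^1(\mathbb{R}^n)$ is $$[f]_{BV^s}:=\sup\left\{\left|\int_{\mathbb{R}^n}f\,\mathrm{div}^s\varphi\,dx\right|:\ \varphi\in C_c^\infty(\mathbb{R}^n;\mathbb{R}^n),\ \|\varphi\|_\infty\le1\right\},$$ and $BV^s(\mathbb{R}^n):=\{f\in L^1(\mathbb{R}^n):[f]_{BV^s}<+\infty\}$. **Hardy space.** $\mathcal{H}^1(\mathbb{R}^n):=\{f\in L^1(\mathbb{R}^n):\ \mathcal{R}f\in L^1\}$, where $\mathcal{R}f=(\mathcal{R}_1f,\ldots,\mathcal{R}_nf)$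 is the (vector) Riesz transform, $$\mathcal{R}_jf(x):=\pi^{-\frac{n+1}{2}}\,\Gamma\left(\tfrac{n+1}{2}\right)\lim_{\varepsilon\to0^+}\int_{\{|y-x|\ge\varepsilon\}}\frac{(y_j-x_j)f(y)}{|y-x|^{n+1}}\,dy,\qquad j=1,\ldots,n,$$ with norm $\|f\|_{\mathcal{H}^1}=\|f\|_{L^1}+\|\mathcal{R}f\|_{L^1}$. **BV.** $BV(\mathbb{R}^n)$ is the space of $f\in L^1(\mathbb{R}^n)$ with finite variation $$[f]_{BV}:=\sup\left\{\left|\int_{\mathbb{R}^n}f\,\mathrm{div}\,\varphi\,dx\right|:\ \varphi\in C_c^\infty(\mathbb{R}^n;\mathbb{R}^n),\ \|\varphi\|_\infty\le1\right\},$$ with norm $\|f\|_{BV}=\|f\|_{L^1}+[f]_{BV}$. Both $\mathcal{H}^1(\mathbb{R}^n)$ and $BV(\mathbb{R}^n)$ are continuously embedded in $L^1(\mathbb{R}^n)$, so they form a compatible couple of Banach spaces. **Complex interpolation.** Let $(E_0,E_1)$ be a compatible couple of complex Banach spaces (both continuously embedded in a common Hausdorff topological vector space), and let $S:=\{z\in\mathbb{C}:0\le\mathrm{Re}\,z\le1\}$. Let $\mathfrak{F}(E_0,E_1)$ be the space of functions $F:S\to E_0+E_1$ that are holomorphic in the interior of $S$, continuous and bounded on $S$, and such that for $j=0,1$ the map $t\mapsto F(j+it)$ is continuous from $\mathbb{R}$ to $E_j$ with $\|F(j+it)\|_{E_j}\to0$ as $|t|\to\infty$. It is normed by $$\|F\|_{\mathfrak{F}}:=\max\left\{\sup_{t\in\mathbb{R}}\|F(it)\|_{E_0},\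 \sup_{t\in\mathbb{R}}\|F(1+it)\|_{E_1}\right\}.$$ For $\theta\in[0,1]$, $[E_0,E_1]_\theta:=\{x\in E_0+E_1:\ x=F(\theta)\text{ for some }F\in\mathfrak{F}(E_0,E_1)\}$, with norm $\|x\|_\theta:=\inf\{\|F\|_{\mathfrak{F}}: F\in\mathfrak{F}(E_0,E_1),\ F(\theta)=x\}$. *)

(* Defs.v *)
From HB Require Import structures.
From mathcomp Require Import all_boot all_order all_algebra.
From mathcomp Require Import all_classical all_reals all_analysis.
From mathcomp Require Import complex.

Set Implicit Arguments.
Unset Strict Implicit.
Unset Printing Implicit Defensive.
Import Order.TTheory GRing.Theory Num.Theory numFieldNormedType.Exports.

Local Open Scope classical_set_scope.
Local Open Scope ring_scope.
Local Open Scope complex_scope.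

(* R[i] carries no topology in the libraries: it gets the one of the modulus,
   as a normed space over itself. *)
HB.instance Definition _ (R : rcfType) := NormedModule.copy R[i] R[i]^o.
HB.instance Definition _ (R : rcfType) := Pointed.copy R[i] R[i]^o.

Definition measure_rV_display : measure_display -> measure_display.
Proof. exact. Qed.

(* The sigma-algebra on 'rV[T]_n is generated by the coordinates; for T = R it
   is the Borel sigma-algebra. *)
Section measurable_rV.
Context {d} {T : measurableType d} {n : nat}.

Let coor : 'I_n -> 'rV[T]_n -> T := fun i x => x ord0 i.

Let rV_set0 : g_sigma_preimage coor set0.
Proof. exact: sigma_algebra0. Qed.

Let rV_setC A : g_sigma_preimage coor A -> g_sigma_preimage coor (~` A).
Proof. exact: sigma_algebraC. Qed.

Let rV_bigcup (F : (set 'rV[T]_n)^nat) :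
  (forall i, g_sigma_preimage coor (F i)) ->
  g_sigma_preimage coor (\bigcup_i (F i)).
Proof. exact: sigma_algebra_bigcup. Qed.

HB.instance Definition _ := @isMeasurable.Build (measure_rV_display d)
  'rV[T]_n (g_sigma_preimage coor) rV_set0 rV_setC rV_bigcup.

Lemma measurable_coord (i : 'I_n) :
  measurable_fun [set: 'rV[T]_n] (fun x : 'rV[T]_n => x ord0 i).
Proof.
move=> _ Y mY; rewrite setTI; apply: sub_sigma_algebra => /=.
rewrite -bigcup_seq/=; exists i => /=; first by rewrite mem_index_enum.
by exists Y => //; rewrite setTI.
Qed.

Lemma measurable_fun_rV d1 (T1 : measurableType d1) (f : T1 -> 'rV[T]_n) :
  (forall i, measurable_fun [set: T1] (fun x => f x ord0 i)) ->
  measurable_fun [set: T1] f.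
Proof.
move=> mf _ A mA; rewrite setTI.
suff: g_sigma_preimage (fun i => (fun x : 'rV[T]_n => x ord0 i) \o f)
  `<=` measurable.
  by rewrite g_sigma_preimage_comp; apply; exists A => //; rewrite setTI.
apply: smallest_sub; first exact: sigma_algebra_measurable.
elim/big_ind: _ => //; first by move=> X Y HX HY Z [/HX|/HY].
by move=> i _ _ [B mB <-]; exact: mf.
Qed.

End measurable_rV.

Section lebesgue_measure_rV.
Variable R : realType.

Definition cons_rV n (p : R * 'rV[R]_n) : 'rV[R]_n.+1 :=
  \row_(i < n.+1) if unlift ord0 i is Some j then p.2 ord0 j else p.1.

Lemma measurable_cons_rV n : measurable_fun setT (@cons_rV n).
Proof.
apply: measurable_fun_rV => i; rewrite /cons_rV.
under eq_fun do rewrite mxE.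
case: unliftP => [j _|_]; last exact: measurable_fst.
exact: (measurableT_comp (measurable_coord j) measurable_snd).
Qed.

Section step.
Variables (n : nat) (m : {sigma_finite_measure set 'rV[R]_n -> \bar R}).
Local Open Scope ereal_scope.

Definition lebesgue_step : set 'rV[R]_n.+1 -> \bar R :=
  pushforward (@lebesgue_measure R \x m) (@cons_rV n).

Let step0 : lebesgue_step set0 = 0.
Proof. by rewrite /lebesgue_step /pushforward preimage_set0 measure0. Qed.

Let step_ge0 A : 0 <= lebesgue_step A.
Proof. by rewrite /lebesgue_step /pushforward. Qed.

Let step_sigma_additive : semi_sigma_additive lebesgue_step.
Proof.
move=> F mF tF mUF; rewrite /lebesgue_step /pushforward preimage_bigcup.
apply: measure_semi_sigma_additive.
- by move=> k; rewrite -[X in measurable X]setTI; exact: measurable_cons_rV.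
- apply/trivIsetP => /= i j _ _ ij; rewrite -preimage_setI.
  by move/trivIsetP : tF => /(_ _ _ _ _ ij) ->//; rewrite preimage_set0.
- rewrite -preimage_bigcup -[X in measurable X]setTI.
  exact: measurable_cons_rV.
Qed.

HB.instance Definition _ := isMeasure.Build _ _ _ lebesgue_step
  step0 step_ge0 step_sigma_additive.

Let behead_rV (x : 'rV[R]_n.+1) : R * 'rV[R]_n :=
  (x ord0 ord0, \row_(j < n) x ord0 (lift ord0 j)).

Let cons_rVK : cancel (@cons_rV n) behead_rV.
Proof.
move=> [a v]; rewrite /behead_rV /cons_rV /= !mxE unlift_none; congr (_, _).
by apply/rowP => j; rewrite !mxE liftK.
Qed.

Let measurable_behead_rV : measurable_fun setT behead_rV.
Proof.
apply/measurable_fun_pairP; split; first exact: measurable_coord.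
apply: measurable_fun_rV => i /=.
under eq_fun do rewrite mxE.
exact: measurable_coord.
Qed.

Let step_sigma_finite : sigma_finite setT lebesgue_step.
Proof.
have /sigma_finiteP[F [TF ndF Foo]] := sigma_finiteT (@lebesgue_measure R).
have /sigma_finiteP[G [TG ndG Goo]] := sigma_finiteT m.
exists (fun k => behead_rV @^-1` (F k `*` G k)) => [|k].
  rewrite -preimage_bigcup (_ : \bigcup_i _ = setT) ?preimage_setT//.
  apply/seteqP; split => // -[x y] _.
  have [i _ Fix] : (\bigcup_i F i) x by rewrite -TF.
  have [j _ Gjy] : (\bigcup_i G i) y by rewrite -TG.
  exists (maxn i j) => //; split.
  - by move: x Fix; exact/subsetPset/ndF/leq_maxl.
  - by move: y Gjy; exact/subsetPset/ndG/leq_maxr.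
have [mFk Fk] := Foo k; have [mGk Gk] := Goo k.
have mFGk : measurable (F k `*` G k) by exact: measurableX.
split; first by rewrite -[X in measurable X]setTI; exact: measurable_behead_rV.
rewrite /lebesgue_step /pushforward -comp_preimage.
rewrite (_ : behead_rV \o _ = id) ?preimage_id; last exact/funext/cons_rVK.
by rewrite product_measure1E// lte_mul_pinfty// ge0_fin_numE.
Qed.

HB.instance Definition _ := Measure_isSigmaFinite.Build _ _ _ lebesgue_step
  step_sigma_finite.

End step.

(* Lebesgue measure on R^n as an n-fold product measure, transported along
   R * 'rV_n -> 'rV_n.+1; lebesgue_rV_box computes it on boxes. *)
Fixpoint lebesgue_rV n : {sigma_finite_measure set 'rV[R]_n -> \bar R} :=
  if n is m.+1 then lebesgue_step (lebesgue_rV m) else \d_(0 : 'rV[R]_0).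

Lemma lebesgue_rV_box n (a b : 'I_n -> R) : (forall i, a i <= b i) ->
  lebesgue_rV n [set x : 'rV[R]_n | forall i, x ord0 i \in `[a i, b i]] =
  (\prod_(i < n) (b i - a i))%:E.
Proof.
elim: n a b => [|n IHn] a b ab /=.
  by rewrite big_ord0 diracE mem_set// => -[].
pose B := [set x : 'rV[R]_n |
  forall i, x ord0 i \in `[a (lift ord0 i), b (lift ord0 i)]].
have mB : measurable B.
  rewrite (_ : B = \bigcap_(i in [set: 'I_n])
      ((fun x : 'rV[R]_n => x ord0 i) @^-1`
        `[a (lift ord0 i), b (lift ord0 i)])); last first.
    by apply/seteqP; split => [x Bx i _|x Bx i]; [exact: Bx|exact: (Bx i I)].
  apply: fin_bigcap_measurable; first exact: finite_finset.
  by move=> i _; rewrite -[X in measurable X]setTI; exact: measurable_coord.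
rewrite /lebesgue_step /pushforward.
rewrite (_ : _ @^-1` _ = `[a ord0, b ord0]%classic `*` B); last first.
  apply/seteqP; split => -[r x] /=.
    move=> H; split => [|i].
      by have := H ord0; rewrite mxE unlift_none.
    by have := H (lift ord0 i); rewrite mxE liftK.
  move=> [Hr Hx] i; rewrite mxE.
  by case: unliftP => [j ->|->].
rewrite product_measure1E// IHn; last by move=> i; exact: ab.
rewrite big_ord_recl EFinM; congr (_ * _)%E.
transitivity (lebesgue_measure (`[a ord0, b ord0]%classic : set R)) => //.
rewrite lebesgue_measure_itv/= lte_fin; case: ltP => // ba.
have -> : b ord0 = a ord0 by apply/eqP; rewrite eq_le ba ab.
by rewrite subrr.
Qed.

End lebesgue_measure_rV.

Section euclidean.
Context {R : realType} {n : nat}.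
Implicit Types x y : 'rV[R]_n.

(* The library norm `|x| on 'rV[R]_n is the sup norm. *)
Definition enorm x : R := Num.sqrt (\sum_(i < n) x ord0 i ^+ 2).

Definition dotp x y : R := \sum_(i < n) x ord0 i * y ord0 i.

Definition basis_rV (i : 'I_n) : 'rV[R]_n := delta_mx ord0 i.

Fixpoint Ck (k : nat) (f : 'rV[R]_n -> R) : Prop :=
  if k is k'.+1 then
    continuous f /\
    forall i, (forall x, derivable f x (basis_rV i)) /\
              Ck k' (fun x => 'D_(basis_rV i) f x)
  else continuous f.

Definition test_field (phi : 'rV[R]_n -> 'rV[R]_n) : Prop :=
  (forall i k, Ck k (fun x => phi x ord0 i)) /\
  compact (closure [set x | phi x != 0]).

Definition divergence (phi : 'rV[R]_n -> 'rV[R]_n) (x : 'rV[R]_n) : R :=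
  \sum_(i < n) 'D_(basis_rV i) (fun z => phi z ord0 i) x.

(* c > 0 is the normalizing constant c_{n,s}; the space BV_frac c s below does
   not depend on its value. *)
Definition frac_divergence (c s : R) (phi : 'rV[R]_n -> 'rV[R]_n)
    (x : 'rV[R]_n) : R :=
  c * \int[lebesgue_rV R n]_y
        dotp ((enorm (x - y) `^ (n%:R + s))^-1 *: (phi x - phi y))
             ((enorm (x - y))^-1 *: (x - y)).

End euclidean.

(* Elements of L^1(R^n; C) and of its subspaces are represented by Borel
   functions R^n -> C. Every set and norm below is invariant under changing such
   a function on a null set, so that membership of the class and membership of a
   representative are the same thing. *)
Section function_spaces.
Context {R : realType} {n : nat}.
Local Notation Rn := 'rV[R]_n.
Local Notation leb := (lebesgue_rV R n).
Implicit Types f : Rn -> R[i].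

Definition cintegral (D : set Rn) f : R[i] :=
  (\int[leb]_(x in D) complex.Re (f x)) +i*
  (\int[leb]_(x in D) complex.Im (f x)).

Definition L1 : set (Rn -> R[i]) := [set f |
  leb.-integrable setT (fun x => (complex.Re (f x))%:E) /\
  leb.-integrable setT (fun x => (complex.Im (f x))%:E)].

Definition L1_norm f : \bar R := \int[leb]_x (Normc.normc (f x))%:E.

Definition variation (D : (Rn -> Rn) -> Rn -> R) f : \bar R :=
  ereal_sup [set (Normc.normc (cintegral setT (fun x => f x * (D phi x)%:C)))%:E
    | phi in [set phi | test_field phi /\ forall x, enorm (phi x) <= 1]].

Definition BV_frac (c s : R) : set (Rn -> R[i]) :=
  [set f | L1 f /\ (variation (frac_divergence c s) f < +oo)%E].

Definition gamma_fun (a : R) : R :=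
  \int[lebesgue_measure]_(t in `]0, +oo[) (t `^ (a - 1) * expR (- t)).

(* The principal value exists at almost every x when f is integrable; where it
   does not, lim returns an arbitrary value. *)
Definition riesz (j : 'I_n) f (x : Rn) : R[i] :=
  (pi `^ (- (n.+1%:R / 2)) * gamma_fun (n.+1%:R / 2))%:C *
  lim (cintegral [set y | e <= enorm (y - x)]
         (fun y => ((y - x) ord0 j)%:C * f y / (enorm (y - x) ^+ n.+1)%:C)
       @[e --> (0 : R)^'+]).

End function_spaces.

(* A subspace of V with its own norm; only the values of the norm on the carrier
   are meaningful. *)
Record normed_subspace (R : realType) (V : lmodType R[i]) := NormedSubspace {
  carrier :> set V;
  subspace_norm : V -> \bar R }.

Section complex_interpolation.
Context {R : realType} {V : lmodType R[i]}.
Variables E0 E1 : normed_subspace V.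

Definition sum_space : normed_subspace V := NormedSubspace
  [set x0 + x1 | x0 in E0 & x1 in E1]
  (fun x => ereal_inf
    [set r | exists x0 x1, [/\ carrier E0 x0, carrier E1 x1, x = x0 + x1 &
        r = (subspace_norm E0 x0 + subspace_norm E1 x1)%E]]).

Local Notation "`|| x ||_ E" := (subspace_norm E x)
  (at level 0, x at level 99, E at level 0).

Definition strip : set R[i] := [set z | 0 <= complex.Re z <= 1].

Definition strip_interior : set R[i] := [set z | 0 < complex.Re z < 1].

Definition holomorphic_on_strip (F : R[i] -> V) : Prop :=
  forall z, strip_interior z -> exists2 d, carrier sum_space d &
    `|| h^-1 *: (F (z + h) - F z) - d ||_sum_space @[h --> (0 : R[i])^']
      --> 0%E.

Definition continuous_on_strip (F : R[i] -> V) : Prop :=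
  forall z, strip z ->
    `|| F w - F z ||_sum_space @[w --> within strip (nbhs z)] --> 0%E.

Definition bounded_on_strip (F : R[i] -> V) : Prop :=
  exists M : R, forall z, strip z -> (`|| F z ||_sum_space <= M%:E)%E.

Definition C0_line (E : normed_subspace V) (G : R -> V) : Prop :=
  [/\ forall t, carrier E (G t),
      forall t0, `|| G t - G t0 ||_E @[t --> t0] --> 0%E,
      `|| G t ||_E @[t --> +oo] --> 0%E &
      `|| G t ||_E @[t --> -oo] --> 0%E].

Definition interp_functions : set (R[i] -> V) := [set F |
  [/\ forall z, strip z -> carrier sum_space (F z),
      holomorphic_on_strip F,
      continuous_on_strip F /\ bounded_on_strip F,
      C0_line E0 (fun t => F (0 +i* t)) &
      C0_line E1 (fun t => F (1 +i* t))]].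

Definition complex_interp (theta : R) : set V :=
  [set F theta%:C | F in interp_functions].

End complex_interpolation.

Definition hardy1 (R : realType) (n : nat) :
    normed_subspace ('rV[R]_n -> R[i]) := NormedSubspace
  [set f | L1 f /\ forall j, L1 (riesz j f)]
  (fun f => L1_norm f + \int[lebesgue_rV R n]_x
     (Num.sqrt (\sum_(j < n) Normc.normc (riesz j f x) ^+ 2))%:E)%E.

Definition BV (R : realType) (n : nat) :
    normed_subspace ('rV[R]_n -> R[i]) := NormedSubspace
  [set f | L1 f /\ (variation divergence f < +oo)%E]
  (fun f => L1_norm f + variation divergence f)%E.

(* Main.v *)
Require Import Defs.
From HB Require Import structures.
From mathcomp Require Import all_boot all_order all_algebra.
From mathcomp Require Import all_classical all_reals all_analysis.
From mathcomp Require Import measurable_realfun.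
From mathcomp Require Import complex.
From mathcomp Require Import ring lra.

Set Implicit Arguments.
Unset Strict Implicit.
Unset Printing Implicit Defensive.
Import Order.TTheory GRing.Theory Num.Theory numFieldNormedType.Exports.

Local Open Scope classical_set_scope.
Local Open Scope ring_scope.

(** The function f(x) = sgn(x_0) |x_0|^(s-1) 1_{|x_0| < 1} exp(- |x_1| - ... - |x_m|)
    on R^(m+1) lies in BV^s but not in the interpolation space. Formally it is
    a fractional derivative of order 1 - s of a function that jumps across the
    hyperplane x_0 = 0, so that its variation of order s is a measure that
    charges the hyperplane. In an interpolation space of H^1 and BV this cannot
    happen: pairings with fields that concentrate on the hyperplane vanish in
    the limit at the endpoint H^1, and therefore, at the appropriate scale, in
    every intermediate space.

    Membership in BV^s ([fsing_BV_frac]). Let g be a component of a test field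
    and K the corresponding kernel, odd and homogeneous of degree - (n + s). In
    the integral of f(x) (g(x) - g(y)) K(x - y), the substitution y = x - x_0 w
    turns all powers of |x_0| into |x_0|^(-1); after an exchange of the
    integrals ([fsing_fdiv_swap]) one has to bound, for fixed w, the integral
    over x of 1_{|x_0| < 1} |x_0|^(-1) exp(...) (g(x) - g(x - x_0 w)), using
    |g| <= 1 only. Up to the error made by shifting the exponential, this is
    a Frullani integral in x_0, bounded by a multiple of |ln |1 - w_0||
    ([frullani], [inner_bound]). The resulting function of w, multiplied by
    |w|^(-n-s), is integrable ([logweight_le], [integral_logbound_lty]).

    Failure of interpolation ([fsing_not_interp]). The test fields
    [bump_field] lam e_0, supported where |x_0| <= 1 / lam, have a divergence
    lam psi with psi = [bump_div] lam bounded by 4 and tending to 0 pointwise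
    as lam grows. Write L(g) for the integral of g psi. Then L(g) tends to 0
    for every integrable g, whereas |L(g)| <= [g]_BV / lam for g in BV. If
    F is admissible with F(s) = f, then H(z) = (lam A)^z (z + 1)^(-2) L(F(z)) is
    holomorphic in the strip, and |H(s)| is at most a constant times the sum of
    the integrals of |H| over both boundary lines ([strip_mean]). As lam tends
    to infinity the integral over Re z = 0 tends to 0 by dominated
    convergence, and the integral over Re z = 1 is O(A)
    ([bump_pairing_bounded]). But |L(f)| >= c lam^(-s) ([pairing_fsing_ge]),
    hence |H(s)| >= c' A^s, which is not O(A) as A tends to 0. *)

Local Notation Re := complex.Re.
Local Notation Im := complex.Im.

Lemma le_of_eq d (T : porderType d) (x y : T) : x = y -> (x <= y)%O.
Proof. by move->. Qed.

(** * Affine changes of variables *)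
Section change.
Context {R : realType} d (T : measurableType d) (nu : {measure set T -> \bar R}).
Variables (k : R) (phi : T -> T).
Hypotheses (mphi : measurable_fun setT phi) (k0 : (0 < k)%R).
Local Open Scope ereal_scope.
Hypothesis change : forall G : T -> \bar R, measurable_fun setT G ->
  (forall x, 0 <= G x) -> \int[nu]_x G x = k%:E * \int[nu]_x G (phi x).

Lemma integrable_change (F : T -> R) : nu.-integrable setT (EFin \o F) ->
  nu.-integrable setT (fun x => (F (phi x))%:E).
Proof.
move=> /integrableP[mF iF]; apply/integrableP; split.
  exact: (measurableT_comp mF mphi).
rewrite ltey; apply/eqP => E; move: iF.
rewrite change//; last exact: measurableT_comp.
by rewrite [X in _ * X]E gt0_muley ?lte_fin// ltxx.
Qed.

(** The formula passes from nonnegative to integrable functions through the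
    positive and negative parts. *)
Lemma Rintegral_change (F : T -> R) : nu.-integrable setT (EFin \o F) ->
  (\int[nu]_x F x = k * \int[nu]_x F (phi x))%R.
Proof.
move=> iF; have iFa := integrable_change iF.
have mF : measurable_fun setT (EFin \o F) by case/integrableP : iF.
have E1 : \int[nu]_x (EFin \o F) x = k%:E * \int[nu]_x (F (phi x))%:E.
  pose Fa x := (F (phi x))%:E.
  have Ep : \int[nu]_x (EFin \o F)^\+ x = k%:E * \int[nu]_x Fa^\+ x.
    rewrite (change (measurable_funepos mF) (funepos_ge0 _)).
    by rewrite (funepos_comp (EFin \o F) phi).
  have En : \int[nu]_x (EFin \o F)^\- x = k%:E * \int[nu]_x Fa^\- x.
    rewrite (change (measurable_funeneg mF) (funeneg_ge0 _)).
    by rewrite (funeneg_comp (EFin \o F) phi).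
  have fi := integral_funeneg_lt_pinfty measurableT iFa.
  rewrite (integralE _ _ (EFin \o F)) Ep En -/Fa (integralE _ _ Fa) [RHS]muleBr//.
  apply: fin_num_adde_defl; rewrite fin_numN.
  by rewrite ge0_fin_numE ?integral_ge0//.
rewrite /Rintegral -[LHS]/(fine (\int[nu]_x (EFin \o F) x)) E1 fineM//.
exact: integrable_fin_num.
Qed.

End change.

Section aff.
Context {R : realType}.
Local Notation mu := (@lebesgue_measure R).
Local Open Scope ereal_scope.

(** The image of [|al| mu] under t |-> al t + be agrees with [mu] on intervals,
    hence is [mu]. *)
Lemma ge0_integral_affine (al be : R) (F : R -> \bar R) : al != 0%R ->
  measurable_fun [set: R] F -> (forall t, 0 <= F t) ->
  \int[mu]_t F t = `|al|%:E * \int[mu]_t F (al * t + be)%R.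
Proof.
move=> al0 mF F0.
pose phi : measurableTypeR R -> measurableTypeR R := fun t => (al * t + be)%R.
have mphi : measurable_fun setT phi.
  by apply: measurable_funD => //; apply: measurable_funM.
pose nu : {measure set (measurableTypeR R) -> \bar R} :=
  mscale (NngNum (normr_ge0 al))
    (measure_function_pushforward__canonical__measure_function_Measure mu mphi).
have E : forall A, measurable A -> mu A = nu A.
  move=> A mA.
  apply: lebesgue_measure_unique => //= _ [[a b]] _ <-.
  rewrite /nu /mscale /= /pushforward lebesgue_measure_itv/=.
  have [al_gt0|al_lt0|/eqP] := ltgtP 0%R al; last by rewrite eq_sym (negbTE al0).
  - rewrite (_ : _ @^-1` _ = `](((a - be) / al)%R), (((b - be) / al)%R)]%classic); last first.
      apply/seteqP; split => t /=; rewrite /phi !in_itv/=.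
        by rewrite ltr_pdivrMr// ler_pdivlMr// ltrBlDr lerBrDr ![(t * _)%R]mulrC.
      by rewrite ltr_pdivrMr// ler_pdivlMr// ltrBlDr lerBrDr ![(t * _)%R]mulrC.
    rewrite lebesgue_measure_itv/= !lte_fin ltr_pM2r ?invr_gt0// ltrD2r.
    case: ifP => _; last by rewrite mule0.
    rewrite -!EFinD -EFinM gtr0_norm// (_ : (al * _ = b - a)%R)//.
    by field.
  - rewrite (_ : _ @^-1` _ = `[(((b - be) / al)%R), (((a - be) / al)%R)[%classic); last first.
      apply/seteqP; split => t /=; rewrite /phi !in_itv/=.
        rewrite ler_ndivrMr// ltr_ndivlMr// lerBrDr ltrBlDr ![(t * _)%R]mulrC.
        by move=> /andP[-> ->].
      rewrite ler_ndivrMr// ltr_ndivlMr// lerBrDr ltrBlDr ![(t * _)%R]mulrC.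
      by move=> /andP[-> ->].
    rewrite lebesgue_measure_itv/= !lte_fin ltr_nM2r ?invr_lt0// ltrD2r.
    case: ifP => _; last by rewrite mule0.
    rewrite -!EFinD -EFinM ltr0_norm// (_ : (- al * _ = b - a)%R)//.
    by field.
rewrite (eq_measure_integral nu) => [|A mA _]; last exact: E.
rewrite /nu ge0_integral_mscale//=; congr (_ * _).
by rewrite ge0_integral_pushforward.
Qed.

End aff.

Section affR.
Context {R : realType}.
Local Notation mu := (@lebesgue_measure R).

Let maff (al be : R) : measurable_fun [set: measurableTypeR R]
  ((fun t => al * t + be) : measurableTypeR R -> measurableTypeR R).
Proof. by apply: measurable_funD => //; exact: measurable_funM. Qed.

Lemma integrable_affine (al be : R) (F : R -> R) : al != 0 ->
  mu.-integrable setT (EFin \o F) ->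
  mu.-integrable setT (fun t => (F (al * t + be))%:E).
Proof.
move=> al0 iF; apply: (integrable_change (k := `|al|) (maff al be)) iF.
  by rewrite normr_gt0.
by move=> G mG G0; exact: ge0_integral_affine.
Qed.

Lemma Rintegral_affine (al be : R) (F : R -> R) : al != 0 ->
  mu.-integrable setT (EFin \o F) ->
  \int[mu]_t F t = `|al| * \int[mu]_t F (al * t + be).
Proof.
move=> al0 iF; apply: (Rintegral_change (k := `|al|) (maff al be)) iF.
  by rewrite normr_gt0.
by move=> G mG G0; exact: ge0_integral_affine.
Qed.

End affR.

Section rV.
Context {R : realType}.
Local Notation mu := (@lebesgue_measure R).
Local Notation leb n := (lebesgue_rV R n).
Local Open Scope ereal_scope.

Lemma measurable_fun_cons_rV n d (T : measurableType d)
    (f : 'rV[R]_n.+1 -> T) (t : R) : measurable_fun setT f ->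
  measurable_fun setT (fun v : 'rV[R]_n => f (cons_rV (t, v))).
Proof.
move=> mf; apply: (measurableT_comp mf).
exact: (measurableT_comp (@measurable_cons_rV R n) (measurable_pair1 t)).
Qed.

Lemma ge0_integral_rVS n (f : 'rV[R]_n.+1 -> \bar R) :
  measurable_fun setT f -> (forall x, 0 <= f x) ->
  \int[leb n.+1]_x f x = \int[mu]_t \int[leb n]_v f (cons_rV (t, v)).
Proof.
move=> mf f0 /=; rewrite /lebesgue_step.
rewrite ge0_integral_pushforward//; last exact: measurable_cons_rV.
rewrite preimage_setT fubini_tonelli1//.
  exact: (measurableT_comp mf (@measurable_cons_rV R n)).
by move=> x; exact: f0.
Qed.

Lemma measurable_rVS_tonelli n (f : 'rV[R]_n.+1 -> \bar R) :
  measurable_fun setT f -> (forall x, 0 <= f x) ->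
  measurable_fun [set: R] (fun t => \int[leb n]_v f (cons_rV (t, v))).
Proof.
move=> mf f0.
apply: (@measurable_fun_fubini_tonelli_F _ _ R _ R (leb n)
  (fun p => f (cons_rV p))) => //.
exact: (measurableT_comp mf (@measurable_cons_rV R n)).
Qed.

Lemma measurable_affine_rV n (al : R) (be : 'rV[R]_n) :
  measurable_fun setT (fun x : 'rV[R]_n => al *: x + be)%R.
Proof.
apply: measurable_fun_rV => i.
under eq_fun do rewrite !mxE.
apply: measurable_funD => //; apply: measurable_funM => //.
exact: measurable_coord.
Qed.

(** Tonelli splits off the first coordinate, on which the map is affine in one
    variable; the others are the induction hypothesis. *)
Lemma ge0_integral_affine_rV n (al : R) (be : 'rV[R]_n) (F : 'rV[R]_n -> \bar R) :
  al != 0%R -> measurable_fun setT F -> (forall t, 0 <= F t) ->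
  \int[leb n]_x F x = (`|al| ^+ n)%:E * \int[leb n]_x F (al *: x + be)%R.
Proof.
move=> al0; elim: n be F => [|n IH] be F mF F0.
  rewrite expr0 mul1e; apply: eq_integral => x _; congr (F _).
  by apply/rowP; case.
rewrite ge0_integral_rVS//.
have mFa : measurable_fun setT (fun x : 'rV[R]_n.+1 => F (al *: x + be)%R).
  exact: (measurableT_comp mF (measurable_affine_rV al be)).
rewrite [in RHS] ge0_integral_rVS//.
pose be' : 'rV[R]_n := \row_(j < n) be ord0 (lift ord0 j).
have E t v : (al *: cons_rV (t, v) + be =
    cons_rV (al * t + be ord0 ord0, al *: v + be'))%R.
  apply/rowP => i; rewrite !mxE /=; case: unliftP => [j ->|->] //=.
  by rewrite !mxE.
under [in RHS]eq_integral do under eq_integral do rewrite E.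
pose G t := \int[leb n]_v F (cons_rV (t, v)).
have mG : measurable_fun [set: R] G by exact: measurable_rVS_tonelli.
have G0 t : 0 <= G t by exact: integral_ge0.
rewrite [LHS](ge0_integral_affine (be ord0 ord0) al0 mG G0).
rewrite exprSr EFinM -muleA muleCA; congr (_ * _).
rewrite -ge0_integralZl//; first last.
- by move=> t _; exact: integral_ge0.
- have := measurable_rVS_tonelli mFa (fun x => F0 _).
  by under eq_fun do under eq_integral do rewrite E.
apply: eq_integral => t _; rewrite /G (IH be')//.
exact: measurable_fun_cons_rV.
Qed.

Lemma integrable_affine_rV n (al : R) (be : 'rV[R]_n) (F : 'rV[R]_n -> R) :
  al != 0%R -> (leb n).-integrable setT (EFin \o F) ->
  (leb n).-integrable setT (fun x : 'rV[R]_n => (F (al *: x + be)%R)%:E).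
Proof.
move=> al0 iF.
apply: (integrable_change (k := (`|al| ^+ n)%R) (measurable_affine_rV al be)) iF.
  by rewrite exprn_gt0// normr_gt0.
by move=> G mG G0; exact: ge0_integral_affine_rV.
Qed.

Lemma Rintegral_affine_rV n (al : R) (be : 'rV[R]_n) (F : 'rV[R]_n -> R) :
  al != 0%R -> (leb n).-integrable setT (EFin \o F) ->
  (\int[leb n]_x F x = `|al| ^+ n * \int[leb n]_x F (al *: x + be))%R.
Proof.
move=> al0 iF.
apply: (Rintegral_change (k := (`|al| ^+ n)%R) (measurable_affine_rV al be)) iF.
  by rewrite exprn_gt0// normr_gt0.
by move=> G mG G0; exact: ge0_integral_affine_rV.
Qed.

End rV.

(** * Power weights on the line *)
Section powers.
Context {R : realType}.
Local Notation mu := (@lebesgue_measure R).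

Lemma integral_powR_segment (al a b : R) : (0 < a) -> (a < b) -> al != 1 ->
  (\int[mu]_(t in `[a, b]) (t `^ (- al))%:E =
  ((b `^ (1 - al) - a `^ (1 - al)) / (1 - al))%:E)%E.
Proof.
move=> a0 ab al1.
have al1' : (1 - al) != 0 by rewrite subr_eq0 eq_sym.
pose F (t : R) := (t `^ (1 - al) / (1 - al)).
have dF (x : R) : (0 < x) -> is_derive x 1 F (x `^ (- al)).
  move=> x0; rewrite /F.
  have := is_derive1_powR (1 - al) x0.
  rewrite (_ : (1 - al - 1) = - al); last by ring.
  move=> H.
  rewrite (_ : (fun t => _) = (1 - al)^-1 \*: (powR (R:=R) ^~ (1 - al))).
    by apply: is_derive_eq; rewrite scalerA mulVf// scale1r.
  by apply/funext => t; rewrite mulrC.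
have ltx x : x \in `[a, b] -> (0 < x).
  by rewrite in_itv/= => /andP[ax _]; apply: lt_le_trans ax.
rewrite (@continuous_FTC2 _ _ F)//.
- by rewrite -EFinB /F mulrBl.
- apply: derivable_within_continuous => x /ltx x0.
  by apply: derivable_powR; rewrite in_itv/= x0.
- have cF (x : R) : (0 < x) -> {for x, continuous F}.
    by move=> /dF[dFx _]; exact/differentiable_continuous/derivable1_diffP.
  split.
  + move=> x xab; have := dF x (ltx _ (subset_itv_oo_cc xab)); by case.
  + by apply: cvg_at_right_filter; exact: cF.
  + by apply: cvg_at_left_filter; apply: cF; exact: lt_trans ab.
- move=> x xab; have := dF x (ltx _ (subset_itv_oo_cc xab)) => ?.
  by rewrite derive1E derive_val.
Qed.

Definition pwpos (al1 al2 t : R) : R :=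
  if 0 < t then (if t < 1 then t `^ (- al1) else t `^ (- al2)) else 0.

Lemma pwpos_ge0 al1 al2 t : 0 <= pwpos al1 al2 t.
Proof. by rewrite /pwpos; do 2 case: ifP => // _; exact: powR_ge0. Qed.

Lemma measurable_pwpos al1 al2 : measurable_fun [set: R] (pwpos al1 al2).
Proof.
apply: measurable_fun_ifT => //; first exact: measurable_fun_ltr.
by apply: measurable_fun_ifT => //; exact: measurable_fun_ltr.
Qed.

(** The integrals over [1/k, k] are explicit and bounded; they increase to the
    whole integral. *)
Lemma integral_pwpos_lty al1 al2 : al1 < 1 -> 1 < al2 ->
  (\int[mu]_t (pwpos al1 al2 t)%:E < +oo)%E.
Proof.
move=> a1 a2.
have mP := measurable_pwpos al1 al2.
have mPE : measurable_fun [set: R] (EFin \o pwpos al1 al2) by exact/measurable_EFinP.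
have -> : (\int[mu]_t (pwpos al1 al2 t)%:E =
    \int[mu]_(t in `]0%R, +oo[) (pwpos al1 al2 t)%:E)%E.
  rewrite [RHS]integral_mkcond; apply: eq_integral => t _.
  rewrite patchE; case: ifPn => //; rewrite notin_setE/= in_itv/= andbT => /negP.
  by rewrite /pwpos => /negbTE ->.
pose F (i : nat) : set R := `[i.+2%:R^-1, i.+2%:R]%classic.
have -> : `]0, +oo[%classic = \bigcup_i F i.
  apply/seteqP; split => t /=; rewrite ?in_itv/= ?andbT.
    move=> t0; exists (maxn (Num.truncn t) (Num.truncn t^-1)) => //.
    rewrite /F/= in_itv/=; apply/andP; split.
      rewrite invf_ple ?posrE// ltW//.
      apply: lt_le_trans (truncnS_gt _) _.
      by rewrite ler_nat ltnS leqW// leq_maxr.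
    apply/ltW/(lt_le_trans (truncnS_gt _)).
    by rewrite ler_nat ltnS leqW// leq_maxl.
  move=> [i _]; rewrite /F/= in_itv/= => /andP[+ _].
  by apply: lt_le_trans; rewrite invr_gt0.
pose C := (1 - al1)^-1 + (al2 - 1)^-1.
have ndF : nondecreasing_seq F.
  move=> i j ij; apply/subsetPset => t; rewrite /F/= !in_itv/= => /andP[h1 h2].
  apply/andP; split; last by apply: (le_trans h2); rewrite ler_nat !ltnS.
  by apply: le_trans h1; rewrite lef_pV2 ?posrE// ler_nat !ltnS.
apply: (@le_lt_trans _ _ C%:E); last exact: ltry.
have mFi i : measurable (F i) by exact: measurable_itv.
have cF : (\int[mu]_(x in F i) (EFin \o pwpos al1 al2) x @[i --> \oo] -->
    \int[mu]_(x in \bigcup_i F i) (EFin \o pwpos al1 al2) x)%E.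
  apply: ge0_nondecreasing_set_cvg_integral => //.
  - by move=> i; exact: measurable_funTS.
  - by move=> i x _; rewrite lee_fin; exact: pwpos_ge0.
rewrite -(cvg_lim _ cF)//; apply: lime_le; first by apply/cvg_ex; eexists; exact: cF.
apply: nearW => i.
have i1 : (i.+2%:R^-1 : R) < 1 by rewrite invf_lt1 ?ltr1n// ltr0n.
have i2 : (1 : R) < i.+2%:R by rewrite ltr1n.
have i0 : (0 : R) < i.+2%:R^-1 by rewrite invr_gt0 ltr0n.
have -> : F i = `[(i.+2%:R^-1)%R, 1%R[%classic `|` `[1%R, (i.+2%:R)%R]%classic.
  rewrite /F -itv_bndbnd_setU// bnd_simp; exact/ltW.
rewrite ge0_integral_setU//=; first last.
- rewrite disj_set2E; apply/eqP; rewrite -subset0 => t []/=; rewrite !in_itv/=.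
  by move=> /andP[_ t1] /andP[]; rewrite leNgt t1.
- by move=> x _; rewrite lee_fin; exact: pwpos_ge0.
- exact: measurable_funTS.
rewrite /C EFinD; apply: leeD.
  apply: (@le_trans _ _ (\int[mu]_(t in `[(i.+2%:R^-1)%R, 1%R]) (t `^ (- al1))%:E)%E).
    apply: (@le_trans _ _ (\int[mu]_(t in `[(i.+2%:R^-1)%R, 1%R[) (t `^ (- al1))%:E)%E).
      apply: le_of_eq; apply: eq_integral => t.
      rewrite inE/= in_itv/= => /andP[h1 h2]; rewrite /pwpos h2.
      by rewrite (lt_le_trans i0 h1).
    apply: ge0_subset_integral => //.
      apply/measurable_EFinP; apply: measurable_funTS; exact: measurable_powR.
      by move=> t _; rewrite lee_fin powR_ge0.
    by move=> t /=; rewrite !in_itv/= => /andP[h1 h2]; rewrite h1 ltW.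
  rewrite integral_powR_segment//; last by rewrite lt_eqF.
  rewrite lee_fin -[leRHS]mul1r ler_pM2r ?invr_gt0 ?subr_gt0//.
  by rewrite powR1 lerBlDr lerDl powR_ge0.
apply: (@le_trans _ _ (\int[mu]_(t in `[1%R, (i.+2%:R)%R]) (t `^ (- al2))%:E)%E).
  apply: le_of_eq; apply: eq_integral => t.
  rewrite inE/= in_itv/= => /andP[h1 h2]; rewrite /pwpos (lt_le_trans ltr01 h1).
  by rewrite ltNge h1.
rewrite integral_powR_segment//; last by rewrite gt_eqF.
rewrite lee_fin -[leRHS]mul1r -[X in X / (1 - al2)]opprK opprB -[1 - al2]opprB.
rewrite invrN mulrNN ler_pM2r ?invr_gt0 ?subr_gt0//.
by rewrite powR1 lerBlDr lerDl powR_ge0.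
Qed.

(** The value at 0 is infinite so that bounds by [pw al1 al2] hold everywhere. *)
Definition pw (al1 al2 t : R) : \bar R :=
  if t == 0 then +oo%E else (if `|t| < 1 then `|t| `^ (- al1) else `|t| `^ (- al2))%:E.

Lemma pw_ge0 al1 al2 t : (0 <= pw al1 al2 t)%E.
Proof.
rewrite /pw; case: ifP => _; first exact: leey.
by rewrite lee_fin; case: ifP => _; exact: powR_ge0.
Qed.

Lemma pwE al1 al2 t : (pw al1 al2 t = (pwpos al1 al2 t)%:E +
  ((pwpos al1 al2 (- t))%:E + (if t == 0%R then +oo else 0)))%E.
Proof.
rewrite /pw /pwpos oppr_gt0; case: (ltgtP 0 t) => t0.
- by rewrite gtr0_norm// adde0 addr0.
- by rewrite ltr0_norm// adde0 add0r.
- by rewrite addey// addey.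
Qed.

Lemma measurable_pw al1 al2 : measurable_fun [set: R] (pw al1 al2).
Proof.
rewrite /pw; apply: measurable_fun_ifT => //.
  by apply: measurable_fun_eqr.
apply/measurable_EFinP.
apply: measurable_fun_ifT.
- by apply: measurable_fun_ltr => //; exact: normr_measurable.
- exact: (measurableT_comp (measurable_powR _) (@normr_measurable R setT)).
- exact: (measurableT_comp (measurable_powR _) (@normr_measurable R setT)).
Qed.

Lemma integral_pw_lty al1 al2 : al1 < 1 -> 1 < al2 ->
  (\int[mu]_t pw al1 al2 t < +oo)%E.
Proof.
move=> a1 a2; have Ip := integral_pwpos_lty a1 a2.
under eq_integral do rewrite pwE.
have mP : measurable_fun [set: R] (fun t => (pwpos al1 al2 t)%:E).
  by apply/measurable_EFinP; exact: measurable_pwpos.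
have mN : measurable_fun [set: R] (fun t => (pwpos al1 al2 (- t))%:E).
  by apply/measurable_EFinP; apply: measurableT_comp => //; exact: measurable_pwpos.
have m0 : measurable_fun [set: R] (fun t : R => if t == 0 then +oo%E else 0%E : \bar R).
  by apply: measurable_fun_ifT => //; apply: measurable_fun_eqr.
have n0 (t : R) : (0 <= (if t == 0%R then +oo else 0) :> \bar R)%E.
  by case: ifP => // _; exact: leey.
rewrite ge0_integralD//=; first last.
- exact: emeasurable_funD.
- by move=> t _; rewrite adde_ge0// lee_fin pwpos_ge0.
- by move=> t _; rewrite lee_fin pwpos_ge0.
rewrite ge0_integralD//=; last by move=> t _; rewrite lee_fin pwpos_ge0.
have -> : (\int[mu]_t (if t == 0%R then +oo else 0) = 0)%E.
  rewrite -[RHS](integral_set1 (fun=> +oo%E) 0) [RHS]integral_mkcond.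
  apply: eq_integral => t _; rewrite patchE; case: eqP => [->|t0].
    by rewrite mem_set.
  by rewrite memNset.
rewrite adde0; apply: lte_add_pinfty; first exact: Ip.
have nz : (-1 : R) != 0 by rewrite oppr_eq0 oner_eq0.
have n1 (t : R) : (0 <= (pwpos al1 al2 t)%:E)%E by rewrite lee_fin pwpos_ge0.
move: Ip; rewrite (ge0_integral_affine 0 nz mP n1) normrN1 mul1e.
by under eq_integral do rewrite mulN1r addr0.
Qed.

End powers.

(** * Integration over R^n by coordinates *)
Section rV2.
Context {R : realType}.
Local Notation mu := (@lebesgue_measure R).
Local Notation leb n := (lebesgue_rV R n).

Definition tail_rV n (x : 'rV[R]_n.+1) : 'rV[R]_n := \row_j x ord0 (lift ord0 j).

Lemma cons_rV0 n t (v : 'rV[R]_n) : cons_rV (t, v) ord0 ord0 = t.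
Proof. by rewrite mxE unlift_none. Qed.

Lemma cons_rVS n t (v : 'rV[R]_n) j : cons_rV (t, v) ord0 (lift ord0 j) = v ord0 j.
Proof. by rewrite mxE liftK. Qed.

Lemma tail_cons_rV n t (v : 'rV[R]_n) : tail_rV (cons_rV (t, v)) = v.
Proof. by apply/rowP => j; rewrite mxE cons_rVS. Qed.

Lemma measurable_tail_rV n : measurable_fun setT (@tail_rV n).
Proof.
apply: measurable_fun_rV => i; under eq_fun do rewrite mxE.
exact: measurable_coord.
Qed.

Lemma emeasurable_prod d (T : measurableType d) (I : Type) (s : seq I)
    (u : I -> T -> \bar R) : (forall i, measurable_fun setT (u i)) ->
  measurable_fun setT (fun x => \big[mule/1%E]_(i <- s) u i x).
Proof.
move=> mu_; elim: s => [|i s IH].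
  rewrite [X in measurable_fun _ X](_ : _ = cst 1%E).
    exact: measurable_cst.
  by apply/funext => x; rewrite big_nil.
rewrite [X in measurable_fun _ X](_ : _ =
    (fun x => u i x * \big[mule/1%E]_(i <- s) u i x)%E).
  exact: emeasurable_funM.
by apply/funext => x; rewrite big_cons.
Qed.

Lemma prode_ge0 (I : Type) (s : seq I) (u : I -> \bar R) :
  (forall i, 0 <= u i)%E -> (0 <= \big[mule/1%E]_(i <- s) u i)%E.
Proof.
by move=> u0; elim/big_ind : _ => // x y x0 y0; exact: mule_ge0.
Qed.

Lemma ge0_integral_prod_rV n (w : 'I_n -> R -> \bar R) :
  (forall i, measurable_fun [set: R] (w i)) -> (forall i t, 0 <= w i t)%E ->
  (\int[leb n]_x \big[mule/1]_(i < n) w i (x ord0 i) =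
   \big[mule/1]_(i < n) \int[mu]_t w i t)%E.
Proof.
elim: n w => [|n IH] w mw w0.
  under eq_integral do rewrite big_ord0.
  by rewrite big_ord0 /= integral_dirac// diracE mem_set// mule1.
have mprod k (u : 'I_k -> R -> \bar R) : (forall i, measurable_fun [set: R] (u i)) ->
    measurable_fun setT (fun x : 'rV[R]_k => \big[mule/1%E]_(i < k) u i (x ord0 i)).
  move=> mu_; apply: (emeasurable_prod _ (u := fun i (x : 'rV[R]_k) => u i (x ord0 i))).
  by move=> i; exact: (measurableT_comp (mu_ i) (measurable_coord i)).
rewrite ge0_integral_rVS; [|exact: mprod _ _ mw|by move=> x; exact: prode_ge0].
under eq_integral => t _.
  under eq_integral => v _.
    rewrite big_ord_recl cons_rV0.
    under eq_bigr => j _ do rewrite cons_rVS.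
    over.
  rewrite ge0_integralZl; [|exact: measurableT|exact: mprod _ _ (fun j => mw (lift ord0 j))|by move=> *; exact: prode_ge0|exact: w0].
  rewrite (IH (fun j => w (lift ord0 j))); [|by move=> i; exact: mw|by move=> i ?; exact: w0].
  over.
rewrite big_ord_recl ge0_integralZr//; first exact: mw.
by apply: prode_ge0 => j; exact: integral_ge0.
Qed.

End rV2.

Section dominated.
Context {R : realType}.

Lemma dominated_integrable d (T : measurableType d) (m : {measure set T -> \bar R})
    (F G : T -> R) : measurable_fun setT F -> m.-integrable setT (EFin \o G) ->
  (forall x, `|F x| <= G x) -> m.-integrable setT (EFin \o F).
Proof.
move=> mF iG FG; apply: le_integrable iG => //; first exact/measurable_EFinP.
by move=> x _ /=; rewrite lee_fin (le_trans (FG x))// ler_norm.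
Qed.

Lemma dominated_normr_Rintegral d (T : measurableType d)
    (m : {measure set T -> \bar R}) (F G : T -> R) :
  measurable_fun setT F -> m.-integrable setT (EFin \o G) ->
  (forall x, `|F x| <= G x) -> `|\int[m]_x F x| <= \int[m]_x G x.
Proof.
move=> mF iG FG; have iF := dominated_integrable mF iG FG.
apply: le_trans (le_normr_Rintegral measurableT iF) _.
by apply: le_Rintegral => //; exact: integrable_norm.
Qed.

Context d1 d2 (T1 : measurableType d1) (T2 : measurableType d2).
Variables (m1 : {sigma_finite_measure set T1 -> \bar R})
  (m2 : {sigma_finite_measure set T2 -> \bar R}).
Variables (f : T1 * T2 -> R) (A : T1 -> R) (B : T2 -> R).
Hypotheses (mf : measurable_fun setT f)
  (iA : m1.-integrable setT (EFin \o A)) (iB : m2.-integrable setT (EFin \o B))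
  (fAB : forall x y, `|f (x, y)| <= A x * B y).

Lemma dominated_section1 x : m2.-integrable setT (fun y => (f (x, y))%:E).
Proof.
apply: (@dominated_integrable _ _ m2 (fun y => f (x, y)) (fun y => A x * B y)) => //.
  exact: (measurableT_comp mf (measurable_pair1 x)).
exact: (integrableZl measurableT (A x) iB).
Qed.

Lemma dominated_section2 y : m1.-integrable setT (fun x => (f (x, y))%:E).
Proof.
apply: (@dominated_integrable _ _ m1 (fun x => f (x, y)) (fun x => A x * B y)) => //.
  exact: (measurableT_comp mf (measurable_pair2 y)).
exact: (integrableZr measurableT (B y) iA).
Qed.

(** A product majorant A(x) B(y) is integrable for the product measure, which
    is all that the theorem of Fubini requires. *)
Lemma dominated_product : (m1 \x m2)%E.-integrable setT (EFin \o f).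
Proof.
apply/integrable12ltyP; first exact/measurable_EFinP.
have iA' := integrable_abse iA; have iB' := integrable_abse iB.
have mA : measurable_fun setT A by apply/measurable_EFinP; case/integrableP : iA.
have mB : measurable_fun setT B by apply/measurable_EFinP; case/integrableP : iB.
apply: (@le_lt_trans _ _
    (\int[m1]_x (`|A x|%:E * \int[m2]_y `|B y|%:E))%E).
  apply: ge0_le_integral => //.
  - by move=> x _; exact: integral_ge0.
  - apply: (@measurable_fun_fubini_tonelli_F _ _ T1 T2 R m2 (fun p => `|f p|%:E)) => //.
    exact/measurable_EFinP/measurableT_comp.
  - by apply: emeasurable_funM => //; apply/measurable_EFinP; exact: measurableT_comp.
  - move=> x _; rewrite -ge0_integralZl//; last first.
      by apply/measurable_EFinP; exact: measurableT_comp.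
    apply: ge0_le_integral => //.
    + apply/measurable_EFinP/measurableT_comp => //.
      exact: (measurableT_comp mf (measurable_pair1 x)).
    + by apply: emeasurable_funM => //; apply/measurable_EFinP; exact: measurableT_comp.
    + move=> y _; rewrite -EFinM lee_fin -normrM.
      by rewrite (le_trans (fAB x y)) ?ler_norm.
rewrite ge0_integralZr//; last 2 first.
- by apply/measurable_EFinP; exact: measurableT_comp.
- exact: integral_ge0.
have /integrableP[_ fA] := iA; have /integrableP[_ fB] := iB.
by rewrite lte_mul_pinfty ?integral_ge0// ge0_fin_numE ?integral_ge0.
Qed.

Lemma Rintegral_fubini :
  \int[m1]_x \int[m2]_y f (x, y) = \int[m2]_y \int[m1]_x f (x, y).
Proof.
rewrite /Rintegral; congr fine.
transitivity (\int[m1]_x \int[m2]_y (f (x, y))%:E)%E.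
  apply: eq_integral => x _; rewrite fineK//.
  exact: (integrable_fin_num measurableT (dominated_section1 x)).
rewrite (Fubini dominated_product); apply: eq_integral => y _; rewrite fineK//.
exact: (integrable_fin_num measurableT (dominated_section2 y)).
Qed.

Lemma Rintegral_fubini1 :
  \int[m1]_x \int[m2]_y f (x, y) = \int[(m1 \x m2)%E]_z f z.
Proof.
rewrite /Rintegral; congr fine.
transitivity (\int[m1]_x \int[m2]_y (f (x, y))%:E)%E; last first.
  exact: (integral12_prod_meas1 dominated_product).
apply: eq_integral => x _; rewrite fineK//.
exact: (integrable_fin_num measurableT (dominated_section1 x)).
Qed.

Lemma integrable_fubini1 :
  m1.-integrable setT (fun x => (\int[m2]_y f (x, y))%:E).
Proof.
have := integrable_fubini_F dominated_product; apply: eq_integrable => // x _.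
rewrite /fubini_F /Rintegral fineK//.
exact: (integrable_fin_num measurableT (dominated_section1 x)).
Qed.

Lemma integrable_fubini2 :
  m2.-integrable setT (fun y => (\int[m1]_x f (x, y))%:E).
Proof.
have mG : measurable_fun setT (fun y => \int[m1]_x f (x, y)).
  apply/measurable_EFinP; have := measurable_fubini_G dominated_product.
  rewrite (_ : fubini_G _ _ = EFin \o (fun y => \int[m1]_x f (x, y)))//.
  apply/funext => y; rewrite /fubini_G /Rintegral /= fineK//.
  exact: (integrable_fin_num measurableT (dominated_section2 y)).
apply: (@dominated_integrable _ _ m2 _ (fun y => (\int[m1]_x A x) * B y)) => //.
  exact: (integrableZl measurableT (\int[m1]_x A x) iB).
move=> y; rewrite -RintegralZr//; apply: dominated_normr_Rintegral => //.
  exact: (measurableT_comp mf (measurable_pair2 y)).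
exact: (integrableZr measurableT (B y) iA).
Qed.

End dominated.

Section dominated_rV.
Context {R : realType}.
Local Notation mu := (@lebesgue_measure R).
Local Notation leb n := (lebesgue_rV R n).
Variables (n : nat) (F : 'rV[R]_n.+1 -> R) (A : R -> R) (B : 'rV[R]_n -> R).
Hypotheses (mF : measurable_fun setT F)
  (iA : mu.-integrable setT (EFin \o A)) (iB : (leb n).-integrable setT (EFin \o B))
  (FAB : forall t v, `|F (cons_rV (t, v))| <= A t * B v).

Let mFc : measurable_fun [set: (measurableTypeR R * 'rV[R]_n)%type]
  (F \o @cons_rV R n).
Proof. exact: (measurableT_comp mF (@measurable_cons_rV R n)). Qed.

Lemma dominated_rVS : (leb n.+1).-integrable setT (EFin \o F).
Proof.
have /integrableP[_ iFc] := dominated_product mFc iA iB FAB.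
apply/integrableP; split; first exact/measurable_EFinP.
move: iFc; rewrite /= /lebesgue_step ge0_integral_pushforward//.
- exact: measurable_cons_rV.
- by apply/measurable_EFinP; exact: measurableT_comp.
Qed.

Lemma Rintegral_rVS :
  \int[leb n.+1]_x F x = \int[mu]_t \int[leb n]_v F (cons_rV (t, v)).
Proof.
rewrite (Rintegral_fubini1 mFc iA iB FAB)/Rintegral /= /lebesgue_step.
rewrite integral_pushforward//.
- exact: measurable_cons_rV.
- exact/measurable_EFinP.
- exact: (dominated_product mFc iA iB FAB).
Qed.

End dominated_rV.

(** * Continuous functions are Borel *)
Section continuous_rV.
Context {R : realType}.

Lemma rV_norm_lt n (x : 'rV[R]_n) (d : R) : 0 < d ->
  (forall i, `|x ord0 i| < d) -> `|x| < d.
Proof.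
move=> d0 xd; have [x0|/mx_norm_neq0[[i j] /= xij]] := eqVneq (mx_norm x) 0.
  by rewrite /Num.norm/= x0.
by rewrite /Num.norm/= xij; rewrite (ord1 i); exact: xd.
Qed.

(** f is the pointwise limit of its compositions with the rounding to the grid
    Z^n / k, which takes countably many values, each on a product of intervals. *)
Lemma continuous_measurable_rV n (f : 'rV[R]_n -> R) :
  continuous f -> measurable_fun setT f.
Proof.
move=> cf.
pose g (k : nat) (x : 'rV[R]_n) : 'rV[int]_n := \row_i Num.floor (k.+1%:R * x ord0 i).
pose h (k : nat) (z : 'rV[int]_n) : 'rV[R]_n := \row_i ((z ord0 i)%:~R / k.+1%:R).
apply: (@measurable_fun_cvg _ _ _ _ (fun k x => f (h k (g k x)))) => [k|x _].
  move=> _ Y mY; rewrite setTI.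
  rewrite (_ : _ @^-1` _ = \bigcup_z ([set x | Y (f (h k z))] `&` g k @^-1` [set z])); last first.
    apply/seteqP; split=> x /=; first by move=> ?; exists (g k x).
    by move=> [z _ [Yz /= gz]]; rewrite -gz in Yz.
  apply: countable_bigcupT_measurable; first exact: countableP.
  move=> z; have [Yz|nYz] := pselect (Y (f (h k z))); last first.
    by rewrite (_ : _ `&` _ = set0)//; apply/seteqP; split => x // [].
  rewrite (_ : _ `&` _ = \bigcap_(i in [set: 'I_n])
      ((fun x : 'rV[R]_n => Num.floor (k.+1%:R * x ord0 i)) @^-1` [set z ord0 i])).
    apply: fin_bigcap_measurable; first exact: finite_finset.
    move=> i _; rewrite (_ : _ @^-1` _ = (fun x : 'rV[R]_n => x ord0 i) @^-1`
        `[(z ord0 i)%:~R / k.+1%:R, (z ord0 i + 1)%:~R / k.+1%:R[%classic).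
      rewrite -[X in measurable X]setTI; exact: measurable_coord.
    apply/seteqP; split => x /=; rewrite in_itv/= ler_pdivrMr// ltr_pdivlMr// mulrC.
      by move=> <-; rewrite floor_le floorD1_gt.
    exact: floor_def.
  apply/seteqP; split => x /=.
    by move=> [_ <-] i _ /=; rewrite mxE.
  by move=> H; split => //; apply/rowP => i; rewrite mxE; exact: H.
have cfx := cf x.
apply: (cvg_comp _ f _ (cf x)).
apply/cvgrPdist_lt => e e0; near=> k.
apply: rV_norm_lt => // i; rewrite !mxE.
have k0 : (0 : R) < k.+1%:R by [].
rewrite -(@ltr_pM2r _ k.+1%:R)// -[X in _ * X]gtr0_norm// -normrM.
rewrite mulrBl -mulrA mulVf ?gt_eqF// mulr1 mulrC.
have := floor_le (k.+1%:R * x ord0 i); have := floorD1_gt (k.+1%:R * x ord0 i).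
rewrite intrD => h1 h2; rewrite ger0_norm ?subr_ge0//.
apply: (@lt_le_trans _ _ 1); first by rewrite ltrBlDl.
rewrite -ler_pdivrMr// div1r; apply/ltW; near: k.
exact: near_infty_natSinv_lt (PosNum e0).
Unshelve. all: by end_near. Qed.

End continuous_rV.

(** * The Euclidean norm and an integrable weight *)
Lemma sum_sqr_le (R : realType) n (u : 'I_n -> R) :
  \sum_(i < n) u i ^+ 2 <= (\sum_(i < n) `|u i|) ^+ 2.
Proof.
elim: n u => [|k IH] u; first by rewrite !big_ord0 expr0n.
rewrite !big_ord_recl sqrrD -addrA lerD//; first by rewrite real_normK// num_real.
by apply: (le_trans (IH _)); rewrite lerDr mulrn_wge0// mulr_ge0// sumr_ge0.
Qed.

Section enorm.
Context {R : realType} {n : nat}.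
Implicit Types x y : 'rV[R]_n.

Lemma enorm_ge0 x : 0 <= enorm x.
Proof. exact: sqrtr_ge0. Qed.

Lemma coord_le_enorm x i : `|x ord0 i| <= enorm x.
Proof.
rewrite -sqrtr_sqr; apply: ler_wsqrtr.
by rewrite (bigD1 i)//= lerDl sumr_ge0// => j _; exact: sqr_ge0.
Qed.

Lemma enormZ a x : enorm (a *: x) = `|a| * enorm x.
Proof.
rewrite /enorm -sqrtr_sqr -sqrtrM ?sqr_ge0//; congr Num.sqrt.
by rewrite mulr_sumr; apply: eq_bigr => i _; rewrite mxE exprMn.
Qed.

Lemma enorm_le_sum x : enorm x <= \sum_(i < n) `|x ord0 i|.
Proof.
have s0 : 0 <= \sum_(i < n) `|x ord0 i| by exact: sumr_ge0.
rewrite -(ger0_norm s0) -sqrtr_sqr; apply: ler_wsqrtr.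
exact: sum_sqr_le.
Qed.

Lemma sum_le_enorm x : \sum_(i < n) `|x ord0 i| <= n%:R * enorm x.
Proof.
apply: (@le_trans _ _ (\sum_(i < n) enorm x)).
  by apply: ler_sum => i _; exact: coord_le_enorm.
by rewrite sumr_const card_ord mulr_natl.
Qed.

Lemma measurable_enorm : measurable_fun setT (@enorm R n).
Proof.
apply: (measurableT_comp (continuous_measurable_fun (@sqrt_continuous R))).
apply: measurable_sum => i; apply: measurable_funX; exact: measurable_coord.
Qed.

End enorm.

Section weights.
Context {R : realType}.
Local Notation mu := (@lebesgue_measure R).
Local Notation leb n := (lebesgue_rV R n).
Variable s : R.
Hypotheses (s_gt0 : 0 < s) (s_lt1 : s < 1).
Variable m : nat.
Local Notation n := m.+1.

(** With n al1 = n + s - 1 < n and n al2 = n + s / 2 > n, the n-fold product of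
    [pw al1 al2] is integrable and majorizes [weight]. *)
Definition al1 : R := (n%:R + s - 1) / n%:R.
Definition al2 : R := (n%:R + s / 2) / n%:R.

Lemma al1_ge0 : 0 <= al1.
Proof. by rewrite divr_ge0// -addrA addrC -addrA addr_ge0 ?subr_ge0 ?ler1n// ltW. Qed.

Lemma al1_lt1 : al1 < 1.
Proof. by rewrite ltr_pdivrMr// mul1r -addrA gtrDl subr_lt0. Qed.

Lemma al2_gt1 : 1 < al2.
Proof. by rewrite ltr_pdivlMr// mul1r ltrDl divr_gt0. Qed.

Definition pwv (E : R) : R := if E < 1 then E `^ (- al1) else E `^ (- al2).

Lemma pwv_ge0 E : 0 <= pwv E.
Proof. by rewrite /pwv; case: ifP => _; exact: powR_ge0. Qed.

Lemma powR_anti (a x y : R) : 0 <= a -> 0 < x -> x <= y -> y `^ (- a) <= x `^ (- a).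
Proof.
move=> a0 x0 xy; rewrite !powRN lef_pV2 ?posrE ?powR_gt0//; last exact: lt_le_trans xy.
by apply: ge0_ler_powR => //; rewrite nnegrE ltW//; exact: lt_le_trans xy.
Qed.

Lemma pwv_anti x y : 0 < x -> x <= y -> pwv y <= pwv x.
Proof.
move=> x0 xy; rewrite /pwv.
have a2 : 0 <= al2 by rewrite (le_trans ler01)// ltW// al2_gt1.
case: ltP => y1.
  by rewrite (le_lt_trans xy y1) powR_anti// al1_ge0.
case: ltP => x1; last exact: powR_anti.
apply: (@le_trans _ _ 1).
  by have := powR_anti a2 ltr01 y1; rewrite powR1.
by have := powR_anti al1_ge0 x0 (ltW x1); rewrite powR1.
Qed.

Lemma pwv_le_pw E t : 0 < E -> `|t| <= E -> ((pwv E)%:E <= pw al1 al2 t)%E.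
Proof.
move=> E0 tE; rewrite /pw; case: eqVneq => [_|t0]; first exact: leey.
by rewrite lee_fin -/(pwv `|t|) pwv_anti// normr_gt0.
Qed.

(** Comparable to the gain from a Lipschitz bound near the origin, with enough
    decay left at infinity against the power - (n + s). *)
Definition minpow (E : R) : R := Num.min E (E `^ (s / 2)).

Definition weight (x : 'rV[R]_n) : R :=
  enorm x `^ (- (n%:R + s)) * minpow (enorm x).

Lemma minpow_ge0 E : 0 <= E -> 0 <= minpow E.
Proof. by move=> E0; rewrite le_min E0 powR_ge0. Qed.

Lemma minpow_small E : 0 <= E -> E < 1 -> minpow E = E.
Proof.
rewrite le_eqVlt => /predU1P[<-|E0 E1]; first by rewrite /minpow min_l// powR_ge0.
rewrite /minpow min_l//; apply: ger1_powR; first by rewrite E0 ltW.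
by rewrite ler_pdivrMr// mul1r (le_trans (ltW s_lt1))// ler1n.
Qed.

Lemma minpow_large E : 1 <= E -> minpow E = E `^ (s / 2).
Proof.
move=> E1; rewrite /minpow min_r//; apply: ler1_powR => //.
by rewrite ler_pdivrMr// mul1r (le_trans (ltW s_lt1))// ler1n.
Qed.

(** The exponents [al1] and [al2] are chosen for this identity, which lets the
    coordinates share the decay equally. *)
Lemma minpow_pwv E : 0 < E -> E `^ (- (n%:R + s)) * minpow E = pwv E ^+ n.
Proof.
move=> E0; have n0 : (n%:R : R) != 0 by rewrite pnatr_eq0.
rewrite /pwv; case: ltP => E1.
  rewrite minpow_small// ?ltW// -[X in _ * X]powRr1 ?ltW//.
  rewrite -powRD; last by rewrite (gt_eqF E0) implybT.
  rewrite -powR_mulrn ?powR_ge0// -powRrM; congr (_ `^ _).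
  by rewrite /al1; field.
rewrite minpow_large// -powRD; last by rewrite (gt_eqF E0) implybT.
rewrite -powR_mulrn ?powR_ge0// -powRrM; congr (_ `^ _).
by rewrite /al2; field.
Qed.

Lemma prod_pwv_le k E (h : 'I_k -> R) : 0 < E -> (forall j, `|h j| <= E) ->
  ((pwv E ^+ k)%:E <= \big[mule/1]_(j < k) pw al1 al2 (h j))%E.
Proof.
move=> E0; elim: k h => [|k IH] h hE; first by rewrite big_ord0 expr0.
rewrite big_ord_recl exprS EFinM; apply: lee_pmul.
- by rewrite lee_fin pwv_ge0.
- by rewrite lee_fin exprn_ge0// pwv_ge0.
- exact: pwv_le_pw.
- by apply: IH.
Qed.

Lemma weight_ge0 x : 0 <= weight x.
Proof. by rewrite mulr_ge0 ?powR_ge0// minpow_ge0 ?enorm_ge0. Qed.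

Lemma weight_le_prod x :
  ((weight x)%:E <= \big[mule/1]_(j < n) pw al1 al2 (x ord0 j))%E.
Proof.
have [x0|x0] := eqVneq (enorm x) 0.
  rewrite /weight x0 minpow_small// mulr0.
  by apply: prode_ge0 => j; exact: pw_ge0.
have E0 : 0 < enorm x by rewrite lt_neqAle eq_sym x0 enorm_ge0.
rewrite /weight minpow_pwv//; apply: prod_pwv_le => // j; exact: coord_le_enorm.
Qed.

Lemma measurable_minpow : measurable_fun [set: R] minpow.
Proof. by apply: measurable_minr => //; exact: measurable_powR. Qed.

Lemma measurable_weight : measurable_fun setT weight.
Proof.
apply: measurable_funM.
  exact: (measurableT_comp (measurable_powR _) measurable_enorm).
exact: (measurableT_comp measurable_minpow measurable_enorm).
Qed.

Lemma prode_lty k (u : 'I_k -> \bar R) : (forall j, 0 <= u j < +oo)%E ->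
  (\big[mule/1]_(j < k) u j < +oo)%E.
Proof.
move=> u0; suff : (\big[mule/1]_(j < k) u j \is a fin_num)%E.
  by move=> /fin_numPlt/andP[].
elim/big_ind : _ => // [x y|j _]; first exact: fin_numM.
by have /andP[? ?] := u0 j; rewrite ge0_fin_numE.
Qed.

Lemma integral_prod_lty k (u : 'I_k -> R -> \bar R) :
  (forall j, measurable_fun [set: R] (u j)) -> (forall j t, 0 <= u j t)%E ->
  (forall j, \int[mu]_t u j t < +oo)%E ->
  (\int[leb k]_x \big[mule/1]_(j < k) u j (x ord0 j) < +oo)%E.
Proof.
move=> mu_ u0 iu; rewrite ge0_integral_prod_rV//; apply: prode_lty => j.
by rewrite integral_ge0//=.
Qed.

Lemma integrable_weight : (leb n).-integrable setT (EFin \o weight).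
Proof.
apply/integrableP; split; first by apply/measurable_EFinP; exact: measurable_weight.
apply: le_lt_trans (@integral_prod_lty n (fun _ => pw al1 al2) _ _ _).
- apply: ge0_le_integral => //.
  + apply/measurable_EFinP; apply: measurableT_comp => //; exact: measurable_weight.
  + apply: (emeasurable_prod _ (u := fun i (x : 'rV[R]_n) => pw al1 al2 (x ord0 i))) => i.
    exact: (measurableT_comp (measurable_pw _ _) (measurable_coord i)).
  + move=> x _; rewrite gee0_abs /= ?lee_fin ?weight_ge0//; exact: weight_le_prod.
- by move=> _; exact: measurable_pw.
- by move=> _; exact: pw_ge0.
- by move=> _; apply: integral_pw_lty; [exact: al1_lt1|exact: al2_gt1].
Qed.

End weights.

(** * The logarithmic weight *)
Section logweight.
Context {R : realType}.
Local Notation mu := (@lebesgue_measure R).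
Local Notation leb n := (lebesgue_rV R n).
Variable s : R.
Hypotheses (s_gt0 : 0 < s) (s_lt1 : s < 1).
Variable m : nat.
Local Notation n := m.+1.
Local Notation al1 := (al1 s m).
Local Notation al2 := (al2 s m).
Local Notation pwv := (pwv s m).
Local Notation minpow := (minpow s).

(** The Frullani integral of the first coordinate, as a function of w_0 = t. *)
Definition logdist (t : R) : R := `|ln `|1 - t| |.

Lemma ln_le_powR (p x : R) : 0 < p -> 0 < x -> ln x <= x `^ p / p.
Proof.
move=> p0 x0; rewrite ler_pdivlMr// mulrC -ln_powR.
exact/ltW/ln_sublinear/powR_gt0.
Qed.

Lemma logdist_small t : `|t| <= 2^-1 -> logdist t <= 2 * `|t|.
Proof.
rewrite /logdist => t2.
have t1 : 2^-1 <= 1 - t by have := ler_norm t; lra.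
have t0 : 0 < 1 - t by lra.
rewrite (gtr0_norm t0) ler_norml; apply/andP; split.
  rewrite lerNl -lnV ?posrE//.
  have i0 : 0 < (1 - t)^-1 by rewrite invr_gt0.
  have : ln (1 + ((1 - t)^-1 - 1)) <= (1 - t)^-1 - 1 by apply: le_ln1Dx; lra.
  rewrite (_ : 1 + ((1 - t)^-1 - 1) = (1 - t)^-1); last by ring.
  move=> /le_trans; apply.
  have -> : (1 - t)^-1 - 1 = t / (1 - t) by field; lra.
  rewrite ler_pdivrMr//; have := ler_norm t; have := normr_ge0 t; nra.
have : ln (1 + - t) <= - t by apply: le_ln1Dx; lra.
move=> /le_trans; apply; have := ler_norm (- t); rewrite normrN; have := normr_ge0 t; lra.
Qed.

Lemma logdist_far t : 1 <= `|1 - t| -> logdist t <= (2 / s) * `|1 - t| `^ (s / 2).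
Proof.
move=> t1; have t0 : 0 < `|1 - t| by exact: lt_le_trans t1.
rewrite /logdist ger0_norm ?ln_ge0//.
apply: (le_trans (ln_le_powR (p := s / 2) _ t0)); first by rewrite divr_gt0.
by rewrite invf_div mulrC.
Qed.

Lemma logdist_near t : t != 1 -> `|1 - t| < 1 -> logdist t <= 2 * `|1 - t| `^ (- 2^-1).
Proof.
move=> t1 t2; have t0 : 0 < `|1 - t| by rewrite normr_gt0 subr_eq0 eq_sym.
rewrite /logdist ler0_norm; last by rewrite -ln1 ler_ln ?posrE// ltW.
rewrite -lnV ?posrE//.
apply: (le_trans (ln_le_powR (p := 2^-1) _ _)); rewrite ?invr_gt0//.
by rewrite invrK mulrC powRN -powR_inv1 ?normr_ge0// -!powRrM mulN1r powRN.
Qed.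

(** The first product takes care of the origin and of infinity, the second one
    of the logarithmic pole along the hyperplane where the first coordinate
    is 1; there the value is infinite. *)
Definition logbound (x : 'rV[R]_n) : \bar R :=
  (\big[mule/1]_(j < n) pw al1 al2 (x ord0 j) +
   pw 2^-1 2 (x ord0 ord0 - 1) *
     \big[mule/1]_(j < m) pw al1 al2 (x ord0 (lift ord0 j)))%E.

Lemma logbound_ge0 x : (0 <= logbound x)%E.
Proof.
apply: adde_ge0; first by apply: prode_ge0 => j; exact: pw_ge0.
by apply: mule_ge0; [exact: pw_ge0|apply: prode_ge0 => j; exact: pw_ge0].
Qed.

Let wt (j : 'I_n) (t : R) : \bar R := if j == ord0 then pw 2^-1 2 (t - 1) else pw al1 al2 t.

Let logboundE x : logbound x = (\big[mule/1]_(j < n) pw al1 al2 (x ord0 j) +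
  \big[mule/1]_(j < n) wt j (x ord0 j))%E.
Proof.
rewrite /logbound; congr (_ + _)%E; rewrite [RHS]big_ord_recl /wt eqxx.
by congr (_ * _)%E; apply: eq_bigr => j _.
Qed.

Let mwt j : measurable_fun [set: R] (wt j).
Proof.
rewrite /wt; case: eqP => _; last exact: measurable_pw.
by apply: (measurableT_comp (measurable_pw _ _)); exact: measurable_funB.
Qed.

Let wt0 j t : (0 <= wt j t)%E.
Proof. by rewrite /wt; case: ifP => _; exact: pw_ge0. Qed.

Let mprod (u : 'I_n -> R -> \bar R) : (forall i, measurable_fun [set: R] (u i)) ->
  measurable_fun setT (fun x : 'rV[R]_n => \big[mule/1%E]_(i < n) u i (x ord0 i)).
Proof.
move=> mu_; apply: (emeasurable_prod _ (u := fun i (x : 'rV[R]_n) => u i (x ord0 i))).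
by move=> i; exact: (measurableT_comp (mu_ i) (measurable_coord i)).
Qed.

Lemma measurable_logbound : measurable_fun setT logbound.
Proof.
rewrite (_ : logbound = (fun x : 'rV[R]_n => \big[mule/1]_(j < n) pw al1 al2 (x ord0 j) +
  \big[mule/1]_(j < n) wt j (x ord0 j))%E); last by apply/funext => x; exact: logboundE.
apply: emeasurable_funD; last exact: mprod mwt.
by apply: (mprod (u := fun=> pw al1 al2)) => _; exact: measurable_pw.
Qed.

Lemma integral_logbound_lty : (\int[leb n]_x logbound x < +oo)%E.
Proof.
under eq_integral do rewrite logboundE.
have m1 : measurable_fun setT (fun x : 'rV[R]_n => \big[mule/1%E]_(j < n) pw al1 al2 (x ord0 j)).
  by apply: (mprod (u := fun=> pw al1 al2)) => _; exact: measurable_pw.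
rewrite ge0_integralD//; first last.
- exact: mprod mwt.
- by move=> x _; apply: prode_ge0.
- by move=> x _; apply: prode_ge0 => j; exact: pw_ge0.
have ipw : (\int[mu]_t pw al1 al2 t < +oo)%E.
  by apply: integral_pw_lty; [exact: al1_lt1|exact: al2_gt1].
apply: lte_add_pinfty.
  exact: (@integral_prod_lty R n (fun=> pw al1 al2) (fun=> measurable_pw _ _)
    (fun=> pw_ge0 _ _) (fun=> ipw)).
apply: integral_prod_lty => // j; rewrite /wt; case: eqP => // _.
have ipw2 : (\int[mu]_t pw (2^-1 : R) 2 t < +oo)%E by apply: integral_pw_lty; lra.
move: ipw2; rewrite (ge0_integral_affine (-1) (oner_neq0 _) (measurable_pw _ _) (pw_ge0 _ _)).
by rewrite normr1 mul1e; under eq_integral do rewrite mul1r.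
Qed.

Lemma logbound_pole (x : 'rV[R]_n) : x ord0 ord0 = 1 -> logbound x = +oo%E.
Proof.
move=> x1; rewrite /logbound x1 subrr {2}/pw eqxx gt0_mulye.
  by rewrite addey// gt_eqF// (@lt_le_trans _ _ 0%E)// prode_ge0// => j; exact: pw_ge0.
elim/big_ind : _ => // [y z|j _]; first exact: mule_gt0.
rewrite /pw; case: eqVneq => [_|t0]; first exact: ltry.
by rewrite lte_fin; case: ifP => _; apply: powR_gt0; rewrite normr_gt0.
Qed.

Lemma minpow_half E : 2^-1 < E -> E `^ (s / 2) <= 2 * minpow E.
Proof.
move=> E2; have E0 : 0 < E by exact: lt_trans E2.
have [E1|E1] := ltP E 1; last by rewrite (minpow_large s_lt1)// ler_pMl ?ler1n ?powR_gt0.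
rewrite (minpow_small s_lt1 (ltW E0) E1).
apply: (@le_trans _ _ 1); last by lra.
have q0 : 0 <= s / 2 by rewrite divr_ge0// ltW.
have := @ge0_ler_powR R _ q0 E 1; rewrite !nnegrE powR1; apply => //; exact: ltW.
Qed.

(** For |t| <= 1/2, with t the first coordinate, the logarithm is O(|t|), and for
    |1 - t| >= 1 it is O(|x|^(s/2)): in both cases it is absorbed by [minpow].
    Near t = 1 the norm of x is at least 1/2, so that the singularity
    |1 - t|^(-1/2) is the only one. *)
Lemma logweight_le : exists2 C : R, 0 < C & forall x : 'rV[R]_n, x ord0 ord0 != 1 ->
  ((enorm x `^ (- (n%:R + s)) * (minpow (enorm x) + logdist (x ord0 ord0)))%:E <=
   C%:E * logbound x)%E.
Proof.
pose q := s / 2; have q0 : 0 < q by rewrite divr_gt0.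
pose C1 := 4 / s * 3 `^ q.
have C10 : 0 < C1 by rewrite mulr_gt0 ?divr_gt0 ?powR_gt0.
exists (3 + C1 + 8) => [|x x1]; first by rewrite !addr_gt0.
have [x0|x0] := eqVneq (enorm x) 0.
  rewrite x0 powR0 ?mul0r; last by rewrite oppr_eq0 gt_eqF// addr_gt0.
  by rewrite mule_ge0 ?logbound_ge0// lee_fin !addr_ge0// ltW.
have E0 : 0 < enorm x by rewrite lt_neqAle eq_sym x0 enorm_ge0.
set t := x ord0 ord0; set E := enorm x; set k := E `^ (- (n%:R + s)).
have tE : `|t| <= E by exact: coord_le_enorm.
have k0 : 0 <= k by exact: powR_ge0.
have M0 : 0 <= minpow E by exact/minpow_ge0/enorm_ge0.
have Pw : ((k * minpow E)%:E <= \big[mule/1]_(j < n) pw al1 al2 (x ord0 j))%E.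
  exact: weight_le_prod.
have PB : ((k * minpow E)%:E <= logbound x)%E.
  apply: (le_trans Pw); rewrite leeDl// mule_ge0 ?pw_ge0//.
  by apply: prode_ge0 => j; exact: pw_ge0.
(* away from t = 1 it suffices to absorb the logarithm into [minpow] *)
have red D : 0 <= D -> 1 + D <= 3 + C1 + 8 -> logdist t <= D * minpow E ->
    ((k * (minpow E + logdist t))%:E <= (3 + C1 + 8)%:E * logbound x)%E.
  move=> D0 DC ld; apply: (@le_trans _ _ ((1 + D)%:E * logbound x)%E); last first.
    by rewrite lee_wpmul2r ?logbound_ge0// lee_fin.
  apply: (@le_trans _ _ ((1 + D)%:E * (k * minpow E)%:E)%E); last first.
    by rewrite lee_wpmul2l// lee_fin addr_ge0.
  by rewrite -EFinM lee_fin; nra.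
have [t2|t2] := leP `|t| 2^-1.
  apply: (red 2); [by []|by lra|].
  apply: (le_trans (logdist_small t2)); rewrite ler_pM2l//.
  have [E1|E1] := ltP E 1; first by rewrite (minpow_small s_lt1 (ltW E0) E1).
  rewrite (minpow_large s_lt1)//; apply: (@le_trans _ _ 1); first by lra.
  have := @ge0_ler_powR R _ (ltW q0) 1 E; rewrite !nnegrE powR1; apply => //; exact: ltW.
have E2 : 2^-1 < E by exact: lt_le_trans tE.
have ME := minpow_half E2.
have [t3|t3] := leP 1 `|1 - t|.
  apply: (red C1); [exact: ltW|by lra|].
  apply: (le_trans (logdist_far t3)).
  have : `|1 - t| `^ q <= 3 `^ q * E `^ q.
    rewrite -powRM//; last exact: ltW.
    have := @ge0_ler_powR R _ (ltW q0) `|1 - t| (3 * E); rewrite !nnegrE; apply => //.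
      by rewrite mulr_ge0// ltW.
    apply: (le_trans (ler_normB _ _)); rewrite normr1; lra.
  move=> h; apply: (@le_trans _ _ (2 / s * (3 `^ q * (2 * minpow E)))); last first.
    by rewrite /C1; apply: le_of_eq; ring.
  rewrite ler_pM2l ?divr_gt0//; apply: (le_trans h).
  by rewrite ler_pM2l ?powR_gt0.
have ld := logdist_near x1 t3.
have Em : ((pwv E ^+ m)%:E <= \big[mule/1]_(j < m) pw al1 al2 (x ord0 (lift ord0 j)))%E.
  by apply: prod_pwv_le => // j; exact: coord_le_enorm.
have pE : pwv E <= 2.
  have a1 : 0 <= al1 by exact: al1_ge0.
  apply: (@le_trans _ _ (pwv 2^-1)).
    by apply: pwv_anti; rewrite ?invr_gt0// ltW.
  rewrite /pwv invf_lt1// ltr1n/=.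
  have -> : 2^-1 `^ (- al1) = 2 `^ al1.
    by rewrite -[2^-1]powR_inv1// -powRrM mulN1r opprK.
  have := @ler_powR R 2 _ al1 1; rewrite powRr1// ler1n; apply => //.
  exact/ltW/al1_lt1.
have kE : k <= 4 * pwv E ^+ m.
  have kM := minpow_pwv s_lt1 m E0; rewrite -/k exprS in kM.
  have M2 : 2^-1 <= minpow E.
    have [E1|E1] := ltP E 1; first by rewrite (minpow_small s_lt1 (ltW E0) E1) ltW.
    rewrite (minpow_large s_lt1)//; apply: (@le_trans _ _ 1); first by lra.
    have := @ge0_ler_powR R _ (ltW q0) 1 E; rewrite !nnegrE powR1; apply => //; exact: ltW.
  have pm0 : 0 <= pwv E ^+ m by rewrite exprn_ge0// pwv_ge0.
  have : k * 2^-1 <= 2 * pwv E ^+ m.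
    apply: (@le_trans _ _ (k * minpow E)); first by rewrite ler_wpM2l.
    by rewrite kM ler_wpM2r.
  by lra.
have pw12 : ((`|1 - t| `^ (- 2^-1))%:E <= pw 2^-1 2 (t - 1))%E.
  by rewrite /pw subr_eq0 (negbTE x1) [`|t - 1|]distrC t3.
rewrite mulrDr EFinD.
have -> : ((3 + C1 + 8)%:E * logbound x = (3 + C1)%:E * logbound x + 8%:E * logbound x)%E.
  by rewrite EFinD ge0_muleDl// lee_fin addr_ge0// ltW.
apply: leeD.
  apply: (le_trans PB); rewrite -[leLHS]mul1e lee_wpmul2r ?logbound_ge0//.
  by rewrite lee_fin; lra.
apply: (@le_trans _ _ (8%:E * (pw 2^-1 2 (t - 1) *
     \big[mule/1]_(j < m) pw al1 al2 (x ord0 (lift ord0 j)))))%E; last first.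
  rewrite lee_wpmul2l// leeDr//.
  by apply: prode_ge0 => j; exact: pw_ge0.
apply: (@le_trans _ _ (8%:E * ((`|1 - t| `^ (- 2^-1))%:E * (pwv E ^+ m)%:E)))%E.
  rewrite -!EFinM lee_fin.
  have p0 : 0 <= `|1 - t| `^ (- 2^-1) by exact: powR_ge0.
  have l0 : 0 <= logdist t by exact: normr_ge0.
  apply: (@le_trans _ _ (4 * pwv E ^+ m * (2 * `|1 - t| `^ (- 2^-1)))).
    by apply: ler_pM.
  by apply: le_of_eq; ring.
rewrite lee_wpmul2l//; apply: lee_pmul => //; rewrite lee_fin.
exact: exprn_ge0 (pwv_ge0 _ _ _).
Qed.

End logweight.

(** * A Frullani estimate *)
Section frullani.
Context {R : realType}.
Local Notation mu := (@lebesgue_measure R).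

Definition hinv (t : R) : R := if `|t| < 1 then `|t|^-1 else 0.

Definition ring_inv (a b t : R) : R := if (a <= `|t|) && (`|t| < b) then `|t|^-1 else 0.

Lemma ring_inv_ge0 a b t : 0 <= ring_inv a b t.
Proof. by rewrite /ring_inv; case: ifP => // _; rewrite invr_ge0. Qed.

Lemma measurable_normV : measurable_fun [set: R] (fun t : R => `|t|^-1).
Proof.
rewrite (_ : (fun t => _) = (fun t => `|t| `^ (-1))).
  exact: (measurableT_comp (measurable_powR _) (@normr_measurable R setT)).
by apply/funext => t; rewrite powR_inv1.
Qed.

Lemma measurable_hinv : measurable_fun [set: R] hinv.
Proof.
apply: measurable_fun_ifT => //; last exact: measurable_normV.
by apply: measurable_fun_ltr => //; exact: normr_measurable.
Qed.

Lemma measurable_ring_inv a b : measurable_fun [set: R] (ring_inv a b).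
Proof.
apply: measurable_fun_ifT => //; last exact: measurable_normV.
apply: measurable_and.
  by apply: measurable_fun_ler => //; exact: normr_measurable.
by apply: measurable_fun_ltr => //; exact: normr_measurable.
Qed.

Lemma integral_inv_segment (a b : R) : 0 < a -> a < b ->
  (\int[mu]_(t in `[a, b]) (t^-1)%:E = (ln b - ln a)%:E)%E.
Proof.
move=> a0 ab.
have ltx x : x \in `[a, b] -> 0 < x.
  by rewrite in_itv/= => /andP[ax _]; apply: lt_le_trans ax.
have dl (x : R) : 0 < x -> is_derive x 1 (@ln R) x^-1 by exact: is_derive1_ln.
rewrite (@continuous_FTC2 _ _ (@ln R))//.
- apply: continuous_in_subspaceT => x; rewrite inE => /ltx x0.
  by apply: continuousV; [rewrite gt_eqF|exact: cvg_id].
- split.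
  + by move=> x xab; have [] := dl x (ltx _ (subset_itv_oo_cc xab)).
  + by apply: cvg_at_right_filter; exact: continuous_ln.
  + by apply: cvg_at_left_filter; apply: continuous_ln; exact: lt_trans ab.
- move=> x xab; have := dl x (ltx _ (subset_itv_oo_cc xab)) => ?.
  by rewrite derive1E derive_val.
Qed.

Lemma integral_ring_inv (a b : R) : 0 < a -> a <= b ->
  (\int[mu]_t (ring_inv a b t)%:E <= (2 * (ln b - ln a))%:E)%E.
Proof.
move=> a0; rewrite le_eqVlt => /predU1P[<-|ab].
  under eq_integral => t _ do rewrite /ring_inv leNgt andNb.
  by rewrite integral0 subrr mulr0.
pose p (t : R) : R := if (a <= t) && (t < b) then t^-1 else 0.
have p0 t : 0 <= p t.
  rewrite /p; case: ifP => // /andP[h _]; rewrite invr_ge0; exact: le_trans (ltW a0) h.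
have mp : measurable_fun [set: R] p.
  rewrite (_ : p = (fun t => if (a <= t) && (t < b) then `|t|^-1 else 0)).
    apply: measurable_fun_ifT => //; last exact: measurable_normV.
    by apply: measurable_and; [exact: measurable_fun_ler|exact: measurable_fun_ltr].
  apply/funext => t; rewrite /p; case: ifP => // /andP[h _].
  by rewrite ger0_norm// (le_trans (ltW a0)).
have E t : ring_inv a b t = p t + p (- t).
  rewrite /ring_inv /p; case: (leP 0 t) => t0.
    rewrite (ger0_norm t0) [X in _ = _ + (if X then _ else _)](_ : _ = false) ?addr0//.
    by apply/negbTE; rewrite negb_and -ltNge; apply/orP; left; lra.
  rewrite (ltr0_norm t0) [X in _ = (if X then _ else _) + _](_ : _ = false) ?add0r//.
  by apply/negbTE; rewrite negb_and -ltNge; apply/orP; left; lra.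
under eq_integral do rewrite E EFinD.
have mpE : measurable_fun [set: R] (EFin \o p) by exact/measurable_EFinP.
have mpN : measurable_fun [set: R] (fun t => (p (- t))%:E).
  by apply/measurable_EFinP; apply: measurableT_comp.
have Ip : (\int[mu]_t (p t)%:E <= (ln b - ln a)%:E)%E.
  rewrite -integral_inv_segment//.
  rewrite [leRHS]integral_mkcond; apply: ge0_le_integral => //.
  - by move=> t _; rewrite lee_fin.
  - apply/(measurable_restrictT _ _).1 => //.
    apply/measurable_EFinP; apply: (eq_measurable_fun (fun t : R => `|t|^-1)).
      move=> t; rewrite inE/= in_itv/= => /andP[h _].
      by rewrite ger0_norm// (le_trans (ltW a0)).
    exact: measurable_funTS measurable_normV.
  - move=> t _; rewrite patchE/= /p; case: ifPn => [/andP[h1 h2]|_].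
      by rewrite mem_set//= in_itv/= h1 ltW.
    case: ifPn => //; rewrite inE/= in_itv/= => /andP[h _].
    by rewrite lee_fin invr_ge0 (le_trans (ltW a0)).
have nz : (-1 : R) != 0 by rewrite oppr_eq0 oner_eq0.
have pE0 t : (0 <= (EFin \o p) t)%E by rewrite lee_fin.
have IN : (\int[mu]_t (p t)%:E = \int[mu]_t (p (- t))%:E)%E.
  rewrite [LHS](ge0_integral_affine 0 nz mpE pE0) normrN1 mul1e.
  by apply: eq_integral => t _; rewrite /= mulN1r addr0.
rewrite ge0_integralD//; last 2 first.
- by move=> t _; rewrite lee_fin.
- by move=> t _; rewrite lee_fin.
by rewrite -IN mulr_natl mulr2n EFinD leeD.
Qed.

Lemma integrable_ring_inv (a b : R) : 0 < a -> a <= b ->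
  mu.-integrable setT (EFin \o ring_inv a b).
Proof.
move=> a0 ab; apply/integrableP; split.
  by apply/measurable_EFinP; exact: measurable_ring_inv.
under eq_integral => t _ do rewrite gee0_abs ?lee_fin ?ring_inv_ge0//.
by apply: (le_lt_trans (integral_ring_inv a0 ab)); rewrite ltry.
Qed.

(** Let th(t) = (Th t - Th 0) / |t|. Substituting t / (1 - w) in the second half
    leaves the integral of th between the radii 1 and |1 - w|, where
    |th| <= 2 M / |t|. The Lipschitz hypothesis makes the two halves separately
    integrable. *)
Lemma frullani (Th : R -> R) (M L w : R) : measurable_fun [set: R] Th ->
  (forall t, `|Th t| <= M) -> (forall t, `|Th t - Th 0| <= L * `|t|) -> w != 1 ->
  `|\int[mu]_t (hinv t * (Th t - Th (t * (1 - w))))| <= 4 * M * logdist w.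
Proof.
move=> mTh ThM ThL w1.
pose be := 1 - w; have be0 : be != 0 by rewrite subr_eq0 eq_sym.
pose th t := (Th t - Th 0) * `|t|^-1.
have L0 : 0 <= L by have := ThL 1; rewrite normr1 mulr1; exact: le_trans.
have M0 : 0 <= M by exact: le_trans (ThM 0).
have thL t : `|th t| <= L.
  rewrite /th normrM normfV normr_id; have [->|t0] := eqVneq t 0.
    by rewrite normr0 invr0 mulr0.
  by rewrite ler_pdivrMr ?normr_gt0.
have mth : measurable_fun [set: R] th.
  by apply: measurable_funM; [exact: measurable_funB|exact: measurable_normV].
pose cut r t := if `|t| < r then th t else 0.
have mcut r : measurable_fun [set: R] (cut r).
  apply: measurable_fun_ifT => //.
  by apply: measurable_fun_ltr => //; exact: normr_measurable.
have icut r : mu.-integrable setT (EFin \o cut r).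
  apply: (@dominated_integrable R _ (measurableTypeR R) mu (cut r)
    (fun t => L * \1_(`]- r, r[%classic : set R) t)) => //.
    exact: mcut.
    exact: (integrableZl measurableT L (integrable_indic_itv (- r) r false true)).
  move=> t; rewrite /cut; case: ifPn => h; last by rewrite normr0 mulr_ge0.
  by rewrite indicE mem_set ?mulr1//= in_itv/= -ltr_norml.
pose J r := \int[mu]_t cut r t.
have -> : \int[mu]_t (hinv t * (Th t - Th (t * (1 - w)))) = J 1 - J `|be|.
  rewrite /J (Rintegral_affine 0 be0 (icut `|be|)).
  rewrite -RintegralZl//; last exact: (integrable_affine 0 be0 (icut `|be|)).
  rewrite -RintegralB//; first last.
  - exact: (integrableZl measurableT `|be| (integrable_affine 0 be0 (icut `|be|))).
  apply: eq_Rintegral => t _.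
  rewrite /cut /hinv addr0 normrM gtr_pMr ?normr_gt0//.
  case: ifP => _; last by rewrite mul0r mulr0 subrr.
  rewrite /th normrM invfM.
  rewrite -/be [t * be]mulrC.
  have : `|be| != 0 by rewrite normr_eq0.
  move: (`|t|^-1) => it hb; field.
  by [].
have E t : cut 1 t - cut `|be| t = (if (Num.min 1 `|be| <= `|t|) && (`|t| < Num.max 1 `|be|)
    then (if `|be| < 1 then th t else - th t) else 0).
  rewrite /cut; case: (ltP `|be| 1) => h.
    have [h1|h1] := ltP `|t| `|be|; last by rewrite subr0.
    by rewrite (lt_trans h1 h) subrr.
  have [h1|h1] := ltP `|t| 1; first by rewrite (lt_le_trans h1 h) subrr.
  by rewrite sub0r /=; case: ifP => // _; rewrite oppr0.
rewrite /J -RintegralB//.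
under eq_Rintegral do rewrite E.
pose a := Num.min 1 `|be|; pose b := Num.max 1 `|be|.
have a0 : 0 < a by rewrite lt_min ltr01 normr_gt0.
have ab : a <= b by rewrite ge_min le_max lexx.
have iR := integrable_ring_inv a0 ab.
apply: (@le_trans _ _ (\int[mu]_t (2 * M * ring_inv a b t))).
  apply: (@dominated_normr_Rintegral R _ (measurableTypeR R) mu).
  - have := measurable_funB (mcut 1) (mcut `|be|).
    by apply: eq_measurable_fun => t _; rewrite /= E.
  - exact: (integrableZl measurableT (2 * M) iR).
  - move=> t; rewrite /ring_inv -/a -/b; case: ifP => _; last by rewrite normr0 mulr0.
    rewrite (_ : `|if _ then _ else _| = `|th t|); last by case: ifP => // _; rewrite normrN.
    rewrite /th normrM normfV normr_id ler_wpM2r ?invr_ge0//.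
    apply: (le_trans (ler_normB _ _)); have := ThM t; have := ThM 0; lra.
rewrite RintegralZl//.
have I2 : \int[mu]_t ring_inv a b t <= 2 * logdist w.
  rewrite -lee_fin /Rintegral fineK; last exact: (integrable_fin_num measurableT iR).
  apply: (le_trans (integral_ring_inv a0 ab)); rewrite lee_fin ler_pM2l//.
  rewrite /logdist -/be /a /b; case: (ltP `|be| 1) => h; rewrite ln1.
    by rewrite sub0r; have := ler_norm (- ln `|be|); rewrite normrN.
  by rewrite subr0 ler_norm.
have : 2 * M * \int[mu]_t ring_inv a b t <= 2 * M * (2 * logdist w).
  by rewrite ler_wpM2l// mulr_ge0.
by move=> /le_trans; apply; apply: le_of_eq; ring.
Qed.

End frullani.

(** * The exponential profile *)
Section bexp.
Context {R : realType}.
Local Notation mu := (@lebesgue_measure R).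
Local Notation leb n := (lebesgue_rV R n).

Lemma pw_dominated_integrable (F : R -> R) (C a1 a2 : R) : a1 < 1 -> 1 < a2 -> 0 <= C ->
  measurable_fun [set: R] F -> (forall t, (`|F t|%:E <= C%:E * pw a1 a2 t)%E) ->
  mu.-integrable setT (EFin \o F).
Proof.
move=> h1 h2 C0 mF FC; apply/integrableP; split; first exact/measurable_EFinP.
apply: (@le_lt_trans _ _ (\int[mu]_t (C%:E * pw a1 a2 t))%E).
  apply: ge0_le_integral => //.
  - by apply/measurable_EFinP; apply: measurableT_comp.
  - by apply: emeasurable_funM => //; exact: measurable_pw.
  - by move=> t _; exact: FC.
rewrite ge0_integralZl//; last 2 first.
- exact: measurable_pw.
- by move=> t _; exact: pw_ge0.
apply: lte_mul_pinfty => //; exact: integral_pw_lty.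
Qed.

Definition l1norm n (v : 'rV[R]_n) : R := \sum_(j < n) `|v ord0 j|.

Definition bexp n (v : 'rV[R]_n) : R := expR (- l1norm v).

Lemma l1norm_ge0 n (v : 'rV[R]_n) : 0 <= l1norm v.
Proof. exact: sumr_ge0. Qed.

Lemma bexp_gt0 n (v : 'rV[R]_n) : 0 < bexp v.
Proof. exact: expR_gt0. Qed.

Lemma bexp_ge0 n (v : 'rV[R]_n) : 0 <= bexp v.
Proof. exact: expR_ge0. Qed.

Lemma l1normZ n a (v : 'rV[R]_n) : l1norm (a *: v) = `|a| * l1norm v.
Proof. by rewrite mulr_sumr; apply: eq_bigr => j _; rewrite mxE normrM. Qed.

Lemma l1norm_triangle n (v h : 'rV[R]_n) : l1norm (v - h) <= l1norm v + l1norm h.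
Proof.
rewrite -big_split/=; apply: ler_sum => j _; rewrite !mxE; exact: ler_normB.
Qed.

Lemma measurable_bexp n : measurable_fun setT (@bexp n).
Proof.
apply: (measurableT_comp (@measurable_expR R)); apply: measurable_funN.
apply: measurable_sum => j; exact: (measurableT_comp (@normr_measurable R setT) (measurable_coord j)).
Qed.

Lemma expRN_integrable : mu.-integrable setT (fun t : R => (expR (- `|t|))%:E).
Proof.
apply: (@pw_dominated_integrable (fun t => expR (- `|t|)) 2 0 2) => //.
- by rewrite ltr1n.
- apply: (measurableT_comp (@measurable_expR R)); apply: measurable_funN.
  exact: normr_measurable.
move=> t; rewrite ger0_norm ?expR_ge0// /pw; case: eqVneq => [_|t0].
  by rewrite gt0_muley ?leey// lte_fin.
rewrite -EFinM lee_fin; have [t1|t1] := ltP.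
  rewrite oppr0 powRr0 mulr1; apply: (@le_trans _ _ 1); last by rewrite ler1n.
  by rewrite -expR0 ler_expR oppr_le0.
have n0 : 0 < `|t| by rewrite normr_gt0.
rewrite expRN powRN powR_mulrn ?normr_ge0// -[2]invrK -invfM lef_pV2 ?posrE ?expR_gt0//; last first.
  by rewrite mulr_gt0 ?invr_gt0 ?exprn_gt0.
have := @expR_ge1Dxn R `|t| 1 (normr_ge0 _).
have -> : (2`!%:R : R) = 2 by [].
have := exprn_ge0 2 (normr_ge0 t); lra.
Qed.

Lemma integrable_bexp n : (leb n).-integrable setT (EFin \o @bexp n).
Proof.
apply/integrableP; split; first by apply/measurable_EFinP; exact: measurable_bexp.
have /integrableP[me ie] := expRN_integrable.
apply: le_lt_trans (@integral_prod_lty R n (fun _ t => (expR (- `|t|))%:E) _ _ _).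
- apply: le_of_eq; apply: eq_integral => v _.
  rewrite gee0_abs /= ?lee_fin ?bexp_ge0// /bexp /l1norm -sumrN expR_sum.
  by elim/big_rec2 : _ => // j x y _ h; rewrite EFinM h.
- by [].
- by move=> j t; rewrite lee_fin expR_ge0.
- move=> j; move: ie; apply: le_lt_trans.
  apply: le_of_eq; apply: eq_integral => t _.
  by rewrite gee0_abs// lee_fin expR_ge0.
Qed.

Lemma bexp_shift n (v h : 'rV[R]_n) :
  `|bexp (v - h) - bexp v| <= bexp v * (expR (l1norm h) - 1).
Proof.
have t1 := l1norm_triangle v h.
have t2 : l1norm v <= l1norm (v - h) + l1norm h.
  have := l1norm_triangle (v - h) (- h); rewrite opprK subrK => /le_trans; apply.
  by rewrite -scaleN1r l1normZ normrN1 mul1r.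
have h0 := l1norm_ge0 h.
have u : bexp (v - h) <= bexp v * expR (l1norm h) by rewrite -expRD ler_expR; lra.
have l : bexp v <= bexp (v - h) * expR (l1norm h) by rewrite -expRD ler_expR; lra.
have e1 : 1 <= expR (l1norm h) by rewrite -expR0 ler_expR.
have p := bexp_gt0 (v - h); have p' := bexp_gt0 v.
rewrite ler_norml; apply/andP; split; last by lra.
rewrite lerNl opprB.
have := bexp_ge0 v; move: (expR _) e1 u l => e; nra.
Qed.

Definition bmass n : R := \int[leb n]_v bexp v.

Lemma bmass_ge0 n : 0 <= bmass n.
Proof. by apply: Rintegral_ge0 => v _; exact: bexp_ge0. Qed.

Lemma integrable_bexp_shift n (h : 'rV[R]_n) :
  (leb n).-integrable setT (fun v => (bexp (v - h))%:E).
Proof.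
have := integrable_affine_rV (- h) (oner_neq0 _) (@integrable_bexp n).
by apply: eq_integrable => // v _; rewrite scale1r.
Qed.

Lemma integral_bexp_shift n (h : 'rV[R]_n) :
  \int[leb n]_v bexp (v - h) = bmass n.
Proof.
rewrite /bmass (Rintegral_affine_rV (- h) (oner_neq0 _) (@integrable_bexp n)).
rewrite normr1 expr1n mul1r; apply: eq_Rintegral => v _; by rewrite scale1r.
Qed.

(** For |h| <= 1 this is the pointwise bound [bexp_shift] with
    e^u - 1 <= 3 u; for larger h the triangle inequality suffices. *)
Lemma bexp_shift_L1 n (h : 'rV[R]_n) :
  \int[leb n]_v `|bexp (v - h) - bexp v| <= 3 * bmass n * Num.min 1 (l1norm h).
Proof.
have iB := @integrable_bexp n; have iS := integrable_bexp_shift h.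
have mS : measurable_fun setT (fun v : 'rV[R]_n => bexp (v - h)).
  by apply/measurable_EFinP; case/integrableP : iS.
have mD : measurable_fun setT (fun v : 'rV[R]_n => `|bexp (v - h) - bexp v|).
  apply: measurableT_comp => //; apply: measurable_funB => //; exact: measurable_bexp.
have B0 := bmass_ge0 n; have h0 := l1norm_ge0 h.
have [h1|h1] := leP 1 (l1norm h).
  rewrite mulr1; apply: (@le_trans _ _ (2 * bmass n)); last by rewrite ler_wpM2r// ler_nat.
  rewrite [leRHS](_ : _ = \int[leb n]_v (bexp (v - h) + bexp v)); last first.
    by rewrite RintegralD// integral_bexp_shift -/(bmass n); ring.
  apply: le_trans (ler_norm _) _; apply: dominated_normr_Rintegral => //.
    by have := integrableD measurableT iS iB; apply: eq_integrable.
  move=> v; rewrite normr_id (le_trans (ler_normB _ _))//.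
  by rewrite !ger0_norm ?bexp_ge0.
have e2 : expR (l1norm h) - 1 <= 3 * l1norm h.
  have i0 : 0 < 1 - l1norm h / 2 by lra.
  have : expR (l1norm h) = expR (l1norm h / 2) ^+ 2 by rewrite -expRM_natr; congr expR; field.
  have e0 : 0 < expR (l1norm h / 2) by exact: expR_gt0.
  have : expR (l1norm h / 2) * (1 - l1norm h / 2) <= 1.
    have := @expR_ge1Dx R (- (l1norm h / 2)); rewrite expRN.
    rewrite -(@ler_pM2l _ (expR (l1norm h / 2)))// mulfV ?gt_eqF//.
  move: (expR (l1norm h / 2)) e0 => e e0 h2 ->.
  move: (l1norm h) h0 h1 i0 h2 => u u0 u1 i0 h2.
  have k0 : 0 < (1 - u / 2) ^+ 2 by rewrite exprn_gt0.
  have h3 : (e * (1 - u / 2)) ^+ 2 <= 1 by rewrite expr_le1// mulr_ge0// ltW.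
  have h4 : 1 <= (1 + 3 * u) * (1 - u / 2) ^+ 2.
    rewrite -subr_ge0 (_ : _ - 1 = u * (1 - u) * (2 - 3 / 4 * u)); last by field.
    by rewrite !mulr_ge0// ?subr_ge0; lra.
  rewrite lerBlDl -(ler_pM2r k0) -exprMn; exact: le_trans h3 h4.
apply: (@le_trans _ _ (\int[leb n]_v (bexp v * (3 * l1norm h)))); last first.
  by rewrite RintegralZr// -/(bmass n); apply: le_of_eq; ring.
apply: le_trans (ler_norm _) _; apply: dominated_normr_Rintegral => //.
  exact: (integrableZr measurableT (3 * l1norm h) iB).
move=> v; rewrite normr_id (le_trans (bexp_shift v h))//.
by rewrite ler_wpM2l ?bexp_ge0.
Qed.

End bexp.

(** * Differences along a shear *)
Section inner.
Context {R : realType}.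
Local Notation mu := (@lebesgue_measure R).
Local Notation leb n := (lebesgue_rV R n).
Variable s : R.
Hypotheses (s_gt0 : 0 < s) (s_lt1 : s < 1).
Local Notation minpow := (minpow s).

(** Where [minpow E] is E, use t <= t^(s/2); elsewhere min(1, u) <= u^(s/2) with
    u = t E. *)
Lemma min1_le (t E : R) : 0 <= t -> t <= 1 -> 0 <= E ->
  Num.min 1 (t * E) <= t `^ (s / 2) * minpow E.
Proof.
move=> t0 t1 E0; have q0 : 0 <= s / 2 by rewrite divr_ge0// ltW.
have q1 : s / 2 <= 1.
  by rewrite ler_pdivrMr// mul1r (le_trans (ltW s_lt1))// ler1n.
have tq : t <= t `^ (s / 2).
  move: t0; rewrite le_eqVlt => /predU1P[<-|t0]; first exact: powR_ge0.
  by apply: ger1_powR; [rewrite t0 t1|exact: q1].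
rewrite /minpow; have [h|h] := leP E (E `^ (s / 2)).
  rewrite ge_min; apply/orP; right.
  by rewrite ler_wpM2r.
rewrite -powRM//; have [tE|tE] := leP 1 (t * E).
  have := @ge0_ler_powR R _ q0 1 (t * E); rewrite !nnegrE powR1; apply => //.
  by rewrite mulr_ge0.
have : 0 <= t * E by rewrite mulr_ge0.
rewrite le_eqVlt => /predU1P[<-|p]; first exact: powR_ge0.
by apply: ger1_powR; [rewrite p ltW|exact: q1].
Qed.

Definition hpow (t : R) : R := hinv t * `|t| `^ (s / 2).

Lemma hinv_ge0 (t : R) : 0 <= hinv t.
Proof. by rewrite /hinv; case: ifP => // _; rewrite invr_ge0. Qed.

Lemma hpow_ge0 t : 0 <= hpow t.
Proof. by rewrite mulr_ge0 ?hinv_ge0 ?powR_ge0. Qed.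

Lemma integrable_hpow : mu.-integrable setT (EFin \o hpow).
Proof.
apply: (@pw_dominated_integrable R hpow 1 (1 - s / 2) 2) => //.
- by have := s_gt0; lra.
- by rewrite ltr1n.
- apply: measurable_funM; first exact: measurable_hinv.
  exact: (measurableT_comp (measurable_powR _) (@normr_measurable R setT)).
move=> t; rewrite mul1e ger0_norm ?hpow_ge0// /pw /hpow /hinv.
case: eqVneq => [_|t0]; first exact: leey.
rewrite lee_fin; case: ifP => _; last by rewrite mul0r powR_ge0.
rewrite -[`|t|^-1]powR_inv1// -powRD; last by rewrite normr_eq0 t0 implybT.
by rewrite (_ : -1 + s / 2 = - (1 - s / 2)) //; ring.
Qed.

Lemma hinv_min1 (t E : R) : 0 <= E ->
  hinv t * Num.min 1 (`|t| * E) <= hpow t * minpow E.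
Proof.
move=> E0; rewrite /hpow -mulrA /hinv; case: ifPn => t1; last by rewrite !mul0r.
by rewrite ler_wpM2l ?invr_ge0// min1_le// ltW.
Qed.

Variable m : nat.
Local Notation n := m.+1.

Lemma measurable_hinv0 : measurable_fun setT (fun x : 'rV[R]_n => hinv (x ord0 ord0)).
Proof. exact: (measurableT_comp measurable_hinv (measurable_coord ord0)). Qed.

Lemma measurable_bexp_tail : measurable_fun setT (fun x : 'rV[R]_n => bexp (tail_rV x)).
Proof. exact: (measurableT_comp (@measurable_bexp R m) (@measurable_tail_rV R m)). Qed.

Definition hmass : R := \int[mu]_t hpow t.

Lemma hmass_ge0 : 0 <= hmass.
Proof. by apply: Rintegral_ge0 => t _; exact: hpow_ge0. Qed.

Section fixed.
Variables (g : 'rV[R]_n -> R) (L : R).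
Hypotheses (mg : measurable_fun setT g) (g1 : forall x, `|g x| <= 1) (L0 : 0 <= L)
  (gL : forall x y, `|g x - g y| <= L * enorm (x - y)).

Lemma lipschitz_min1 x y : `|g x - g y| <= (2 + L) * Num.min 1 (enorm (x - y)).
Proof.
have := gL x y; have := enorm_ge0 (x - y); set E := enorm _ => E0 h.
have h2 : `|g x - g y| <= 2.
  by apply: (le_trans (ler_normB _ _)); have := g1 x; have := g1 y; lra.
by have l0 := L0; have [e1|e1] := leP 1 E; nra.
Qed.

Variable w : 'rV[R]_n.
Local Notation w0 := (w ord0 ord0).
Local Notation w' := (tail_rV w).
Local Notation E := (enorm w).

Lemma cons_shift t v : cons_rV (t, v) - t *: w = cons_rV (t * (1 - w0), v - t *: w').
Proof.
apply/rowP => i; rewrite !mxE /=; case: unliftP => [j ->|->]; last by ring.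
by rewrite !mxE.
Qed.

(** The point y in the substitution y = x - x_0 w. *)
Definition shear (x : 'rV[R]_n) : 'rV[R]_n := x - x ord0 ord0 *: w.

Lemma measurable_shear : measurable_fun setT shear.
Proof.
apply: measurable_fun_rV => i; under eq_fun do rewrite !mxE.
apply: measurable_funB; first exact: measurable_coord.
by apply: measurable_funM => //; exact: measurable_coord.
Qed.

Lemma measurable_comp_shear : measurable_fun setT (fun x => g (shear x)).
Proof. exact: (measurableT_comp mg measurable_shear). Qed.

(** What f(x) (g(x) - g(y)) K(x - y) dy becomes under y = x - x_0 w, up to the
    factor K(w). *)
Definition shear_diff (x : 'rV[R]_n) := hinv (x ord0 ord0) * bexp (tail_rV x) * (g x - g (shear x)).

Lemma measurable_shear_diff : measurable_fun setT shear_diff.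
Proof.
apply: measurable_funM; last by apply: measurable_funB => //; exact: measurable_comp_shear.
by apply: measurable_funM; [exact: measurable_hinv0|exact: measurable_bexp_tail].
Qed.

Lemma shear_diff_bound (x : 'rV[R]_n) : `|shear_diff x| <=
  (2 + L) * minpow E * hpow (x ord0 ord0) * bexp (tail_rV x).
Proof.
have h := hinv_ge0 (x ord0 ord0); have b := bexp_ge0 (tail_rV x).
rewrite /shear_diff normrM (ger0_norm (mulr_ge0 h b)).
have : `|g x - g (shear x)| <= (2 + L) * Num.min 1 (`|x ord0 ord0| * E).
  have := lipschitz_min1 x (shear x); rewrite /shear opprB addrCA subrr addr0 enormZ//.
have k := hinv_min1 (x ord0 ord0) (enorm_ge0 w).
move: (Num.min _ _) k => M k gb.
apply: (@le_trans _ _ (hinv (x ord0 ord0) * bexp (tail_rV x) * ((2 + L) * M))).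
  by rewrite ler_wpM2l// mulr_ge0.
rewrite (_ : _ * _ = (2 + L) * (hinv (x ord0 ord0) * M) * bexp (tail_rV x)); last by ring.
rewrite ler_wpM2r// -[leRHS]mulrA ler_wpM2l ?addr_ge0//.
by rewrite [leRHS]mulrC.
Qed.

(** The cost of moving the exponential along with the point: the rest,
    [shear_main], compares one function of x_0 at t and at t (1 - w_0). *)
Definition shear_err (x : 'rV[R]_n) := hinv (x ord0 ord0) *
  (bexp (tail_rV x - x ord0 ord0 *: w') - bexp (tail_rV x)) * g (shear x).

Lemma measurable_shear_err : measurable_fun setT shear_err.
Proof.
apply: measurable_funM; last exact: measurable_comp_shear.
apply: measurable_funM; first exact: measurable_hinv0.
apply: measurable_funB; last exact: measurable_bexp_tail.
apply: (measurableT_comp (@measurable_bexp R m)).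
apply: measurable_fun_rV => i; under eq_fun do rewrite !mxE.
apply: measurable_funB; first exact: measurable_coord.
by apply: measurable_funM => //; exact: measurable_coord.
Qed.

Definition shear_main (x : 'rV[R]_n) := shear_diff x - shear_err x.

Lemma shear_mainE t v : shear_main (cons_rV (t, v)) = hinv t *
  (bexp v * g (cons_rV (t, v)) -
   bexp (v - t *: w') * g (cons_rV (t * (1 - w0), v - t *: w'))).
Proof.
rewrite /shear_main /shear_diff /shear_err /shear cons_rV0 tail_cons_rV cons_shift; ring.
Qed.

Let unitcut (t : R) : R := if `|t| < 1 then 1 else 0.

Lemma integrable_unitcut : mu.-integrable setT (EFin \o unitcut).
Proof.
have := integrable_indic_itv (-1 : R) 1 false true; apply: eq_integrable => // t _.
rewrite /= /unitcut indicE; case: ifPn => h; first by rewrite mem_set//= in_itv/= -ltr_norml.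
by rewrite memNset//= in_itv/= -ltr_norml; exact/negP.
Qed.

Definition shear_err_const : R := l1norm w' * expR (l1norm w').

Lemma shear_err_bound t v : `|shear_err (cons_rV (t, v))| <= shear_err_const * unitcut t * bexp v.
Proof.
rewrite /shear_err cons_rV0 tail_cons_rV !normrM (ger0_norm (hinv_ge0 t)).
have b := bexp_ge0 v; have N0 := l1norm_ge0 w'.
apply: (@le_trans _ _ (hinv t * `|bexp (v - t *: w') - bexp v| * 1)).
  by rewrite ler_wpM2l// mulr_ge0// hinv_ge0.
rewrite mulr1 /hinv /unitcut; case: ifPn => t1; last by rewrite mul0r mulr0 mul0r.
rewrite mulr1; have [->|t0] := eqVneq t 0.
  by rewrite normr0 invr0 mul0r mulr_ge0// mulr_ge0// expR_ge0.
have tn : 0 < `|t| by rewrite normr_gt0.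
rewrite mulrC ler_pdivrMr//.
apply: (le_trans (bexp_shift v (t *: w'))); rewrite l1normZ.
rewrite (_ : shear_err_const * bexp v * `|t| = bexp v * (`|t| * shear_err_const)); last by ring.
rewrite ler_wpM2l// /shear_err_const.
move: (l1norm w') N0 => N N0.
(* e^u - 1 <= u e^u with u = |t| N <= N *)
have u0 : 0 <= `|t| * N by rewrite mulr_ge0.
have e1 : expR (`|t| * N) * (1 - `|t| * N) <= 1.
  have := @expR_ge1Dx R (- (`|t| * N)); rewrite expRN.
  by rewrite -(@ler_pM2l _ (expR (`|t| * N)))// ?mulfV ?gt_eqF// ?expR_gt0.
have e2 : expR (`|t| * N) <= expR N by rewrite ler_expR; nra.
have : (`|t| * N) * expR (`|t| * N) <= (`|t| * N) * expR N by rewrite ler_wpM2l.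
lra.
Qed.

Lemma shear_diff_bound_cons t v : `|shear_diff (cons_rV (t, v))| <=
  ((2 + L) * minpow E * hpow t) * bexp v.
Proof. by have := shear_diff_bound (cons_rV (t, v)); rewrite cons_rV0 tail_cons_rV. Qed.

Let iA1 : mu.-integrable setT (EFin \o (fun t => (2 + L) * minpow E * hpow t)).
Proof. exact: (integrableZl measurableT ((2 + L) * minpow E) integrable_hpow). Qed.

Let iA2 : mu.-integrable setT (EFin \o (fun t => shear_err_const * unitcut t)).
Proof. exact: (integrableZl measurableT shear_err_const integrable_unitcut). Qed.

Let iA3 : mu.-integrable setT
  (EFin \o (fun t => (2 + L) * minpow E * hpow t + shear_err_const * unitcut t)).
Proof. by have := integrableD measurableT iA1 iA2; apply: eq_integrable. Qed.

Lemma shear_main_bound t v : `|shear_main (cons_rV (t, v))| <=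
  ((2 + L) * minpow E * hpow t + shear_err_const * unitcut t) * bexp v.
Proof.
apply: (le_trans (ler_normB _ _)); rewrite mulrDl lerD//.
  exact: shear_diff_bound_cons.
exact: shear_err_bound.
Qed.

Lemma integrable_shear_diff : (leb n).-integrable setT (EFin \o shear_diff).
Proof. exact: (dominated_rVS measurable_shear_diff iA1 (@integrable_bexp R m) shear_diff_bound_cons). Qed.

Lemma integrable_shear_err : (leb n).-integrable setT (EFin \o shear_err).
Proof. exact: (dominated_rVS measurable_shear_err iA2 (@integrable_bexp R m) shear_err_bound). Qed.

Lemma shear_err_integral : `|\int[leb n]_x shear_err x| <= 3 * @bmass R m * m%:R * hmass * minpow E.
Proof.
rewrite (Rintegral_rVS measurable_shear_err iA2 (@integrable_bexp R m) shear_err_bound).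
have mF : measurable_fun [set: (measurableTypeR R * 'rV[R]_m)%type] (shear_err \o @cons_rV R m).
  exact: (measurableT_comp measurable_shear_err (@measurable_cons_rV R m)).
have iI := integrable_fubini1 mF iA2 (@integrable_bexp R m) shear_err_bound.
pose K := 3 * @bmass R m * m%:R * minpow E.
rewrite (_ : 3 * _ * _ * _ * _ = \int[mu]_t (K * hpow t)); last first.
  by rewrite RintegralZl//; [rewrite /K /hmass; ring|exact: integrable_hpow].
apply: (@dominated_normr_Rintegral R _ (measurableTypeR R) mu).
- by apply/measurable_EFinP; case/integrableP : iI.
- exact: (integrableZl measurableT K integrable_hpow).
move=> t.
pose D (v : 'rV[R]_m) := `|bexp (v - t *: w') - bexp v|.
have iD : (leb m).-integrable setT (EFin \o D).
  have := integrableB measurableT (integrable_bexp_shift (t *: w')) (@integrable_bexp R m).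
  by move=> h; apply: integrable_norm; apply: eq_integrable h.
apply: (@le_trans _ _ (\int[leb m]_v (hinv t * D v))).
  apply: dominated_normr_Rintegral.
  - exact: (measurable_fun_cons_rV t measurable_shear_err).
  - exact: (integrableZl measurableT (hinv t) iD).
  - move=> v; rewrite /shear_err cons_rV0 tail_cons_rV !normrM (ger0_norm (hinv_ge0 t)).
    by rewrite -[leRHS]mulr1 ler_wpM2l// mulr_ge0// hinv_ge0.
rewrite RintegralZl//.
have B0 := @bmass_ge0 R m.
apply: (@le_trans _ _ (hinv t * (3 * @bmass R m * Num.min 1 (l1norm (t *: w'))))).
  by rewrite ler_wpM2l ?hinv_ge0// bexp_shift_L1.
have wE : l1norm w' <= m%:R * E.
  apply: (@le_trans _ _ (\sum_(j < m) E)); last by rewrite sumr_const card_ord mulr_natl.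
  by apply: ler_sum => j _; rewrite mxE coord_le_enorm.
have mm : Num.min 1 (l1norm (t *: w')) <= m%:R * Num.min 1 (`|t| * E).
  have tE : 0 <= `|t| * E by rewrite mulr_ge0 ?enorm_ge0.
  have tw : `|t| * l1norm w' <= m%:R * (`|t| * E) by rewrite mulrCA ler_wpM2l.
  rewrite l1normZ; have [m0|m0] := posnP m.
    have mz : (m%:R : R) = 0 by rewrite m0.
    by move: tw; rewrite mz !mul0r ge_min => ->; rewrite orbT.
  have k1 : (1 : R) <= m%:R by rewrite ler1n.
  have [h|h] := leP 1 (`|t| * E); first by rewrite mulr1 ge_min k1.
  by rewrite ge_min tw orbT.
apply: (@le_trans _ _ (3 * @bmass R m * m%:R * (hinv t * Num.min 1 (`|t| * E)))).
  rewrite [leRHS](_ : _ = hinv t * (3 * @bmass R m * (m%:R * Num.min 1 (`|t| * E)))); last by ring.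
  by rewrite ler_wpM2l ?hinv_ge0// ler_wpM2l// mulr_ge0.
rewrite /K [leRHS](_ : _ = 3 * @bmass R m * m%:R * (hpow t * minpow E)); last by ring.
by rewrite ler_wpM2l ?mulr_ge0// hinv_min1 ?enorm_ge0.
Qed.

Definition slice (t : R) : R := \int[leb m]_v (bexp v * g (cons_rV (t, v))).

Let integrable_slice t : (leb m).-integrable setT (fun v => (bexp v * g (cons_rV (t, v)))%:E).
Proof.
apply: (@dominated_integrable R _ _ (leb m) (fun v => bexp v * g (cons_rV (t, v))) (@bexp R m)).
- apply: measurable_funM; first exact: measurable_bexp.
  exact: (measurable_fun_cons_rV t mg).
- exact: integrable_bexp.
- by move=> v; rewrite normrM (ger0_norm (bexp_ge0 v)) -[leRHS]mulr1 ler_wpM2l// bexp_ge0.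
Qed.

Lemma slice_le t : `|slice t| <= @bmass R m.
Proof.
apply: dominated_normr_Rintegral.
- by apply/measurable_EFinP; case/integrableP : (integrable_slice t).
- exact: integrable_bexp.
- by move=> v; rewrite normrM (ger0_norm (bexp_ge0 v)) -[leRHS]mulr1 ler_wpM2l// bexp_ge0.
Qed.

Lemma slice_lip t : `|slice t - slice 0| <= (L * @bmass R m) * `|t|.
Proof.
rewrite /slice -RintegralB//; [|exact: integrable_slice|exact: integrable_slice].
rewrite (_ : L * _ * _ = \int[leb m]_v (bexp v * (L * `|t|))); last first.
  by rewrite RintegralZr//; [rewrite /bmass; ring|exact: integrable_bexp].
apply: dominated_normr_Rintegral.
- have := integrableB measurableT (integrable_slice t) (integrable_slice 0).
  by case/integrableP => /measurable_EFinP.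
- exact: (integrableZr measurableT (L * `|t|) (@integrable_bexp R m)).
move=> v; rewrite -mulrBr normrM (ger0_norm (bexp_ge0 v)) ler_wpM2l ?bexp_ge0//.
apply: (le_trans (gL _ _)); rewrite ler_wpM2l//.
apply: (le_trans (enorm_le_sum _)).
rewrite big_ord_recl !mxE unlift_none /= subr0 big1 ?addr0// => j _.
by rewrite !mxE liftK /= subrr normr0.
Qed.

Lemma measurable_slice : measurable_fun [set: R] slice.
Proof.
(* Tonelli's theorem needs a nonnegative function, and g + 1 >= 0 *)
pose f (x : 'rV[R]_n) := (bexp (tail_rV x) * (g x + 1))%:E.
have mf : measurable_fun setT f.
  apply/measurable_EFinP; apply: measurable_funM; first exact: measurable_bexp_tail.
  exact: measurable_funD.
have f0 x : (0 <= f x)%E.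
  rewrite lee_fin mulr_ge0 ?bexp_ge0//.
  by have := g1 x; rewrite ler_norml => /andP[+ _]; rewrite -lerBlDr sub0r.
have mT := measurable_rVS_tonelli mf f0.
suff -> : slice = (fun t => fine (\int[leb m]_v f (cons_rV (t, v)))%E - @bmass R m).
  apply: measurable_funB => //.
  exact: (measurableT_comp (fine_measurable measurableT) mT).
apply/funext => t; rewrite /f.
transitivity ((\int[leb m]_v (bexp v * g (cons_rV (t, v)) + bexp v)) - @bmass R m).
  by rewrite RintegralD//; [rewrite addrK|exact: integrable_slice|exact: integrable_bexp].
congr (_ - _); rewrite /Rintegral; congr fine; apply: eq_integral => v _.
by rewrite tail_cons_rV mulrDr mulr1.
Qed.

(** A translation within the hyperplane identifies the two integrals of g as
    [slice] at t and at t (1 - w_0), which leaves a Frullani integral. *)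
Lemma shear_main_integral : w0 != 1 -> `|\int[leb n]_x shear_main x| <= 4 * @bmass R m * logdist w0.
Proof.
move=> w1.
have mGm : measurable_fun setT shear_main.
  by apply: measurable_funB; [exact: measurable_shear_diff|exact: measurable_shear_err].
rewrite (Rintegral_rVS mGm iA3 (@integrable_bexp R m) shear_main_bound).
rewrite (_ : \int[mu]_t _ = \int[mu]_t (hinv t * (slice t - slice (t * (1 - w0))))).
  exact: (frullani measurable_slice slice_le slice_lip w1).
apply: eq_Rintegral => t _.
under eq_Rintegral do rewrite shear_mainE.
have iT2 := integrable_affine_rV (- (t *: w')) (oner_neq0 _) (integrable_slice (t * (1 - w0))).
rewrite RintegralZl//; last first.
  have := integrableB measurableT (integrable_slice t) iT2; apply: eq_integrable => // v _.
  by rewrite scale1r.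
congr (_ * _); rewrite RintegralB//; last 2 first.
- exact: integrable_slice.
- by move: iT2; apply: eq_integrable => // v _; rewrite scale1r.
congr (_ - _).
rewrite /slice (Rintegral_affine_rV (- (t *: w')) (oner_neq0 _) (integrable_slice (t * (1 - w0)))).
by rewrite normr1 expr1n mul1r; apply: eq_Rintegral => v _; rewrite scale1r.
Qed.

(** The bound is uniform in g, as the supremum that defines the fractional
    variation demands. *)
Lemma inner_bound : w0 != 1 -> `|\int[leb n]_x shear_diff x| <=
  (3 * @bmass R m * m%:R * hmass + 4 * @bmass R m) * (minpow E + logdist w0).
Proof.
move=> w1; have := shear_main_integral w1; have := shear_err_integral.
rewrite RintegralB//; [|exact: integrable_shear_diff|exact: integrable_shear_err].
move: (\int[leb n]_x shear_diff x) (\int[leb n]_x shear_err x) => a b hb hab.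
have B0 := @bmass_ge0 R m; have H0 := hmass_ge0.
have M0 := minpow_ge0 s (enorm_ge0 w); have D0 : 0 <= logdist w0 by exact: normr_ge0.
have : `|a| <= `|a - b| + `|b| by rewrite -{1}(subrK b a) ler_normD.
have : 0 <= 3 * @bmass R m * m%:R * hmass by rewrite !mulr_ge0.
move: (3 * @bmass R m * m%:R * hmass) hb => K hb K0; nra.
Qed.

End fixed.
End inner.

(** * Pairing the singular function with a fractional divergence *)
Section fracpair.
Context {R : realType}.
Local Notation mu := (@lebesgue_measure R).
Local Notation leb n := (lebesgue_rV R n).
Variable s : R.
Hypotheses (s_gt0 : 0 < s) (s_lt1 : s < 1).
Variable m : nat.
Local Notation n := m.+1.
Local Notation minpow := (minpow s).

(** Its derivative of order s is a multiple of the Dirac mass at 0, up to less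
    singular terms. *)
Definition asing (t : R) : R := if `|t| < 1 then Num.sg t * `|t| `^ (s - 1) else 0.

Definition fsing (x : 'rV[R]_n) : R := asing (x ord0 ord0) * bexp (tail_rV x).

Lemma measurable_sg : measurable_fun [set: R] (@Num.sg R).
Proof.
rewrite (_ : @Num.sg R = (fun t => if t == 0 then 0 else if t < 0 then -1 else 1)); last first.
  apply/funext => t; case: ltgtP => [t0|t0|->].
  - exact: ltr0_sg.
  - exact: gtr0_sg.
  - exact: sgr0.
apply: measurable_fun_ifT => //; first exact: measurable_fun_eqr.
by apply: measurable_fun_ifT => //; exact: measurable_fun_ltr.
Qed.

Lemma measurable_asing : measurable_fun [set: R] asing.
Proof.
apply: measurable_fun_ifT => //.
  by apply: measurable_fun_ltr => //; exact: normr_measurable.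
apply: measurable_funM; first exact: measurable_sg.
exact: (measurableT_comp (measurable_powR _) (@normr_measurable R setT)).
Qed.

Lemma integrable_asing : mu.-integrable setT (EFin \o asing).
Proof.
apply: (@pw_dominated_integrable R asing 1 (1 - s) 2) => //.
- by have := s_gt0; lra.
- by rewrite ltr1n.
- exact: measurable_asing.
move=> t; rewrite mul1e /pw /asing.
case: eqVneq => [_|t0]; first exact: leey.
rewrite lee_fin; case: ifP => _; last by rewrite normr0 powR_ge0.
by rewrite normrM normr_sg t0 mul1r ger0_norm ?powR_ge0// opprB.
Qed.

Lemma measurable_fsing : measurable_fun setT fsing.
Proof.
apply: measurable_funM; last exact: measurable_bexp_tail.
exact: (measurableT_comp measurable_asing (measurable_coord ord0)).
Qed.

Lemma integrable_fsing : (leb n).-integrable setT (EFin \o fsing).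
Proof.
apply: (dominated_rVS measurable_fsing (integrable_norm integrable_asing) (@integrable_bexp R m)).
by move=> t v; rewrite /fsing cons_rV0 tail_cons_rV normrM (ger0_norm (bexp_ge0 v)).
Qed.

Definition kern (i : 'I_n) (h : 'rV[R]_n) : R :=
  h ord0 i / (enorm h `^ (n%:R + s) * enorm h).

Lemma kern_le i h : `|kern i h| <= enorm h `^ (- (n%:R + s)).
Proof.
have [h0|h0] := eqVneq (enorm h) 0.
  by rewrite /kern h0 mulr0 invr0 mulr0 normr0 powR_ge0.
have E0 : 0 < enorm h by rewrite lt_neqAle eq_sym h0 enorm_ge0.
have p0 : 0 < enorm h `^ (n%:R + s) by exact: powR_gt0.
rewrite /kern normrM normfV (gtr0_norm (mulr_gt0 p0 E0)) powRN invfM mulrCA.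
by rewrite -[leRHS]mulr1 ler_pM2l ?invr_gt0// ler_pdivrMr// mul1r coord_le_enorm.
Qed.

Lemma kern_weight i h : `|kern i h| * minpow (enorm h) <= weight s h.
Proof. by rewrite ler_wpM2r ?kern_le// minpow_ge0 ?enorm_ge0. Qed.

(** The kernel is odd and homogeneous of degree - (n + s). *)
Lemma kernZ i a h : kern i (a *: h) = Num.sg a * `|a| `^ (- (n%:R + s)) * kern i h.
Proof.
have [->|a0] := eqVneq a 0.
  by rewrite scale0r /kern mxE mul0r sgr0 !mul0r.
rewrite /kern mxE enormZ powRM ?enorm_ge0// powRN.
have an : `|a| != 0 by rewrite normr_eq0.
have pn : `|a| `^ (n%:R + s) != 0 by rewrite powR_eq0 (negbTE an).
rewrite {1}[a]numEsg !invfM.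
move: ((enorm h `^ (n%:R + s))^-1) ((enorm h)^-1) => u v.
move: (Num.sg a) (`|a| `^ _) pn => sa pa pa0.
move: (`|a|) an => na na0.
by field; rewrite na0 pa0.
Qed.

Lemma measurable_kern i : measurable_fun setT (kern i).
Proof.
apply: measurable_funM; first exact: measurable_coord.
rewrite (_ : (fun x => _) = (fun x : 'rV[R]_n => enorm x `^ (- (n%:R + s)) * enorm x `^ (-1))).
  by apply: measurable_funM; exact: (measurableT_comp (measurable_powR _) measurable_enorm).
by apply/funext => x; rewrite invfM powRN powR_inv1 ?enorm_ge0.
Qed.

Section fixed.
Variables (i : 'I_n) (g : 'rV[R]_n -> R) (L : R).
Hypotheses (mg : measurable_fun setT g) (g1 : forall x, `|g x| <= 1) (L0 : 0 <= L)
  (gL : forall x y, `|g x - g y| <= L * enorm (x - y)).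

Lemma kern_section_integrable x :
  (leb n).-integrable setT (fun y => ((g x - g y) * kern i (x - y))%:E).
Proof.
have mxy : measurable_fun setT (fun y : 'rV[R]_n => x - y).
  apply: measurable_fun_rV => j; under eq_fun do rewrite !mxE.
  by apply: measurable_funB => //; exact: measurable_coord.
have nz : (-1 : R) != 0 by rewrite oppr_eq0 oner_eq0.
have iW := integrable_affine_rV x nz (integrable_weight s_gt0 s_lt1 m).
apply: (@dominated_integrable R _ _ (leb n) (fun y => (g x - g y) * kern i (x - y))
  (fun y => (2 + L) * weight s (-1 *: y + x))).
- apply: measurable_funM; first exact: measurable_funB.
  exact: (measurableT_comp (measurable_kern i) mxy).
- exact: (integrableZl measurableT (2 + L) iW).
move=> y; rewrite scaleN1r [- y + x]addrC normrM.
have h1 := lipschitz_min1 g1 L0 gL x y.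
have h2 : Num.min 1 (enorm (x - y)) <= minpow (enorm (x - y)).
  by have := min1_le s_gt0 s_lt1 ler01 (lexx 1) (enorm_ge0 (x - y)); rewrite powR1 !mul1r.
have h3 := kern_weight i (x - y).
apply: (@le_trans _ _ ((2 + L) * minpow (enorm (x - y)) * `|kern i (x - y)|)).
  rewrite ler_wpM2r//; apply: (le_trans h1); rewrite ler_wpM2l// addr_ge0//.
by rewrite -mulrA ler_wpM2l ?addr_ge0// mulrC.
Qed.

Definition kern_shear (p : 'rV[R]_n * 'rV[R]_n) : R := shear_diff g p.2 p.1 * kern i p.2.

Lemma measurable_kern_shear : measurable_fun setT kern_shear.
Proof.
apply: measurable_funM; last first.
  exact: (measurableT_comp (measurable_kern i) measurable_snd).
rewrite /shear_diff; apply: measurable_funM.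
  apply: measurable_funM.
    exact: (measurableT_comp (@measurable_hinv0 R m) measurable_fst).
  exact: (measurableT_comp (@measurable_bexp_tail R m) measurable_fst).
apply: measurable_funB; first exact: (measurableT_comp mg measurable_fst).
apply: (measurableT_comp mg); apply: measurable_fun_rV => j.
rewrite /shear; under eq_fun do rewrite !mxE.
apply: measurable_funB; first exact: (measurableT_comp (measurable_coord j) measurable_fst).
apply: measurable_funM.
  exact: (measurableT_comp (measurable_coord ord0) measurable_fst).
exact: (measurableT_comp (measurable_coord j) measurable_snd).
Qed.

Let Adom (x : 'rV[R]_n) : R := (2 + L) * (hpow s (x ord0 ord0) * bexp (tail_rV x)).

Let iAdom : (leb n).-integrable setT (EFin \o Adom).
Proof.
have mh : measurable_fun [set: R] (hpow s).
  by apply/measurable_EFinP; case/integrableP : (integrable_hpow s_gt0).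
have iF : (leb n).-integrable setT
    (EFin \o (fun x : 'rV[R]_n => hpow s (x ord0 ord0) * bexp (tail_rV x))).
  apply: (dominated_rVS _ (integrable_hpow s_gt0) (@integrable_bexp R m)).
    apply: measurable_funM; last exact: measurable_bexp_tail.
    exact: (measurableT_comp mh (measurable_coord ord0)).
  move=> t v; rewrite cons_rV0 tail_cons_rV ger0_norm//.
  by rewrite mulr_ge0 ?hpow_ge0 ?bexp_ge0.
exact: (integrableZl measurableT (2 + L) iF).
Qed.

Lemma kern_shear_bound x w : `|kern_shear (x, w)| <= Adom x * weight s w.
Proof.
rewrite /kern_shear normrM /=.
have h := shear_diff_bound s_gt0 s_lt1 g1 L0 gL w x.
have k := kern_weight i w.
apply: (@le_trans _ _ (Adom x * minpow (enorm w) * `|kern i w|)).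
  rewrite ler_wpM2r//; apply: (le_trans h).
  by rewrite /Adom; apply: le_of_eq; ring.
rewrite -mulrA ler_wpM2l//; last by rewrite mulrC.
apply: mulr_ge0; first by rewrite addr_ge0// L0.
by rewrite mulr_ge0 ?hpow_ge0 ?bexp_ge0.
Qed.

Definition fdiv (x : 'rV[R]_n) : R := \int[leb n]_y ((g x - g y) * kern i (x - y)).

(** The power |x_0|^(s-1), the Jacobian |x_0|^n and the homogeneity of the kernel
    combine to |x_0|^(-1), and the signs cancel. *)
Lemma fsing_fdiv x : fsing x * fdiv x = \int[leb n]_w kern_shear (x, w).
Proof.
have [x0|x0] := eqVneq (x ord0 ord0) 0.
  rewrite /fsing /asing x0 sgr0 mul0r if_same !mul0r.
  rewrite [RHS](_ : _ = \int[leb n]_w (cst 0 w)); last first.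
    by apply: eq_Rintegral => w _; rewrite /kern_shear /shear_diff /= /hinv x0 normr0 invr0 if_same !mul0r.
  by rewrite /Rintegral integral0.
have nx0 : - x ord0 ord0 != 0 by rewrite oppr_eq0.
have iK := kern_section_integrable x.
rewrite /fdiv (Rintegral_affine_rV x nx0 iK) normrN.
have iK' := integrable_affine_rV x nx0 iK.
rewrite mulrA -RintegralZl//; apply: eq_Rintegral => w _.
have -> : - x ord0 ord0 *: w + x = shear w x by rewrite /shear scaleNr addrC.
rewrite {2}/shear opprB addrCA subrr addr0 kernZ /kern_shear /shear_diff /= /fsing /asing /hinv.
case: ifP => _; last by rewrite !mul0r.
have an : 0 < `|x ord0 ord0| by rewrite normr_gt0.
have sg2 : Num.sg (x ord0 ord0) * Num.sg (x ord0 ord0) = 1.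
  by rewrite -expr2 sqr_sg x0.
have pw : `|x ord0 ord0| `^ (s - 1) * `|x ord0 ord0| ^+ n * `|x ord0 ord0| `^ (- (n%:R + s))
    = `|x ord0 ord0|^-1.
  rewrite -powR_mulrn ?normr_ge0// -!powRD ?(gt_eqF an) ?implybT//.
  by rewrite -powR_inv1 ?normr_ge0//; congr (_ `^ _); ring.
rewrite -pw.
transitivity ((Num.sg (x ord0 ord0) * Num.sg (x ord0 ord0)) *
   (`|x ord0 ord0| `^ (s - 1) * `|x ord0 ord0| ^+ n * `|x ord0 ord0| `^ (- (n%:R + s))) *
   bexp (tail_rV x) * (g x - g (shear w x)) * kern i w); first by ring.
by rewrite sg2 mul1r.
Qed.

Lemma integrable_fsing_fdiv : (leb n).-integrable setT (fun x => (fsing x * fdiv x)%:E).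
Proof.
have := integrable_fubini1 measurable_kern_shear iAdom (integrable_weight s_gt0 s_lt1 m) kern_shear_bound.
by apply: eq_integrable => // x _; rewrite fsing_fdiv.
Qed.

Definition inner_const : R := 3 * @bmass R m * m%:R * hmass s + 4 * @bmass R m.

Lemma fsing_fdiv_swap : \int[leb n]_x (fsing x * fdiv x) =
  \int[leb n]_w (kern i w * \int[leb n]_x shear_diff g w x).
Proof.
under eq_Rintegral do rewrite fsing_fdiv.
rewrite (Rintegral_fubini measurable_kern_shear iAdom (integrable_weight s_gt0 s_lt1 m) kern_shear_bound).
apply: eq_Rintegral => w _; rewrite /kern_shear /= RintegralZr//; first by rewrite mulrC.
exact: (integrable_shear_diff s_gt0 s_lt1 mg g1 L0 gL).
Qed.

Lemma integrable_kern_inner : (leb n).-integrable setT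
  (fun w => (kern i w * \int[leb n]_x shear_diff g w x)%:E).
Proof.
have := integrable_fubini2 measurable_kern_shear iAdom (integrable_weight s_gt0 s_lt1 m) kern_shear_bound.
apply: eq_integrable => // w _; rewrite /kern_shear /= RintegralZr//; first by rewrite mulrC.
exact: (integrable_shear_diff s_gt0 s_lt1 mg g1 L0 gL).
Qed.

Lemma fsing_fdiv_bound (C : R) : 0 < C ->
  (forall x : 'rV[R]_n, x ord0 ord0 != 1 ->
    ((enorm x `^ (- (n%:R + s)) * (minpow (enorm x) + logdist (x ord0 ord0)))%:E <=
    C%:E * logbound s x)%E) ->
  (`|\int[leb n]_x (fsing x * fdiv x)|%:E <=
    ((inner_const + 1) * C)%:E * \int[leb n]_x logbound s x)%E.
Proof.
move=> C0 HC; rewrite fsing_fdiv_swap.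
have iK := integrable_kern_inner.
have Ci0 : 0 <= inner_const.
  have B0 := @bmass_ge0 R m; have H0 := hmass_ge0 s.
  by rewrite addr_ge0 ?mulr_ge0.
have K0 : (0 <= ((inner_const + 1) * C)%:E)%E by rewrite lee_fin mulr_ge0//; [rewrite addr_ge0|exact: ltW].
have lb0 (x : 'rV[R]_n) : (0 <= logbound s x)%E by exact: logbound_ge0.
have mlb : measurable_fun setT (@logbound R s m) by exact: measurable_logbound.
rewrite -ge0_integralZl//.
have h := le_normr_Rintegral measurableT iK.
apply: (@le_trans _ _ (\int[leb n]_w `|kern i w * \int[leb n]_x shear_diff g w x|)%:E).
  by rewrite lee_fin.
have iKn : (leb n).-integrable setT (fun w => (`|kern i w * \int[leb n]_x shear_diff g w x|)%:E).
  exact: (integrable_norm iK).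
rewrite /Rintegral fineK; last exact: (integrable_fin_num measurableT iKn).
apply: ge0_le_integral => //.
- by case/integrableP : iKn.
- by apply: emeasurable_funM => //.
move=> w _; have [w1|w1] := eqVneq (w ord0 ord0) 1.
  rewrite logbound_pole// gt0_muley ?leey// lte_fin mulr_gt0//.
  by rewrite ltr_wpDl.
have IB := inner_bound s_gt0 s_lt1 mg g1 L0 gL w1.
rewrite EFinM -muleA.
apply: (@le_trans _ _ ((inner_const + 1)%:E * (enorm w `^ (- (n%:R + s)) *
    (minpow (enorm w) + logdist (w ord0 ord0)))%:E)%E); last first.
  by rewrite lee_wpmul2l ?HC// lee_fin addr_ge0.
rewrite -EFinM lee_fin normrM mulrCA.
apply: ler_pM => //; first exact: kern_le.
apply: (le_trans IB); rewrite -/inner_const ler_wpM2r//; last by rewrite lerDl.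
by rewrite addr_ge0 ?minpow_ge0 ?enorm_ge0// normr_ge0.
Qed.

End fixed.

Lemma fsing_fdiv_uniform : exists C : R, forall (i : 'I_n) (g : 'rV[R]_n -> R) (L : R),
  measurable_fun setT g -> (forall x, `|g x| <= 1) -> 0 <= L ->
  (forall x y, `|g x - g y| <= L * enorm (x - y)) ->
  `|\int[leb n]_x (fsing x * fdiv i g x)| <= C.
Proof.
have [C C0 HC] := logweight_le s_gt0 s_lt1 m.
have ilb := integral_logbound_lty s_gt0 s_lt1 m.
have lb0 : (0 <= \int[leb n]_x logbound s x)%E.
  by apply: integral_ge0 => x _; exact: logbound_ge0.
exists ((inner_const + 1) * C * fine (\int[leb n]_x logbound s x)%E) => i g L mg g1 L0 gL.
have := fsing_fdiv_bound i mg g1 L0 gL C0 HC.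
by rewrite -[X in (_ * X)%E]fineK ?ge0_fin_numE// -EFinM lee_fin.
Qed.

End fracpair.

(** * The singular function has bounded fractional variation *)
Section lines.
Context {R : realType}.

Lemma is_derive_line (V : normedModType R) (f : V -> R) (x v : V) (t df : R) :
  is_derive (x + t *: v) v f df -> is_derive t 1 (fun t => f (x + t *: v)) df.
Proof.
have E : (fun h : R => h^-1 *: (((fun t => f (x + t *: v)) \o shift t) (h *: 1) -
    f (x + t *: v))) =
    (fun h : R => h^-1 *: ((f \o shift (x + t *: v)) (h *: v) - f (x + t *: v))).
  apply/funext => h /=; congr (_ *: (f _ - _)).
  by rewrite [h *: 1]mulr1 scalerDl addrCA.
by move=> [d <-]; split; [rewrite /derivable E|rewrite /derive E].
Qed.

Lemma is_derive_of_line (V : normedModType R) (f : V -> R) (x v : V) (df : R) :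
  is_derive (0 : R) 1 (fun t => f (x + t *: v)) df -> is_derive x v f df.
Proof.
have E : (fun h : R => h^-1 *: (((fun t => f (x + t *: v)) \o shift 0) (h *: 1) -
    f (x + 0 *: v))) =
    (fun h : R => h^-1 *: ((f \o shift x) (h *: v) - f x)).
  apply/funext => h /=; rewrite scale0r addr0 addr0; congr (_ *: (f _ - _)).
  by rewrite [h *: 1]mulr1 addrC.
by move=> [d <-]; split; [rewrite /derivable -E|rewrite /derive E].
Qed.

Lemma line_lipschitz (V : normedModType R) (f : V -> R) (v : V) (B : R) :
  (forall x, derivable f x v) -> (forall x, `|'D_v f x| <= B) ->
  forall x (h : R), `|f (x + h *: v) - f x| <= B * `|h|.
Proof.
move=> df fB x h.
pose u (t : R) := f (x + t *: v).
have du (t : R) : is_derive t 1 u ('D_v f (x + t *: v)).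
  by apply: is_derive_line; exact: derivableP.
have cu a b : {within `[a, b], continuous u}.
  apply: continuous_subspaceT => t; apply/differentiable_continuous/derivable1_diffP.
  by have [] := du t.
have key a b : a <= b -> `|u b - u a| <= B * `|b - a|.
  move=> ab; have [c _ ->] := @MVT_segment R u (fun t => 'D_v f (x + t *: v)) a b ab
    (fun t _ => du t) (cu a b).
  by rewrite normrM ler_wpM2r.
have u0 : u 0 = f x by rewrite /u scale0r addr0.
rewrite -u0 -/(u h); have [h0|/ltW h0] := leP 0 h.
  by have := key _ _ h0; rewrite subr0.
by have := key _ _ h0; rewrite sub0r normrN distrC.
Qed.

Lemma coord_lipschitz n (f : 'rV[R]_n -> R) (B : R) :
  (forall i x, derivable f x (basis_rV i)) ->
  (forall i x, `|'D_(basis_rV i) f x| <= B) -> 0 <= B ->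
  forall x y, `|f x - f y| <= B * n%:R * enorm (x - y).
Proof.
move=> df fB B0 x y.
pose z k : 'rV[R]_n := \row_j (if (j < k)%N then x ord0 j else y ord0 j).
have zn : z n = x by apply/rowP => j; rewrite mxE ltn_ord.
have z0 : z 0%N = y by apply/rowP => j; rewrite mxE.
have zS (k : 'I_n) : z k.+1 = z k + (x - y) ord0 k *: basis_rV k.
  apply/rowP => j; rewrite !mxE eqxx /= ltnS.
  have [->|jk] := eqVneq j k; first by rewrite leqnn ltnn mulr1; ring.
  by rewrite mulr0 addr0 leq_eqVlt (negbTE (jk : val j != val k)).
rewrite -zn -z0 -(telescope_sumr (fun k => f (z k)) (leq0n n)) zn z0 big_mkord.
apply: (le_trans (ler_norm_sum _ _ _)).
apply: (@le_trans _ _ (\sum_(k < n) B * `|(x - y) ord0 k|)).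
  by apply: ler_sum => k _; rewrite zS; apply: line_lipschitz.
by rewrite -mulr_sumr -mulrA ler_wpM2l// sum_le_enorm.
Qed.

End lines.

Section testfield.
Context {R : realType} {n : nat}.
Local Notation leb := (lebesgue_rV R n).

Lemma test_field_lipschitz (phi : 'rV[R]_n -> 'rV[R]_n) (i : 'I_n) : test_field phi ->
  exists2 L, 0 <= L & forall x y, `|phi x ord0 i - phi y ord0 i| <= L * enorm (x - y).
Proof.
move=> [Cphi cK]; pose f x := phi x ord0 i.
have [cf /= df] := Cphi i 1%N.
pose K := closure [set x | phi x != 0].
have out j x : ~ K x -> 'D_(basis_rV j) f x = 0.
  move=> nK.
  have nb : \forall y \near x, f y = cst 0 y.
    have : nbhs x (~` K) by apply: open_nbhs_nbhs; split => //; exact: closed_openC (@closed_closure _ _).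
    apply: filterS => y nKy; rewrite /f /=.
    have -> : phi y = 0.
      by apply: contra_notP nKy => /eqP ny; apply: subset_closure.
    by rewrite mxE.
  by rewrite (near_eq_derive _ nb) derive_cst.
have bd j : exists B, forall x, `|'D_(basis_rV j) f x| <= B.
  have [_ cd] := df j.
  have cdj : continuous (fun x => 'D_(basis_rV j) f x) by exact: cd.
  have /compact_bounded[M [Mr MB]] : compact ((fun x => 'D_(basis_rV j) f x) @` K).
    by apply: continuous_compact => //; exact: continuous_subspaceT.
  exists (Num.max 0 (M + 1)) => x.
  have [Kx|nKx] := pselect (K x); last by rewrite out// normr0 le_max lexx.
  rewrite le_max; apply/orP; right; apply: (MB (M + 1)); first by rewrite ltrDl.
  by exists x.
have [B HB] := choice bd.
pose B' := \sum_j `|B j|.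
have B'0 : 0 <= B' by exact: sumr_ge0.
exists (B' * n%:R); first by rewrite mulr_ge0.
apply: coord_lipschitz => // j x; first exact: (df j).1.
apply: (le_trans (HB j x)); apply: (le_trans (ler_norm _)).
by rewrite /B' (bigD1 j)//= lerDl sumr_ge0.
Qed.

Lemma test_field_measurable (phi : 'rV[R]_n -> 'rV[R]_n) (i : 'I_n) : test_field phi ->
  measurable_fun setT (fun x => phi x ord0 i).
Proof. by move=> [Cphi _]; apply: continuous_measurable_rV; exact: (Cphi i 0%N). Qed.

End testfield.

Section sums.
Context {R : realType} d (T : measurableType d) (mu : {measure set T -> \bar R}).

Lemma integrable_sum_fin I (r : seq I) (F : I -> T -> R) :
  (forall i, mu.-integrable setT (EFin \o F i)) ->
  mu.-integrable setT (fun x => (\sum_(i <- r) F i x)%:E).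
Proof.
move=> iF; have := @integrable_sum _ _ R mu setT measurableT _ r xpredT
  (fun i => EFin \o F i) (fun i _ => iF i).
by apply: eq_integrable => // x _; rewrite /= sumEFin.
Qed.

Lemma Rintegral_sum_fin I (r : seq I) (F : I -> T -> R) :
  (forall i, mu.-integrable setT (EFin \o F i)) ->
  \int[mu]_x (\sum_(i <- r) F i x) = \sum_(i <- r) \int[mu]_x F i x.
Proof.
move=> iF; elim: r => [|i r IH].
  rewrite big_nil; under eq_Rintegral do rewrite big_nil.
  by rewrite /Rintegral integral0.
under eq_Rintegral do rewrite big_cons.
rewrite RintegralD//; first by rewrite big_cons IH.
exact: integrable_sum_fin.
Qed.

End sums.

Section BVfrac.
Context {R : realType}.
Variable s : R.
Hypotheses (s_gt0 : 0 < s) (s_lt1 : s < 1).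
Variable m : nat.
Local Notation n := m.+1.
Local Notation leb := (lebesgue_rV R n).
Local Open Scope complex_scope.

Lemma frac_divergence_sum (c : R) (phi : 'rV[R]_n -> 'rV[R]_n) x : test_field phi ->
  (forall x, enorm (phi x) <= 1) ->
  frac_divergence c s phi x = c * \sum_i fdiv s i (fun x => phi x ord0 i) x.
Proof.
move=> tphi phi1; rewrite /frac_divergence; congr (_ * _).
have iK i : leb.-integrable setT
    (fun y => ((phi x ord0 i - phi y ord0 i) * kern s i (x - y))%:E).
  have [L L0 hL] := test_field_lipschitz i tphi.
  apply: (@kern_section_integrable R s s_gt0 s_lt1 m i (fun x => phi x ord0 i) L) => //.
    exact: test_field_measurable.
  by move=> y; exact: le_trans (coord_le_enorm _ _) (phi1 y).
transitivity (\int[leb]_y \sum_(i <- index_enum 'I_n)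
   ((phi x ord0 i - phi y ord0 i) * kern s i (x - y))).
  apply: eq_Rintegral => y _; rewrite /dotp; apply: eq_bigr => i _.
  rewrite !mxE /kern !mxE invfM; ring.
exact: Rintegral_sum_fin.
Qed.

Lemma fsing_BV_frac (c : R) : BV_frac c s (fun x : 'rV[R]_n => (fsing s x)%:C).
Proof.
split.
  split => /=; first exact: integrable_fsing.
  exact: integrable0.
have [C HC] := fsing_fdiv_uniform s_gt0 s_lt1 m.
apply: (@le_lt_trans _ _ (`|c| * (n%:R * C))%:E); last exact: ltry.
apply: ge_ereal_sup => _ [phi [tphi phi1] <-].
rewrite lee_fin.
have HCi i : `|\int[leb]_x (fsing s x * fdiv s i (fun x => phi x ord0 i) x)| <= C.
  have [L L0 hL] := test_field_lipschitz i tphi.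
  apply: (HC i _ L) => //; first exact: test_field_measurable.
  by move=> y; exact: le_trans (coord_le_enorm _ _) (phi1 y).
have iD i : leb.-integrable setT
    (fun x => (fsing s x * fdiv s i (fun x => phi x ord0 i) x)%:E).
  have [L L0 hL] := test_field_lipschitz i tphi.
  apply: (@integrable_fsing_fdiv R s s_gt0 s_lt1 m i (fun x => phi x ord0 i) L) => //.
    exact: test_field_measurable.
  by move=> y; exact: le_trans (coord_le_enorm _ _) (phi1 y).
rewrite /cintegral.
have -> : \int[leb]_x Im ((fsing s x)%:C * (frac_divergence c s phi x)%:C) = 0.
  under eq_Rintegral do rewrite /= mulr0 mul0r addr0.
  by rewrite /Rintegral integral0.
have E : \int[leb]_x Re ((fsing s x)%:C * (frac_divergence c s phi x)%:C) =
    c * \sum_i \int[leb]_x (fsing s x * fdiv s i (fun x => phi x ord0 i) x).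
  transitivity (\int[leb]_x (c * \sum_(i <- index_enum 'I_n)
      (fsing s x * fdiv s i (fun x => phi x ord0 i) x))).
    apply: eq_Rintegral => x _; rewrite /= mul0r subr0 frac_divergence_sum//.
    by rewrite mulrCA mulr_sumr.
  rewrite RintegralZl//; last exact: integrable_sum_fin.
  by rewrite Rintegral_sum_fin.
rewrite E /Normc.normc expr0n addr0 sqrtr_sqr normrM ler_wpM2l//.
apply: (le_trans (ler_norm_sum _ _ _)).
apply: (@le_trans _ _ (\sum_(i < n) C)); first by apply: ler_sum => i _; exact: HCi.
by rewrite sumr_const card_ord mulr_natl.
Qed.

End BVfrac.

(** * The theorem of Goursat for closed forms *)
Section goursat.
Context {R : realType}.
Local Notation mu := (@lebesgue_measure R).

Definition itg (a b : R) (f : R -> R) : R := \int[mu]_(x in `[a, b]) f x.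

Definition cont_on (a b : R) (f : R -> R) := forall x, a <= x <= b -> {for x, continuous f}.

Lemma cont_on_integrable a b f : cont_on a b f -> mu.-integrable `[a, b] (EFin \o f).
Proof.
move=> cf; apply: continuous_compact_integrable; first exact: segment_compact.
by apply: continuous_in_subspaceT => x; rewrite inE/= in_itv/= => /cf.
Qed.

Lemma cont_onS a b a' b' f : a <= a' -> b' <= b -> cont_on a b f -> cont_on a' b' f.
Proof.
by move=> h1 h2 cf x /andP[x1 x2]; apply: cf; rewrite (le_trans h1 x1) (le_trans x2 h2).
Qed.

Lemma cont_onB a b f g : cont_on a b f -> cont_on a b g -> cont_on a b (fun x => f x - g x).
Proof. by move=> cf cg x xab; apply: continuousB; [exact: cf|exact: cg]. Qed.

Lemma itg_split a c b f : a <= c -> c <= b -> cont_on a b f ->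
  itg a b f = itg a c f + itg c b f.
Proof.
move=> ac cb cf; have iab := cont_on_integrable cf.
have iS A : measurable A -> A `<=` `[a, b] -> mu.-integrable A (EFin \o f).
  by move=> mA AS; exact: integrableS iab.
rewrite /itg -[in RHS](Rintegral_itv_obnd_cbnd (r := c)); last first.
  apply: iS => // x /=; rewrite !in_itv/= => /andP[h ->]; rewrite andbT.
  exact: le_trans ac (ltW h).
rewrite -Rintegral_setU//=.
- by congr Rintegral; rewrite -itv_bndbnd_setU// bnd_simp.
- by rewrite -itv_bndbnd_setU// bnd_simp.
- rewrite disj_set2E; apply/eqP; rewrite -subset0 => x []/=; rewrite !in_itv/=.
  by move=> /andP[_ h] /andP[]; rewrite ltNge h.
Qed.

Lemma itg_bound a b f B : a <= b -> cont_on a b f ->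
  (forall x, a <= x <= b -> `|f x| <= B) -> `|itg a b f| <= B * (b - a).
Proof.
move=> ab cf fB; have iab := cont_on_integrable cf.
apply: (le_trans (le_normr_Rintegral _ iab)) => //.
have mab : mu `[a, b]%classic = (b - a)%:E.
  rewrite lebesgue_measure_itv/= lte_fin; case: ltP => // ba.
  have -> : b = a by apply/eqP; rewrite eq_le ab ba.
  by rewrite subrr.
have -> : B * (b - a) = \int[mu]_(x in `[a, b]) (cst B x).
  by rewrite Rintegral_cst//= mab.
apply: le_Rintegral => //.
- exact: integrable_norm.
- apply: continuous_compact_integrable; first exact: segment_compact.
  by apply: continuous_subspaceT => x; exact: cvg_cst.
Qed.

Lemma itgD a b f g : cont_on a b f -> cont_on a b g ->
  itg a b (fun x => f x + g x) = itg a b f + itg a b g.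
Proof. by move=> /cont_on_integrable cf /cont_on_integrable cg; rewrite /itg RintegralD. Qed.

Lemma itg_cst a b k : a <= b -> itg a b (fun=> k) = k * (b - a).
Proof.
move=> ab; rewrite /itg Rintegral_cst//= lebesgue_measure_itv/= lte_fin; case: ltP => // ba.
have -> : b = a by apply/eqP; rewrite eq_le ab ba.
by rewrite subrr.
Qed.

Variables p q : R -> R -> R.

(** The integral of p dx + q dy along the boundary, counterclockwise. *)
Definition circ (a b c d : R) : R :=
  itg a b (fun x => p x c - p x d) + itg c d (fun y => q b y - q a y).

(** p dx + q dy is differentiable at the point, and closed there: [be] is both
    the y-derivative of p and the x-derivative of q. *)
Definition closed_diff (x y : R) := exists al be ga : R, forall e, 0 < e ->
  exists2 r, 0 < r & forall x' y', `|x' - x| < r -> `|y' - y| < r ->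
    `|p x' y' - p x y - al * (x' - x) - be * (y' - y)| <= e * (`|x' - x| + `|y' - y|) /\
    `|q x' y' - q x y - be * (x' - x) - ga * (y' - y)| <= e * (`|x' - x| + `|y' - y|).

Lemma closed_diff_contx x y : closed_diff x y ->
  {for x, continuous (fun x => p x y)} /\ {for y, continuous (fun y => q x y)}.
Proof.
move=> [al [be [ga H]]]; have [r r0 Hr] := H 1 ltr01.
have half (k e : R) : 0 < e -> exists2 d, 0 < d & (1 + `|k|) * d < e /\ d <= r.
  move=> e0; exists (Num.min r (e / 2 / (1 + `|k|))).
    by rewrite lt_min r0 divr_gt0 ?divr_gt0// ltr_pwDl.
  have k0 : 0 < 1 + `|k| by rewrite ltr_pwDl.
  split; last by rewrite ge_min lexx.
  apply: (@le_lt_trans _ _ (e / 2)); last by lra.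
  by rewrite mulrC -ler_pdivlMr// ge_min lexx orbT.
split; apply/cvgrPdist_lt => e e0.
  have [d d0 [de dr]] := half al e e0.
  exists d => // x' /= xd; rewrite distrC.
  have xd' : `|x' - x| < d by rewrite distrC.
  have yy : `|y - y| < r by rewrite subrr normr0.
  have [+ _] := Hr x' y (lt_le_trans xd' dr) yy.
  rewrite subrr normr0 mulr0 subr0 addr0 mul1r => h.
  have : `|p x' y - p x y| <= (1 + `|al|) * `|x' - x|.
    rewrite -[X in `|X|](subrK (al * (x' - x))) (le_trans (ler_normD _ _))//.
    by rewrite mulrDl mul1r normrM lerD.
  have := normr_ge0 al; nra.
have [d d0 [de dr]] := half ga e e0.
exists d => // y' /= yd; rewrite distrC.
have yd' : `|y' - y| < d by rewrite distrC.
have xx : `|x - x| < r by rewrite subrr normr0.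
have [_] := Hr x y' xx (lt_le_trans yd' dr).
rewrite subrr normr0 mulr0 subr0 add0r mul1r => h.
have : `|q x y' - q x y| <= (1 + `|ga|) * `|y' - y|.
  rewrite -[X in `|X|](subrK (ga * (y' - y))) (le_trans (ler_normD _ _))//.
  by rewrite mulrDl mul1r normrM lerD.
have := normr_ge0 ga; nra.
Qed.

Definition diff_on (a b c d : R) := forall x y, a <= x <= b -> c <= y <= d -> closed_diff x y.

Lemma diff_onS a b c d a' b' c' d' : a <= a' -> b' <= b -> c <= c' -> d' <= d ->
  diff_on a b c d -> diff_on a' b' c' d'.
Proof.
move=> h1 h2 h3 h4 D x y /andP[x1 x2] /andP[y1 y2]; apply: D.
  by rewrite (le_trans h1 x1) (le_trans x2 h2).
by rewrite (le_trans h3 y1) (le_trans y2 h4).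
Qed.

Definition edge_cont (a b c d : R) :=
  (forall y, c <= y <= d -> cont_on a b (fun x => p x y)) /\
  (forall x, a <= x <= b -> cont_on c d (fun y => q x y)).

Lemma diff_on_cont a b c d : diff_on a b c d -> edge_cont a b c d.
Proof.
move=> D; split.
  by move=> y yy x xx; have [] := closed_diff_contx (D x y xx yy).
by move=> x xx y yy; have [] := closed_diff_contx (D x y xx yy).
Qed.

Lemma circ_splitx a e b c d : a <= e -> e <= b -> c <= d ->
  cont_on a b (fun x => p x c) -> cont_on a b (fun x => p x d) ->
  cont_on c d (q a) -> cont_on c d (q e) -> cont_on c d (q b) ->
  circ a b c d = circ a e c d + circ e b c d.
Proof.
move=> ae eb cd pc pd qa qe qb; rewrite /circ (itg_split ae eb); last exact: cont_onB.
have -> : itg c d (fun y => q b y - q a y) =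
    itg c d (fun y => (q e y - q a y) + (q b y - q e y)).
  by congr itg; apply/funext => y; ring.
by rewrite (itgD (cont_onB qe qa) (cont_onB qb qe)); ring.
Qed.

Lemma circ_splity a b c e d : c <= e -> e <= d -> a <= b ->
  cont_on a b (fun x => p x c) -> cont_on a b (fun x => p x e) ->
  cont_on a b (fun x => p x d) ->
  cont_on c d (q a) -> cont_on c d (q b) ->
  circ a b c d = circ a b c e + circ a b e d.
Proof.
move=> ce ed ab pc pe pd qa qb; rewrite /circ (itg_split ce ed); last exact: cont_onB.
have -> : itg a b (fun x => p x c - p x d) =
    itg a b (fun x => (p x c - p x e) + (p x e - p x d)).
  by congr itg; apply/funext => x; ring.
by rewrite (itgD (cont_onB pc pe) (cont_onB pe pd)); ring.
Qed.

(** The affine part of the form is exact, hence has no circulation; the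
    remainder is o(size) on a boundary of length O(size). *)
Lemma circ_small x y e : closed_diff x y -> 0 < e ->
  exists2 r, 0 < r & forall a b c d, a <= x <= b -> c <= y <= d -> b - a < r -> d - c < r ->
    edge_cont a b c d -> `|circ a b c d| <= 2 * e * (b - a + (d - c)) ^+ 2.
Proof.
move=> [al [be [ga H]]] e0; have [r r0 Hr] := H e e0; exists r => // a b c d.
move=> /andP[ax xb] /andP[cy yd] br dr [cp cq].
have ab : a <= b by exact: le_trans xb. have cd : c <= d by exact: le_trans yd.
set W := b - a; set V := d - c.
have W0 : 0 <= W by rewrite subr_ge0. have V0 : 0 <= V by rewrite subr_ge0.
have cc : c <= c <= d by rewrite lexx. have dd : c <= d <= d by rewrite lexx andbT.
have aa : a <= a <= b by rewrite lexx. have bb : a <= b <= b by rewrite lexx andbT.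
have xin t : a <= t <= b -> `|t - x| <= W.
  by move=> /andP[h1 h2]; rewrite ler_norml /W; apply/andP; split; lra.
have yin t : c <= t <= d -> `|t - y| <= V.
  by move=> /andP[h1 h2]; rewrite ler_norml /V; apply/andP; split; lra.
have lt1 t : a <= t <= b -> `|t - x| < r by move=> /xin h; exact: le_lt_trans h br.
have lt2 t : c <= t <= d -> `|t - y| < r by move=> /yin h; exact: le_lt_trans h dr.
have P t : a <= t <= b -> `|(p t c - p t d) - be * (c - d)| <= 2 * e * (W + V).
  move=> tt; have [h1 _] := Hr t c (lt1 _ tt) (lt2 _ cc).
  have [h2 _] := Hr t d (lt1 _ tt) (lt2 _ dd).
  have -> : (p t c - p t d) - be * (c - d) =
    (p t c - p x y - al * (t - x) - be * (c - y)) -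
    (p t d - p x y - al * (t - x) - be * (d - y)) by ring.
  apply: (le_trans (ler_normB _ _)).
  have := xin _ tt; have := yin _ cc; have := yin _ dd.
  move: h1 h2; move: `|t - x| `|c - y| `|d - y| => u v w h1 h2 k1 k2 k3; nra.
have Q t : c <= t <= d -> `|(q b t - q a t) - be * (b - a)| <= 2 * e * (W + V).
  move=> tt; have [_ h1] := Hr b t (lt1 _ bb) (lt2 _ tt).
  have [_ h2] := Hr a t (lt1 _ aa) (lt2 _ tt).
  have -> : (q b t - q a t) - be * (b - a) =
    (q b t - q x y - be * (b - x) - ga * (t - y)) -
    (q a t - q x y - be * (a - x) - ga * (t - y)) by ring.
  apply: (le_trans (ler_normB _ _)).
  have := yin _ tt; have := xin _ aa; have := xin _ bb.
  move: h1 h2; move: `|t - y| `|b - x| `|a - x| => u v w h1 h2 k1 k2 k3; nra.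
have ck k : cont_on a b (fun=> k) by move=> ? _; exact: cvg_cst.
have ck' k : cont_on c d (fun=> k) by move=> ? _; exact: cvg_cst.
have cP : cont_on a b (fun t => p t c - p t d - be * (c - d)).
  apply: (cont_onB _ (ck _)); apply: cont_onB; exact: cp.
have cQ : cont_on c d (fun t => q b t - q a t - be * (b - a)).
  apply: (cont_onB _ (ck' _)); apply: cont_onB; exact: cq.
have E1 : itg a b (fun t => p t c - p t d) =
    itg a b (fun t => p t c - p t d - be * (c - d)) + be * (c - d) * W.
  rewrite /W -(@itg_cst a b (be * (c - d)) ab) -(itgD cP (ck _)).
  by congr itg; apply/funext => t; ring.
have E2 : itg c d (fun t => q b t - q a t) =
    itg c d (fun t => q b t - q a t - be * (b - a)) + be * (b - a) * V.
  rewrite /V -(@itg_cst c d (be * (b - a)) cd) -(itgD cQ (ck' _)).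
  by congr itg; apply/funext => t; ring.
rewrite /circ E1 E2.
have I1 := itg_bound ab cP P; have I2 := itg_bound cd cQ Q.
rewrite (_ : _ + _ + _ = itg a b (fun t => p t c - p t d - be * (c - d)) +
  itg c d (fun t => q b t - q a t - be * (b - a))); last by rewrite /W /V; ring.
apply: (le_trans (ler_normD _ _)); apply: (le_trans (lerD I1 I2)).
by rewrite -/W -/V; apply: le_of_eq; ring.
Qed.

Lemma circ_quarter a b c d eta : a <= b -> c <= d -> edge_cont a b c d -> eta <= `|circ a b c d| ->
  exists a' c', [/\ (a' = a \/ a' = (a + b) / 2), (c' = c \/ c' = (c + d) / 2) &
    eta / 4 <= `|circ a' (a' + (b - a) / 2) c' (c' + (d - c) / 2)|].
Proof.
move=> ab cd [cp cq] hG; set e := (a + b) / 2; set f := (c + d) / 2.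
have ae : a <= e by rewrite /e; lra. have eb : e <= b by rewrite /e; lra.
have cf : c <= f by rewrite /f; lra. have fd : f <= d by rewrite /f; lra.
have [cc dd] : c <= c <= d /\ c <= d <= d by rewrite !lexx cd.
have [aa bb] : a <= a <= b /\ a <= b <= b by rewrite !lexx ab.
have ee : a <= e <= b by rewrite ae eb. have ff : c <= f <= d by rewrite cf fd.
have pS y a' b' : a <= a' -> b' <= b -> c <= y <= d -> cont_on a' b' (fun x => p x y).
  by move=> h1 h2 yy; apply: cont_onS h1 h2 (cp y yy).
have E : circ a b c d = circ a e c f + circ a e f d + (circ e b c f + circ e b f d).
  rewrite (@circ_splitx a e b c d)//; [|exact: cp|exact: cp|exact: cq|exact: cq|exact: cq].
  rewrite (@circ_splity a e c f d)//; [|exact: pS|exact: pS|exact: pS|exact: cq|exact: cq].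
  by rewrite (@circ_splity e b c f d)//; [exact: pS|exact: pS|exact: pS|exact: cq|exact: cq].
have ea : a + (b - a) / 2 = e by rewrite /e; field.
have eb' : e + (b - a) / 2 = b by rewrite /e; field.
have fc : c + (d - c) / 2 = f by rewrite /f; field.
have fd' : f + (d - c) / 2 = d by rewrite /f; field.
have [h1|h1] := leP (eta / 4) `|circ a e c f|.
  by exists a, c; split; [left|left|rewrite ea fc].
have [h2|h2] := leP (eta / 4) `|circ a e f d|.
  by exists a, f; split; [left|right|rewrite ea fd'].
have [h3|h3] := leP (eta / 4) `|circ e b c f|.
  by exists e, c; split; [right|left|rewrite eb' fc].
have [h4|h4] := leP (eta / 4) `|circ e b f d|.
  by exists e, f; split; [right|right|rewrite eb' fd'].
exfalso; move: hG; rewrite E.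
have := ler_normD (circ a e c f + circ a e f d) (circ e b c f + circ e b f d).
have := ler_normD (circ a e c f) (circ a e f d).
have := ler_normD (circ e b c f) (circ e b f d).
move: h1 h2 h3 h4; lra.
Qed.

Lemma nested_point (X w : nat -> R) : (forall k, X k <= X k.+1) ->
  (forall k, X k.+1 + w k.+1 <= X k + w k) -> (forall k, 0 <= w k) ->
  exists x, forall k, X k <= x <= X k + w k.
Proof.
move=> Xi Xd w0.
have mi i j : X i <= X (i + j)%N.
  by elim: j => [|j IH]; rewrite ?addn0// addnS; exact: le_trans IH (Xi _).
have md i j : X (i + j)%N + w (i + j)%N <= X i + w i.
  by elim: j => [|j IH]; rewrite ?addn0// addnS; exact: le_trans (Xd _) IH.
have ub i k : X i <= X k + w k.
  have [ik|/ltnW ki] := leqP i k.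
    by rewrite -(subnKC ik); apply: le_trans (mi i (k - i)%N) _; rewrite lerDl.
  by apply: le_trans (md k (i - k)%N); rewrite (subnKC ki) lerDl.
have hs : has_sup (range X).
  by split; [exists (X 0%N); exists 0%N|exists (X 0%N + w 0%N) => _ [i _ <-]].
exists (sup (range X)) => k; apply/andP; split.
  by apply: ub_le_sup; [exact: hs.2|exists k].
by apply: ge_sup; [exact: hs.1|move=> _ [i _ <-]].
Qed.

(** Otherwise repeated quartering gives rectangles shrinking to a point whose
    circulation is at least a constant times the square of their size, against
    [circ_small]. *)
Lemma goursat a b c d : a <= b -> c <= d -> diff_on a b c d -> circ a b c d = 0.
Proof.
move=> ab cd D; apply/eqP/negPn/negP => G0.
set eta := `|circ a b c d|; have eta0 : 0 < eta by rewrite normr_gt0.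
pose W k := (b - a) / 2 ^+ k; pose V k := (d - c) / 2 ^+ k.
have p2 k : (0 : R) < 2 ^+ k by rewrite exprn_gt0.
have W0 k : 0 <= W k by rewrite divr_ge0 ?subr_ge0// ltW.
have V0 k : 0 <= V k by rewrite divr_ge0 ?subr_ge0// ltW.
have WS k : W k.+1 = W k / 2 by rewrite /W exprS; field; rewrite gt_eqF.
have VS k : V k.+1 = V k / 2 by rewrite /V exprS; field; rewrite gt_eqF.
pose bad k (z : R * R) := [/\ a <= z.1, z.1 + W k <= b, c <= z.2, z.2 + V k <= d &
  eta / 4 ^+ k <= `|circ z.1 (z.1 + W k) z.2 (z.2 + V k)|].
have step (kz : nat * (R * R)) : exists z' : R * R, bad kz.1 kz.2 ->
    [/\ kz.2.1 <= z'.1, z'.1 + W kz.1.+1 <= kz.2.1 + W kz.1,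
        kz.2.2 <= z'.2, z'.2 + V kz.1.+1 <= kz.2.2 + V kz.1 & bad kz.1.+1 z'].
  case: kz => k [x y] /=.
  have [bd|nb] := pselect (bad k (x, y)); last by exists (x, y).
  case: (bd) => /= h1 h2 h3 h4 h5.
  have xW : x <= x + W k by rewrite lerDl.
  have yV : y <= y + V k by rewrite lerDl.
  have ec := diff_on_cont (diff_onS h1 h2 h3 h4 D).
  have [x' [y' [hx hy]]] := circ_quarter xW yV ec h5.
  rewrite [x + _ - x]addrAC subrr add0r [y + _ - y]addrAC subrr add0r => hG.
  have Wk := W0 k; have Vk := V0 k.
  have xx : x <= x' /\ x' + W k / 2 <= x + W k by case: hx => ->; split; lra.
  have yy : y <= y' /\ y' + V k / 2 <= y + V k by case: hy => ->; split; lra.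
  exists (x', y') => _; rewrite /bad /= WS VS.
  case: xx yy => [x1 x2] [y1 y2]; split => //; split => //.
  - exact: le_trans x1.
  - exact: le_trans x2 h2.
  - exact: le_trans y1.
  - exact: le_trans y2 h4.
  - by move: hG; rewrite exprSr invfM mulrA.
have [g Hg] := choice step.
pose st := fix st k := if k is k'.+1 then g (k', st k') else (a, c).
have bst k : bad k (st k).
  elim: k => [|k IH].
    by rewrite /bad /= /W /V expr0 !divr1 !subrKC !lexx.
  by have [] := Hg (k, st k) IH.
have [x Hx] : exists x, forall k, (st k).1 <= x <= (st k).1 + W k.
  by apply: nested_point => // k; have [] := Hg (k, st k) (bst k).
have [y Hy] : exists y, forall k, (st k).2 <= y <= (st k).2 + V k.
  by apply: nested_point => // k; have [] := Hg (k, st k) (bst k).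
have xab : a <= x <= b.
  by have := Hx 0%N; rewrite /= /W expr0 divr1 subrKC.
have ycd : c <= y <= d.
  by have := Hy 0%N; rewrite /= /V expr0 divr1 subrKC.
pose S := (b - a + (d - c)) ^+ 2.
have S0 : 0 <= S by exact: sqr_ge0.
have e0 : 0 < eta / (4 * (S + 1)) by rewrite divr_gt0// mulr_gt0// ltr_pwDr.
have [r r0 Hr] := circ_small (D x y xab ycd) e0.
pose k := Num.truncn ((b - a + (d - c)) / r).
have L0 : 0 <= b - a + (d - c) by rewrite addr_ge0// subr_ge0.
have kr : (b - a + (d - c)) / 2 ^+ k < r.
  rewrite ltr_pdivrMr// mulrC -ltr_pdivrMr//.
  apply: (lt_le_trans (truncnS_gt _)); rewrite -/k -natrX ler_nat.
  exact: ltn_expl.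
have [h1 h2 h3 h4 h5] := bst k.
have Wr : W k < r by apply: le_lt_trans kr; rewrite ler_pM2r ?invr_gt0// lerDl subr_ge0.
have Vr : V k < r by apply: le_lt_trans kr; rewrite ler_pM2r ?invr_gt0// lerDr subr_ge0.
have ec := diff_on_cont (diff_onS h1 h2 h3 h4 D).
have xE : (st k).1 + W k - (st k).1 = W k by rewrite addrAC subrr add0r.
have yE : (st k).2 + V k - (st k).2 = V k by rewrite addrAC subrr add0r.
have := Hr _ _ _ _ (Hx k) (Hy k); rewrite xE yE => /(_ Wr Vr ec).
rewrite leNgt => /negP; apply; apply: lt_le_trans h5.
have -> : (W k + V k) ^+ 2 = S / 4 ^+ k.
  rewrite /W /V -mulrDl exprMn exprVn -exprM mulnC exprM.
  by rewrite (_ : (2 : R) ^+ 2 = 4) // expr2; ring.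
rewrite mulrA ltr_pM2r ?invr_gt0 ?exprn_gt0//.
have S1 : 0 < S + 1 by rewrite ltr_pwDr.
rewrite (_ : 2 * _ * S = eta * (S / (2 * (S + 1)))); last by field; rewrite gt_eqF.
rewrite -[ltRHS]mulr1 ltr_pM2l// ltr_pdivrMr ?mulr_gt0//; lra.
Qed.

(** By [goursat], only a small square of side 2 r around the hole contributes;
    there the circulation is O(r) as the form is bounded. *)
Lemma circ_hole a b c d x0 y0 r0 B : a < x0 < b -> c < y0 < d -> 0 < r0 ->
  (forall x y, a <= x <= b -> c <= y <= d -> (x, y) != (x0, y0) -> closed_diff x y) ->
  (forall x y, `|x - x0| <= r0 -> `|y - y0| <= r0 -> `|p x y| <= B /\ `|q x y| <= B) ->
  circ a b c d = 0.
Proof.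
move=> /andP[ax xb] /andP[cy yd] r00 D HB.
have B0 : 0 <= B.
  have z0 (u : R) : `|u - u| <= r0 by rewrite subrr normr0 ltW.
  by have [h _] := HB x0 y0 (z0 x0) (z0 y0); exact: le_trans h.
pose rm := Num.min r0 (Num.min (Num.min (x0 - a) (b - x0)) (Num.min (y0 - c) (d - y0))).
have rm0 : 0 < rm by rewrite !lt_min r00 !subr_gt0 ax xb cy yd.
suff key r : 0 < r -> r <= rm -> `|circ a b c d| <= 8 * B * r.
  apply/eqP; rewrite -normr_eq0 eq_le normr_ge0 andbT; apply/ler_addgt0Pr => e e0.
  rewrite add0r.
  pose r := Num.min rm (e / (8 * B + 1)).
  have b1 : 0 < 8 * B + 1 by lra.
  have rr : 0 < r by rewrite lt_min rm0 divr_gt0.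
  apply: (le_trans (key r rr _)); first by rewrite ge_min lexx.
  apply: (@le_trans _ _ ((8 * B + 1) * (e / (8 * B + 1)))).
    apply: ler_pM; [lra|exact: ltW|lra|by rewrite /r ge_min lexx orbT].
  by rewrite mulrC divfK// gt_eqF.
move=> r_gt0; rewrite !le_min => /and3P[rr0 /andP[r1 r2] /andP[r3 r4]].
have D' a' b' c' d' : a <= a' -> b' <= b -> c <= c' -> d' <= d ->
    (forall x y, a' <= x <= b' -> c' <= y <= d' -> (x, y) != (x0, y0)) ->
    diff_on a' b' c' d'.
  move=> h1 h2 h3 h4 ne x y xx yy; have := ne _ _ xx yy; move: xx yy.
  move=> /andP[x1 x2] /andP[y1 y2]; apply: D.
    by rewrite (le_trans h1 x1) (le_trans x2 h2).
  by rewrite (le_trans h3 y1) (le_trans y2 h4).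
have nex x y : x != x0 -> (x, y) != (x0, y0) by move=> h; rewrite xpair_eqE negb_and h.
have ney x y : y != y0 -> (x, y) != (x0, y0) by move=> h; rewrite xpair_eqE negb_and h orbT.
have cX x : a <= x <= b -> x != x0 -> cont_on c d (q x).
  by move=> xx nx y yy; have [] := closed_diff_contx (D x y xx yy (nex _ _ nx)).
have cY y : c <= y <= d -> y != y0 -> cont_on a b (fun x => p x y).
  by move=> yy ny x xx; have [] := closed_diff_contx (D x y xx yy (ney _ _ ny)).
have [aa bb] : a <= a <= b /\ a <= b <= b by rewrite !lexx; split; lra.
have [cc dd] : c <= c <= d /\ c <= d <= d by rewrite !lexx; split; lra.
set x1 := x0 - r; set x2 := x0 + r; set y1 := y0 - r; set y2 := y0 + r.
have x1n : x1 != x0 by apply/eqP; rewrite /x1; lra.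
have x2n : x2 != x0 by apply/eqP; rewrite /x2; lra.
have y1n : y1 != y0 by apply/eqP; rewrite /y1; lra.
have y2n : y2 != y0 by apply/eqP; rewrite /y2; lra.
have an : a != x0 by rewrite lt_eqF. have bn : b != x0 by rewrite gt_eqF.
have cn : c != y0 by rewrite lt_eqF. have dn : d != y0 by rewrite gt_eqF.
have x1i : a <= x1 <= b by rewrite /x1; lra.
have x2i : a <= x2 <= b by rewrite /x2; lra.
have y1i : c <= y1 <= d by rewrite /y1; lra.
have y2i : c <= y2 <= d by rewrite /y2; lra.
have x12 : x1 <= x2 by rewrite /x1 /x2; lra.
have y12 : y1 <= y2 by rewrite /y1 /y2; lra.
have [ax1 x1b] := andP x1i; have [ax2 x2b] := andP x2i.
have [cy1 y1d] := andP y1i; have [cy2 y2d] := andP y2i.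
have cd : c <= d by lra.
have S a' b' f : a <= a' -> b' <= b -> cont_on a b f -> cont_on a' b' f by exact: cont_onS.
have T c' d' f : c <= c' -> d' <= d -> cont_on c d f -> cont_on c' d' f by exact: cont_onS.
rewrite (@circ_splitx a x1 b c d)//; [|exact: cY|exact: cY|exact: cX|exact: cX|exact: cX].
rewrite (@circ_splitx x1 x2 b c d)//; [|exact/S/cY|exact/S/cY|exact: cX|exact: cX|exact: cX].
rewrite (@circ_splity x1 x2 c y1 d)//;
  [|exact/S/cY|exact/S/cY|exact/S/cY|exact: cX|exact: cX].
rewrite (@circ_splity x1 x2 y1 y2 d)//;
  [|exact/S/cY|exact/S/cY|exact/S/cY|exact/T/cX|exact/T/cX].
have -> : circ a x1 c d = 0.
  apply: goursat => //; apply: D' => // x y /andP[_ h] _; apply: nex.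
  by rewrite lt_eqF// (le_lt_trans h)// /x1; lra.
have -> : circ x2 b c d = 0.
  apply: goursat => //; apply: D' => // x y /andP[h _] _; apply: nex.
  by rewrite gt_eqF// (lt_le_trans _ h)// /x2; lra.
have -> : circ x1 x2 c y1 = 0.
  apply: goursat => //; apply: D' => // x y _ /andP[_ h]; apply: ney.
  by rewrite lt_eqF// (le_lt_trans h)// /y1; lra.
have -> : circ x1 x2 y2 d = 0.
  apply: goursat => //; apply: D' => // x y _ /andP[h _]; apply: ney.
  by rewrite gt_eqF// (lt_le_trans _ h)// /y2; lra.
rewrite !add0r !addr0 /circ.
have near1 x : x1 <= x <= x2 -> `|x - x0| <= r0.
  by move=> /andP[h1 h2]; rewrite ler_norml; move: h1 h2; rewrite /x1 /x2; lra.
have near2 y : y1 <= y <= y2 -> `|y - y0| <= r0.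
  by move=> /andP[h1 h2]; rewrite ler_norml; move: h1 h2; rewrite /y1 /y2; lra.
have [n1 n2] : x1 <= x1 <= x2 /\ x1 <= x2 <= x2 by rewrite !lexx x12.
have [n3 n4] : y1 <= y1 <= y2 /\ y1 <= y2 <= y2 by rewrite !lexx y12.
have I1 : `|itg x1 x2 (fun x => p x y1 - p x y2)| <= 2 * B * (x2 - x1).
  apply: itg_bound => //; first by apply: cont_onB; exact/S/cY.
  move=> x xx; apply: (le_trans (ler_normB _ _)).
  have [h1 _] := HB x y1 (near1 _ xx) (near2 _ n3).
  have [h2 _] := HB x y2 (near1 _ xx) (near2 _ n4); lra.
have I2 : `|itg y1 y2 (fun y => q x2 y - q x1 y)| <= 2 * B * (y2 - y1).
  apply: itg_bound => //; first by apply: cont_onB; exact/T/cX.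
  move=> y yy; apply: (le_trans (ler_normB _ _)).
  have [_ h1] := HB x1 y (near1 _ n1) (near2 _ yy).
  have [_ h2] := HB x2 y (near1 _ n2) (near2 _ yy); lra.
apply: (le_trans (ler_normD _ _)); apply: (le_trans (lerD I1 I2)).
by rewrite /x1 /x2 /y1 /y2; apply: le_of_eq; ring.
Qed.

End goursat.

(** * Complex differentiability *)
Section cplx.
Context {R : realType}.
Local Notation C := (R[i]).
Local Notation nc := (@Normc.normc R).
Local Open Scope complex_scope.
Implicit Types z w h : C.

Lemma nc_ge0 z : 0 <= nc z.
Proof. by case: z => a b; exact: sqrtr_ge0. Qed.

Lemma ncM z w : nc (z * w) = nc z * nc w.
Proof. exact: Normc.normcM. Qed.

Lemma ncV z : nc z^-1 = (nc z)^-1.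
Proof. exact: Normc.normcV. Qed.

Lemma ncD z w : nc (z + w) <= nc z + nc w.
Proof. exact: le_normcD. Qed.

Lemma ncN z : nc (- z) = nc z.
Proof. exact: normcN. Qed.

Lemma nc0 : nc 0 = 0.
Proof. exact: Normc.normc0. Qed.

Lemma ncB z w : nc (z - w) <= nc z + nc w.
Proof. by rewrite -(ncN w); exact: ncD. Qed.

Lemma ncBC z w : nc (z - w) = nc (w - z).
Proof. by rewrite -ncN opprB. Qed.

Lemma nc_eq0 z : (nc z == 0) = (z == 0).
Proof. by apply/eqP/eqP => [/Normc.eq0_normc//|->]; exact: nc0. Qed.

Lemma nc_gt0 z : z != 0 -> 0 < nc z.
Proof. by move=> z0; rewrite lt_neqAle eq_sym nc_eq0 z0 nc_ge0. Qed.

Lemma nc_real (a : R) : nc (a%:C) = `|a|.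
Proof. by rewrite /Normc.normc /= expr0n addr0 sqrtr_sqr. Qed.

Lemma ncX z n : nc (z ^+ n) = nc z ^+ n.
Proof. by elim: n => [|n IH]; rewrite ?expr0 ?Normc.normc1// !exprS ncM IH. Qed.

Lemma Re_le_nc z : `|Re z| <= nc z.
Proof.
by case: z => a b /=; rewrite -sqrtr_sqr; apply: ler_wsqrtr; rewrite lerDl sqr_ge0.
Qed.

Lemma Im_le_nc z : `|Im z| <= nc z.
Proof.
by case: z => a b /=; rewrite -sqrtr_sqr; apply: ler_wsqrtr; rewrite lerDr sqr_ge0.
Qed.

Lemma nc_le z : nc z <= `|Re z| + `|Im z|.
Proof.
case: z => a b /=; rewrite -[leRHS]ger0_norm ?addr_ge0// -sqrtr_sqr; apply: ler_wsqrtr.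
by rewrite sqrrD !real_normK ?num_real// lerD2r lerDl mulrn_wge0// mulr_ge0.
Qed.

(** Increments are measured by the real-valued modulus, which keeps the error
    bounds in R and their order total. *)
Definition cdiff (f : C -> C) z := exists d : C, forall e : R, 0 < e ->
  exists2 r : R, 0 < r & forall h, nc h < r -> nc (f (z + h) - f z - d * h) <= e * nc h.

Lemma cdiff_bound f z : cdiff f z ->
  exists2 K : R, 0 < K & exists2 r : R, 0 < r & forall h, nc h < r -> nc (f (z + h) - f z) <= K * nc h.
Proof.
move=> [d H]; have [r r0 Hr] := H 1 ltr01.
exists (1 + nc d); first by rewrite ltr_pwDl ?nc_ge0.
exists r => // h hr; rewrite -[X in nc X](subrK (d * h)) (le_trans (ncD _ _))//.
by rewrite mulrDl lerD ?Hr// ncM.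
Qed.

Lemma cdiff_cst k z : cdiff (fun=> k) z.
Proof.
exists 0 => e e0; exists 1 => // h _; rewrite subrr mul0r subrr nc0.
by rewrite mulr_ge0 ?nc_ge0// ltW.
Qed.

Lemma cdiffB f g z : cdiff f z -> cdiff g z -> cdiff (fun z => f z - g z) z.
Proof.
move=> [d Hd] [c Hc]; exists (d - c) => e e0.
have e2 : 0 < e / 2 by rewrite divr_gt0.
have [r r0 Hr] := Hd _ e2; have [q q0 Hq] := Hc _ e2.
exists (Num.min r q); first by rewrite lt_min r0.
move=> h; rewrite lt_min => /andP[hr hq].
rewrite (_ : _ - _ = (f (z + h) - f z - d * h) - (g (z + h) - g z - c * h)); last by ring.
apply: (le_trans (ncB _ _)); have := Hr h hr; have := Hq h hq.
move=> h1 h2; have -> : e * nc h = e / 2 * nc h + e / 2 * nc h by field.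
exact: lerD.
Qed.

Lemma cdiffM f g z : cdiff f z -> cdiff g z -> cdiff (fun z => f z * g z) z.
Proof.
move=> df dg; have [Kg Kg0 [rg rg0 Hg]] := cdiff_bound dg.
case: df => d Hd; case: dg => c Hc; exists (d * g z + f z * c) => e e0.
have M0 : 0 < nc (g z) + 1 by rewrite ltr_wpDl ?nc_ge0.
have F0 : 0 < nc (f z) + 1 by rewrite ltr_wpDl ?nc_ge0.
have D0 : 0 < nc d + 1 by rewrite ltr_wpDl ?nc_ge0.
pose e1 := e / 3 / (nc (g z) + 1); pose e2 := e / 3 / (nc (f z) + 1).
have e10 : 0 < e1 by rewrite !divr_gt0. have e20 : 0 < e2 by rewrite !divr_gt0.
have [r r0 Hr] := Hd _ e10; have [q q0 Hq] := Hc _ e20.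
pose r3 := e / 3 / (Kg * (nc d + 1)).
have r30 : 0 < r3 by rewrite !divr_gt0// mulr_gt0.
exists (Num.min (Num.min r q) (Num.min (Num.min rg Kg^-1) r3)).
  by rewrite !lt_min r0 q0 rg0 invr_gt0 Kg0.
move=> h; rewrite !lt_min => /and3P[/andP[hr hq] /andP[hg hK] h3].
have nh := nc_ge0 h.
have gb : nc (g (z + h) - g z) <= Kg * nc h by exact: Hg.
have gb1 : nc (g (z + h)) <= nc (g z) + 1.
  have t : nc (g (z + h)) <= nc (g (z + h) - g z) + nc (g z).
    by rewrite -{1}(subrK (g z) (g (z + h))); exact: ncD.
  have : Kg * nc h <= 1 by rewrite -ler_pdivlMl// mulr1 ltW.
  lra.
rewrite (_ : _ - _ = (f (z + h) - f z - d * h) * g (z + h) +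
   (d * h * (g (z + h) - g z) + f z * (g (z + h) - g z - c * h))); last by ring.
have -> : e * nc h = e / 3 * nc h + (e / 3 * nc h + e / 3 * nc h) by field.
apply: (le_trans (ncD _ _)); apply: lerD.
  rewrite ncM; apply: (@le_trans _ _ (e1 * nc h * (nc (g z) + 1))).
    by apply: ler_pM; rewrite ?nc_ge0// Hr.
  by rewrite /e1; apply: le_of_eq; field; rewrite gt_eqF.
apply: (le_trans (ncD _ _)); apply: lerD; last first.
  rewrite ncM; apply: (@le_trans _ _ ((nc (f z) + 1) * (e2 * nc h))).
    by apply: ler_pM; rewrite ?nc_ge0 ?lerDl// Hq.
  by rewrite /e2; apply: le_of_eq; field; rewrite gt_eqF.
rewrite !ncM; apply: (@le_trans _ _ ((nc d + 1) * nc h * (Kg * nc h))).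
  apply: ler_pM; rewrite ?mulr_ge0 ?nc_ge0//.
  by rewrite ler_wpM2r// lerDl.
apply: (@le_trans _ _ ((nc d + 1) * nc h * (Kg * r3))).
  by rewrite ler_wpM2l ?mulr_ge0// ?ler_wpM2l ?ltW.
rewrite /r3; apply: le_of_eq; field.
by rewrite !gt_eqF.
Qed.

Lemma cdiff_inv_lin (a z : C) : z != a -> cdiff (fun z => (z - a)^-1) z.
Proof.
rewrite -subr_eq0 => w0; set w := z - a in w0.
have n0 : 0 < nc w by exact: nc_gt0.
exists (- (w ^+ 2)^-1) => e e0.
have r0 : 0 < e * nc w ^+ 3 / 2 by rewrite divr_gt0// mulr_gt0// exprn_gt0.
exists (Num.min (nc w / 2) (e * nc w ^+ 3 / 2)); first by rewrite lt_min divr_gt0.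
move=> h; rewrite lt_min => /andP[h1 h2].
have wh : nc w / 2 <= nc (w + h).
  have : nc w <= nc (w + h) + nc h by rewrite -{1}(addrK h w); exact: ncB.
  lra.
have wh0 : w + h != 0 by rewrite -nc_eq0 gt_eqF// (lt_le_trans _ wh)// divr_gt0.
rewrite (_ : z + h - a = w + h); last by rewrite /w addrAC.
rewrite -/w.
rewrite (_ : _ - _ = h ^+ 2 * ((w ^+ 2)^-1 * (w + h)^-1)); last by field; rewrite w0 wh0.
rewrite !ncM !ncV !ncX.
have nh := nc_ge0 h.
rewrite expr2 -mulrA mulrC ler_wpM2r// -invfM ler_pdivrMr; last first.
  by rewrite !mulr_gt0 ?nc_gt0 ?n0.
apply: (@le_trans _ _ (e * (nc w * nc w * (nc w / 2)))).
  by apply: (le_trans (ltW h2)); apply: le_of_eq; field.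
by rewrite ler_pM2l// ler_pM2l// mulr_gt0.
Qed.

(** The Cauchy-Riemann equations: Im f dx + Re f dy is the imaginary part of
    f dz. *)
Lemma cdiff_closed f x y : cdiff f (x +i* y) ->
  closed_diff (fun x y => Im (f (x +i* y))) (fun x y => Re (f (x +i* y))) x y.
Proof.
move=> [[d1 d2] H]; exists d2, d1, (- d2) => e e0; have [r r0 Hr] := H e e0.
exists (r / 2) => [|x' y' xr yr]; first by rewrite divr_gt0.
pose h : C := (x' - x) +i* (y' - y).
have nh : nc h <= `|x' - x| + `|y' - y| by exact: nc_le.
have hr : nc h < r by apply: (le_lt_trans nh); lra.
have zh : x +i* y + h = x' +i* y' by rewrite /h; simpc; rewrite !subrKC.
have := Hr h hr; rewrite zh => hh.
have hb : nc (f (x' +i* y') - f (x +i* y) - (d1 +i* d2) * h) <=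
    e * (`|x' - x| + `|y' - y|).
  by apply: (le_trans hh); rewrite ler_pM2l.
split.
  apply: le_trans hb; apply: le_trans (Im_le_nc _).
  rewrite /h; case: (f _) => a b; case: (f _) => a' b' /=.
  by apply: le_of_eq; congr (`|_|); ring.
apply: le_trans hb; apply: le_trans (Re_le_nc _).
rewrite /h; case: (f _) => a b; case: (f _) => a' b' /=.
by apply: le_of_eq; congr (`|_|); ring.
Qed.

End cplx.

(** * A mean value inequality on the strip *)
Lemma Rintegral_dominated_cvg d (T : measurableType d) (R : realType)
    (m : {measure set T -> \bar R}) (F : nat -> T -> R) (f G : T -> R) :
  (forall k, measurable_fun setT (F k)) -> measurable_fun setT f ->
  m.-integrable setT (EFin \o G) -> (forall k x, `|F k x| <= G x) ->
  (forall x, F k x @[k --> \oo] --> f x) ->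
  \int[m]_x F k x @[k --> \oo] --> \int[m]_x f x.
Proof.
move=> mF mf iG FG Ff.
have mF' k : measurable_fun setT (EFin \o F k) by apply/measurable_EFinP; exact: mF.
have mf' : measurable_fun setT (EFin \o f) by exact/measurable_EFinP.
have Ff' : {ae m, forall x, setT x -> (EFin \o F k) x @[k --> \oo] --> (EFin \o f) x}.
  by apply: aeW => x _ /=; apply: cvg_EFin; [exact: nearW|exact: Ff].
have FG' : {ae m, forall x k, setT x -> (`|(EFin \o F k) x| <= (EFin \o G) x)%E}.
  by apply: aeW => x k _ /=; rewrite lee_fin FG.
have [i _ h] := dominated_convergence measurableT mF' mf' Ff' iG FG'.
apply: fine_cvg; rewrite /Rintegral fineK; last exact: integrable_fin_num.
exact: h.
Qed.

Section itg_more.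
Context {R : realType}.
Local Notation mu := (@lebesgue_measure R).

Lemma itgZ a b k (f : R -> R) : cont_on a b f -> itg a b (fun x => k * f x) = k * itg a b f.
Proof. by move=> /cont_on_integrable cf; rewrite /itg RintegralZl. Qed.

Lemma itg_le a b (f g : R -> R) : cont_on a b f -> cont_on a b g ->
  (forall x, a <= x <= b -> f x <= g x) -> itg a b f <= itg a b g.
Proof.
move=> /cont_on_integrable cf /cont_on_integrable cg fg; exact: le_Rintegral.
Qed.

Lemma itg_ge0 a b (f : R -> R) : (forall x, a <= x <= b -> 0 <= f x) -> 0 <= itg a b f.
Proof. by move=> f0; apply: Rintegral_ge0 => x /=; rewrite in_itv/= => /f0. Qed.

Lemma itg_le_full a b (f : R -> R) : mu.-integrable setT (EFin \o f) ->
  (forall x, 0 <= f x) -> itg a b f <= \int[mu]_x f x.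
Proof.
move=> fi f0; have fS : mu.-integrable `[a, b] (EFin \o f) by exact: integrableS fi.
rewrite /itg /Rintegral fine_le//; [exact: integrable_fin_num|exact: integrable_fin_num|].
apply: ge0_subset_integral => //; first by case/integrableP: fi.
by move=> x _; rewrite lee_fin.
Qed.

Lemma cont_onZ a b k (f : R -> R) : cont_on a b f -> cont_on a b (fun x => k * f x).
Proof. by move=> cf x xab; apply: cvgM; [exact: cvg_cst|exact: cf]. Qed.

Lemma cont_onD a b (f g : R -> R) : cont_on a b f -> cont_on a b g ->
  cont_on a b (fun x => f x + g x).
Proof. by move=> cf cg x xab; apply: cvgD; [exact: cf|exact: cg]. Qed.

Lemma cont_on_cst a b (k : R) : cont_on a b (fun=> k).
Proof. by move=> x _; exact: cvg_cst. Qed.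

Lemma circ_lin (p1 q1 p2 q2 : R -> R -> R) r a b c d :
  cont_on a b (fun x => p1 x c) -> cont_on a b (fun x => p1 x d) ->
  cont_on c d (q1 a) -> cont_on c d (q1 b) ->
  cont_on a b (fun x => p2 x c) -> cont_on a b (fun x => p2 x d) ->
  cont_on c d (q2 a) -> cont_on c d (q2 b) ->
  circ (fun x y => p1 x y - r * p2 x y) (fun x y => q1 x y - r * q2 x y) a b c d =
  circ p1 q1 a b c d - r * circ p2 q2 a b c d.
Proof.
move=> h1 h2 h3 h4 h5 h6 h7 h8; rewrite /circ.
have -> : (fun x => p1 x c - r * p2 x c - (p1 x d - r * p2 x d)) =
  (fun x => (p1 x c - p1 x d) + (- r) * (p2 x c - p2 x d)) by apply/funext => x; ring.
have -> : (fun y => q1 b y - r * q2 b y - (q1 a y - r * q2 a y)) =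
  (fun y => (q1 b y - q1 a y) + (- r) * (q2 b y - q2 a y)) by apply/funext => x; ring.
rewrite (itgD (cont_onB h1 h2) (cont_onZ (k := - r) (cont_onB h5 h6))).
rewrite (itgD (cont_onB h4 h3) (cont_onZ (k := - r) (cont_onB h8 h7))).
rewrite (itgZ _ (cont_onB h5 h6)) (itgZ _ (cont_onB h8 h7)); ring.
Qed.

End itg_more.

Section strip.
Context {R : realType}.
Local Notation C := (R[i]).
Local Notation nc := (@Normc.normc R).
Local Notation mu := (@lebesgue_measure R).
Local Open Scope complex_scope.

Lemma complexV (a b : R) :
  (a +i* b)^-1 = (a / (a ^+ 2 + b ^+ 2)) +i* (- b / (a ^+ 2 + b ^+ 2)) :> C.
Proof. by rewrite mulNr. Qed.

Lemma complex_subC (a b c : R) : (a +i* b) - c%:C = (a - c) +i* b :> C.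
Proof. by simpc. Qed.

Lemma ReM_real (r : R) (z : C) : Re (r%:C * z) = r * Re z.
Proof. by case: z => a b /=; rewrite mul0r subr0. Qed.

Lemma ImM_real (r : R) (z : C) : Im (r%:C * z) = r * Im z.
Proof. by case: z => a b /=; rewrite mul0r addr0. Qed.

Lemma ReB (z w : C) : Re (z - w) = Re z - Re w.
Proof. by case: z w => ? ? []. Qed.

Lemma ImB (z w : C) : Im (z - w) = Im z - Im w.
Proof. by case: z w => ? ? []. Qed.

Lemma conjM_self (z : C) : z^* * z = (nc z ^+ 2)%:C.
Proof.
by case: z => a b; simpc; rewrite /= sqr_sqrtr ?addr_ge0 ?sqr_ge0//; congr (_ +i* _); ring.
Qed.

Lemma nc_conj (z : C) : nc z^* = nc z.
Proof. by case: z => a b /=; rewrite sqrrN. Qed.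

Section pole.
Variable s : R.

Definition pole (z : C) : C := (z - s%:C)^-1.

Lemma Re_pole x y : Re (pole (x +i* y)) = (x - s) / ((x - s) ^+ 2 + y ^+ 2).
Proof. by rewrite /pole complex_subC complexV. Qed.

Lemma Im_pole x y : Im (pole (x +i* y)) = - y / ((x - s) ^+ 2 + y ^+ 2).
Proof. by rewrite /pole complex_subC complexV. Qed.

Lemma nc_pole_Re x y d : 0 < d -> d <= `|x - s| -> nc (pole (x +i* y)) <= d^-1.
Proof.
move=> d0 dx; rewrite /pole ncV lef_pV2 ?posrE//.
  by apply: (le_trans dx); rewrite (le_trans _ (Re_le_nc _))// complex_subC.
by apply: (lt_le_trans d0); apply: (le_trans dx); rewrite (le_trans _ (Re_le_nc _))// complex_subC.
Qed.

Lemma nc_pole_Im x y d : 0 < d -> d <= `|y| -> nc (pole (x +i* y)) <= d^-1.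
Proof.
move=> d0 dx; rewrite /pole ncV lef_pV2 ?posrE//.
  by apply: (le_trans dx); rewrite (le_trans _ (Im_le_nc _))// complex_subC.
by apply: (lt_le_trans d0); apply: (le_trans dx); rewrite (le_trans _ (Im_le_nc _))// complex_subC.
Qed.

Lemma cdiff_pole x y : (x, y) != (s, 0) -> cdiff pole (x +i* y).
Proof.
move=> h; apply: cdiff_inv_lin; apply: contraNneq h => -[-> ->].
exact: eqxx.
Qed.

(** All four edges contribute with the same sign, and the part of the left edge
    at height at most 1 suffices for a bound independent of T. *)
Lemma circ_pole_ge d T : 0 < d -> d <= s / 2 -> d <= (1 - s) / 2 -> 1 <= T ->
  s / 2 <= circ (fun x y => Im (pole (x +i* y)))
                (fun x y => Re (pole (x +i* y))) d (1 - d) (- T) T.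
Proof.
move=> d0 ds ds' T1; rewrite /circ -[s / 2]add0r; apply: lerD.
  apply: itg_ge0 => x _; rewrite !Im_pole sqrrN -mulrBl.
  by apply: mulr_ge0; [lra|rewrite invr_ge0 addr_ge0 ?sqr_ge0].
pose g y := Re (pole ((1 - d) +i* y)) - Re (pole (d +i* y)).
have gE y : g y = (1 - d - s) / ((1 - d - s) ^+ 2 + y ^+ 2) + (s - d) / ((d - s) ^+ 2 + y ^+ 2).
  by rewrite /g !Re_pole -mulNr opprB.
have g0 y : 0 <= g y.
  by rewrite gE; apply: addr_ge0; (apply: mulr_ge0; [lra|rewrite invr_ge0 addr_ge0 ?sqr_ge0]).
have gl y : -1 <= y <= 1 -> s / 4 <= g y.
  move=> /andP[y1 y2]; rewrite gE -[s / 4]add0r; apply: lerD.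
    by apply: mulr_ge0; [lra|rewrite invr_ge0 addr_ge0 ?sqr_ge0].
  have D0 : 0 < (d - s) ^+ 2 + y ^+ 2.
    by rewrite ltr_pwDl ?sqr_ge0// exprn_even_gt0//=; apply/eqP; lra.
  have yy : y ^+ 2 <= 1 by nra.
  have dd : (d - s) ^+ 2 <= 1 by nra.
  by rewrite ler_pdivlMr//; nra.
have cg a b : cont_on a b g.
  apply: cont_onB.
    move=> y _; have := @cdiff_closed R pole (1 - d) y; case/(_ _)/closed_diff_contx => //.
    by apply: cdiff_pole; rewrite xpair_eqE negb_and; apply/orP; left; apply/eqP; lra.
  move=> y _; have := @cdiff_closed R pole d y; case/(_ _)/closed_diff_contx => //.
  by apply: cdiff_pole; rewrite xpair_eqE negb_and; apply/orP; left; apply/eqP; lra.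
have TT : - T <= -1 by lra.
have e1 : itg (- T) T g = itg (- T) (-1) g + (itg (-1) 1 g + itg 1 T g).
  by rewrite (@itg_split _ (- T) (-1) T)// ?(@itg_split _ (-1) 1 T)//; lra.
rewrite -/(itg (- T) T g) e1 -[s / 2]add0r; apply: lerD; first exact: itg_ge0.
rewrite -[s / 2]addr0; apply: lerD; last exact: itg_ge0.
have m11 : (-1 : R) <= 1 by lra.
have -> : s / 2 = itg (-1) 1 (fun=> s / 4) by rewrite itg_cst//; field.
by apply: itg_le => //; exact: cont_on_cst.
Qed.

End pole.
End strip.

Lemma integrable_inv1sqr (R : realType) (a b : R) :
  (@lebesgue_measure R).-integrable setT (EFin \o (fun y : R => a * (b * (1 + y ^+ 2)^-1))).
Proof.
have i0 : (@lebesgue_measure R).-integrable setT (EFin \o (fun y : R => (1 + y ^+ 2)^-1)).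
  have p1 (y : R) : 0 < 1 + y ^+ 2 by rewrite ltr_pwDl ?sqr_ge0.
  apply: (@pw_dominated_integrable R _ 1 0 2) => //; first by rewrite ltr1n.
    apply: continuous_measurable_fun => y; apply: cvgV; first by rewrite gt_eqF.
    by apply: cvgD; [exact: cvg_cst|exact: exprn_continuous].
  move=> t; rewrite mul1e ger0_norm ?invr_ge0 ?(ltW (p1 _))// /pw; case: eqVneq => [_|t0]; first exact: leey.
  rewrite lee_fin; have [t1|t1] := ltP.
    by rewrite oppr0 powRr0 invf_le1// lerDl sqr_ge0.
  have tp : 0 < `|t| by rewrite normr_gt0.
  rewrite powRN powR_mulrn// lef_pV2 ?posrE ?exprn_gt0//.
  by rewrite real_normK ?num_real// lerDr.
have h := integrableZl measurableT (a * b) i0.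
move: h; congr (_.-integrable _ _); apply/funext => y /=; rewrite -EFinM; congr (_%:E).
by rewrite mulrA.
Qed.

Section strip_mean.
Context {R : realType}.
Local Notation C := (R[i]).
Local Notation nc := (@Normc.normc R).
Local Notation mu := (@lebesgue_measure R).
Local Open Scope complex_scope.
Variables (s B : R) (H : C -> C).
Hypotheses (s_gt0 : 0 < s) (s_lt1 : s < 1).
Hypothesis Hdiff : forall z : C, 0 < Re z < 1 -> cdiff H z.
Hypothesis Hcont : forall z : C, 0 <= Re z <= 1 -> forall e : R, 0 < e ->
  exists2 r : R, 0 < r & forall w : C, 0 <= Re w <= 1 -> nc (w - z) < r -> nc (H w - H z) <= e.
Hypothesis Hbound : forall x y : R, 0 <= x <= 1 -> nc (H (x +i* y)) <= B / (1 + y ^+ 2).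

Lemma nc_dist z w : `|nc z - nc w| <= nc (z - w).
Proof.
rewrite ler_norml; have h1 : nc z <= nc (z - w) + nc w by rewrite -{1}(subrK w z); exact: ncD.
have h2 : nc w <= nc (w - z) + nc z by rewrite -{1}(subrK z w); exact: ncD.
by rewrite ncBC in h2; apply/andP; split; lra.
Qed.

Lemma nc_vert (x y y' : R) : nc ((x +i* y) - (x +i* y')) = `|y - y'|.
Proof. by rewrite /= subrr expr0n add0r sqrtr_sqr. Qed.

Lemma Hcont_vert (x y : R) : 0 <= x <= 1 -> {for y, continuous (fun y => nc (H (x +i* y)))}.
Proof.
move=> x01; apply/cvgrPdist_le => e e0; have [r r0 Hr] := Hcont (z := x +i* y) x01 e0.
apply/nbhs_ballP; exists r => //= y' yy'; apply: (le_trans (nc_dist _ _)).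
by rewrite ncBC; apply: Hr => //; rewrite nc_vert distrC.
Qed.

Let f (z : C) := (H s%:C)^* * H z.
Let rho := nc (H s%:C) ^+ 2.
Let g (z : C) := f z * pole s z - rho%:C * pole s z.

Let fs : f s%:C = rho%:C. Proof. exact: conjM_self. Qed.

Let fdiff x y : 0 < x < 1 -> cdiff f (x +i* y).
Proof. by move=> x01; apply: cdiffM; [exact: cdiff_cst|exact: Hdiff]. Qed.

Let rect (u : C -> C) a b c d := circ (fun x y => Im (u (x +i* y)))
  (fun x y => Re (u (x +i* y))) a b c d.

Let rect_g d T : 0 < d -> d <= s / 2 -> d <= (1 - s) / 2 -> 1 <= T ->
  rect g d (1 - d) (- T) T = 0.
Proof.
move=> d0 ds ds' T1.
have [K K0 [r r0 HK]] : exists2 K, 0 < K & exists2 r, 0 < r & forall h, nc h < r ->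
  nc (f (s%:C + h) - f s%:C) <= K * nc h by apply: cdiff_bound; apply: fdiff; rewrite s_gt0.
have r40 : 0 < r / 4 by rewrite divr_gt0.
have s0 := s_gt0; have s1 := s_lt1.
apply: (@circ_hole _ _ _ _ _ _ _ s 0 (r / 4) K) => //; first by lra.
- by lra.
- move=> x y /andP[x1 x2] _ ne; apply: cdiff_closed.
  have cp := cdiff_pole ne; apply: cdiffB; apply: cdiffM => //; last exact: cdiff_cst.
  by apply: fdiff; lra.
move=> x y hx hy; rewrite subr0 in hy.
suff key : nc (g (x +i* y)) <= K.
  by split; apply: le_trans key; [exact: Im_le_nc|exact: Re_le_nc].
have [e|ne] := eqVneq ((x +i* y) : C) s%:C.
  by rewrite e /g fs subrr nc0 ltW.
have w0 : (x +i* y) - s%:C != 0 by rewrite subr_eq0.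
rewrite /g -mulrBl -fs ncM /pole ncV ler_pdivrMr ?nc_gt0//.
have {1}-> : (x +i* y) = s%:C + ((x +i* y) - s%:C) by rewrite addrC subrK.
apply: HK; apply: (le_lt_trans (nc_le _)); rewrite complex_subC /=; lra.
Qed.

Let edge_x (u : C -> C) a b y : (forall x, a <= x <= b -> cdiff u (x +i* y)) ->
  cont_on a b (fun x => Im (u (x +i* y))).
Proof. by move=> du x /du /cdiff_closed/closed_diff_contx[]. Qed.

Let edge_y (u : C -> C) c d x : (forall y, cdiff u (x +i* y)) ->
  cont_on c d (fun y => Re (u (x +i* y))).
Proof. by move=> du y _; have /cdiff_closed/closed_diff_contx[] := du y. Qed.

(** After multiplication by the conjugate of H(s) the value at s is real and
    nonnegative. The circulation of (H - H(s)) / (z - s) vanishes, so that of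
    H / (z - s) is H(s) times the one of the pole; it is also bounded by
    the horizontal edges, O(1/T), and the vertical ones, where 1 / |z - s| is
    at most 2 / s or 2 / (1 - s). *)
Lemma strip_mean_rect d T : 0 < d -> d <= s / 2 -> d <= (1 - s) / 2 -> 1 <= T ->
  s / 2 * nc (H s%:C) <= 2 * B / T + itg (- T) T
    (fun y => 2 / s * nc (H (d +i* y)) + 2 / (1 - s) * nc (H ((1 - d) +i* y))).
Proof.
move=> d0 ds ds' T1; have s0 := s_gt0; have s1 := s_lt1.
have B0 : 0 <= B.
  have := Hbound (x := 0) 0 _; rewrite expr0n addr0 divr1 lexx ler01 => /(_ isT).
  exact: le_trans (nc_ge0 _).
set q := nc (H s%:C); have q0 : 0 <= q by exact: nc_ge0.
set J := itg _ _ _.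
have J0 : 0 <= J.
  by apply: itg_ge0 => y _; rewrite addr_ge0// mulr_ge0 ?nc_ge0// divr_ge0//; lra.
have cv x : 0 <= x <= 1 -> cont_on (- T) T (fun y => nc (H (x +i* y))).
  by move=> x01 y _; exact: Hcont_vert.
have kx y : `|y| = T -> forall x, cdiff (pole s) (x +i* y).
  move=> yT x; apply: cdiff_pole; rewrite xpair_eqE negb_and; apply/orP; right.
  by rewrite -normr_eq0 yT gt_eqF//; lra.
have ky x : x != s -> forall y, cdiff (pole s) (x +i* y).
  by move=> xs y; apply: cdiff_pole; rewrite xpair_eqE negb_and xs.
have TT : `|T| = T by rewrite ger0_norm//; lra.
have NT : `|- T| = T by rewrite normrN.
have ne1 : d != s by apply/eqP; lra.
have ne2 : 1 - d != s by apply/eqP; lra.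
have fk x y : 0 < x < 1 -> cdiff (pole s) (x +i* y) -> cdiff (fun z => f z * pole s z) (x +i* y).
  by move=> x01 k; apply: cdiffM => //; exact: fdiff.
have E : rho * rect (pole s) d (1 - d) (- T) T =
         rect (fun z => f z * pole s z) d (1 - d) (- T) T.
  have := rect_g d0 ds ds' T1; rewrite /rect.
  have -> : (fun x y => Im (g (x +i* y))) = (fun x y =>
      Im (f (x +i* y) * pole s (x +i* y)) - rho * Im (pole s (x +i* y))).
    by apply/funext => x; apply/funext => y; rewrite /g ImB ImM_real.
  have -> : (fun x y => Re (g (x +i* y))) = (fun x y =>
      Re (f (x +i* y) * pole s (x +i* y)) - rho * Re (pole s (x +i* y))).
    by apply/funext => x; apply/funext => y; rewrite /g ReB ReM_real.
  rewrite circ_lin; first by move/eqP; rewrite subr_eq0 eq_sym => /eqP.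
  - by apply: (@edge_x (fun z => f z * pole s z)) => x xd; apply: fk; [lra|exact: kx].
  - by apply: (@edge_x (fun z => f z * pole s z)) => x xd; apply: fk; [lra|exact: kx].
  - by apply: (@edge_y (fun z => f z * pole s z)) => y; apply: fk; [lra|exact: ky].
  - by apply: (@edge_y (fun z => f z * pole s z)) => y; apply: fk; [lra|exact: ky].
  - by apply: edge_x => x xd; exact: kx.
  - by apply: edge_x => x xd; exact: kx.
  - by apply: edge_y => y; exact: ky.
  - by apply: edge_y => y; exact: ky.
have Hf z : nc (f z) = q * nc (H z) by rewrite /f ncM nc_conj.
have U : rect (fun z => f z * pole s z) d (1 - d) (- T) T <= q * (2 * B / T + J).
  rewrite /rect /circ mulrDr; apply: lerD.
    have hor x y : d <= x <= 1 - d -> `|y| = T ->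
        `|Im (f (x +i* y) * pole s (x +i* y))| <= q * B / T.
      move=> xd yT; apply: (le_trans (Im_le_nc _)); rewrite ncM Hf.
      apply: ler_pM; rewrite ?nc_ge0 ?mulr_ge0 ?nc_ge0//; last first.
        by apply: nc_pole_Im; [lra|rewrite yT].
      apply: ler_wpM2l => //; apply: (le_trans (Hbound (x := x) y _)); first lra.
      rewrite ler_pdivrMr; last by rewrite ltr_pwDl ?sqr_ge0.
      by rewrite ler_peMr// lerDl sqr_ge0.
    have dd : d <= 1 - d by lra.
    have ex y : `|y| = T -> cont_on d (1 - d) (fun x => Im (f (x +i* y) * pole s (x +i* y))).
      by move=> yT; apply: (@edge_x (fun z => f z * pole s z)) => x xd; apply: fk; [lra|exact: kx].
    apply: (le_trans (ler_norm _)).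
    apply: (le_trans (@itg_bound _ _ _ _ (2 * (q * B / T)) dd _ _)).
    - by apply: cont_onB; exact: ex.
    - move=> x xd; apply: (le_trans (ler_normB _ _)).
      by have := hor x _ xd NT; have := hor x _ xd TT; lra.
    have qBT : 0 <= q * B / T by rewrite !mulr_ge0// invr_ge0; lra.
    have -> : q * (2 * B / T) = 2 * (q * B / T) by ring.
    by nra.
  rewrite -itgZ; last first.
    by apply: cont_onD; apply: cont_onZ; apply: cv; lra.
  have ey x : 0 < x < 1 -> x != s -> cont_on (- T) T (fun y => Re (f (x +i* y) * pole s (x +i* y))).
    by move=> x01 xs; apply: (@edge_y (fun z => f z * pole s z)) => y; apply: fk => //; exact: ky.
  have ver x y k : 0 < x < 1 -> 0 < k -> k <= `|x - s| ->
      `|Re (f (x +i* y) * pole s (x +i* y))| <= q * (k^-1 * nc (H (x +i* y))).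
    move=> x01 k0 ks; apply: (le_trans (Re_le_nc _)); rewrite ncM Hf -mulrA ler_wpM2l//.
    rewrite mulrC ler_wpM2r ?nc_ge0//; exact: nc_pole_Re.
  apply: itg_le.
  - by apply: cont_onB; apply: ey => //; lra.
  - by apply: cont_onZ; apply: cont_onD; apply: cont_onZ; apply: cv; lra.
  move=> y _; apply: (le_trans (ler_norm _)); apply: (le_trans (ler_normB _ _)).
  rewrite mulrDr addrC; apply: lerD.
    have := @ver d y (s / 2) _ _ _; rewrite invf_div; apply; [lra|lra|].
    by rewrite ltr0_norm; lra.
  have := @ver (1 - d) y ((1 - s) / 2) _ _ _; rewrite invf_div; apply; [lra|lra|].
  by rewrite ger0_norm; lra.
have L := circ_pole_ge d0 ds ds' T1.
have fin : rho * (s / 2) <= q * (2 * B / T + J).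
  apply: le_trans U; rewrite -E ler_wpM2l//; exact: sqr_ge0.
have [->|qn] := eqVneq q 0.
  by rewrite mulr0 addr_ge0// divr_ge0 ?mulr_ge0//; lra.
have qp : 0 < q by rewrite lt_neqAle eq_sym qn.
by rewrite -(ler_pM2l qp); apply: le_trans fin; rewrite /rho -/q; nra.
Qed.

Lemma strip_measurable x : 0 <= x <= 1 ->
  measurable_fun [set: R] (fun y => nc (H (x +i* y))).
Proof. by move=> x01; apply: continuous_measurable_fun => y; exact: Hcont_vert. Qed.

(** Let T tend to infinity in [strip_mean_rect], then d to 0 by dominated
    convergence. *)
Lemma strip_mean : s / 2 * nc (H s%:C) <= \int[mu]_y
  (2 / s * nc (H (0 +i* y)) + 2 / (1 - s) * nc (H (1 +i* y))).
Proof.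
have s0 := s_gt0; have s1 := s_lt1.
have B0 : 0 <= B.
  have := Hbound (x := 0) 0 _; rewrite expr0n addr0 divr1 lexx ler01 => /(_ isT).
  exact: le_trans (nc_ge0 _).
pose d k := Num.min (s / 2) ((1 - s) / 2) * harmonic k : R.
have h0 : 0 < Num.min (s / 2) ((1 - s) / 2) by rewrite lt_min; lra.
have d0 k : 0 < d k by rewrite mulr_gt0 ?invr_gt0.
have dm k : d k <= Num.min (s / 2) ((1 - s) / 2).
  by rewrite ler_piMr ?(ltW h0)// /harmonic /= invf_le1// ler1n.
have ds k : d k <= s / 2 by apply: (le_trans (dm k)); rewrite ge_min lexx.
have ds' k : d k <= (1 - s) / 2 by apply: (le_trans (dm k)); rewrite ge_min lexx orbT.
have dc : d k @[k --> \oo] --> 0.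
  by rewrite -[X in _ --> X](mulr0 (Num.min (s / 2) ((1 - s) / 2))); apply: cvgM;
    [exact: cvg_cst|exact: cvg_harmonic].
pose W x y := 2 / s * nc (H (x +i* y)) + 2 / (1 - s) * nc (H ((1 - x) +i* y)).
pose G y : R := (2 / s + 2 / (1 - s)) * (B * (1 + y ^+ 2)^-1).
have c1 : 0 <= 2 / s by rewrite divr_ge0//; lra.
have c2 : 0 <= 2 / (1 - s) by rewrite divr_ge0//; lra.
have x01 k : 0 <= d k <= 1 by have := d0 k; have := ds k; lra.
have y01 k : 0 <= 1 - d k <= 1 by have := d0 k; have := ds k; lra.
have mW x : 0 <= x <= 1 -> measurable_fun [set: R] (W x).
  by move=> x_01; apply: measurable_funD; apply: measurable_funM => //; apply: strip_measurable; lra.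
have W0 x y : 0 <= W x y by rewrite /W addr_ge0// mulr_ge0 ?nc_ge0.
have WG x y : 0 <= x <= 1 -> `|W x y| <= G y.
  move=> x_01; rewrite ger0_norm// /W /G [leRHS]mulrDl.
  by apply: lerD; apply: ler_wpM2l => //; apply: Hbound; lra.
have iG : mu.-integrable setT (EFin \o G) by exact: integrable_inv1sqr.
have lim : \int[mu]_y W (d k) y @[k --> \oo] --> \int[mu]_y W 0 y.
  apply: (@Rintegral_dominated_cvg _ (measurableTypeR R) R mu (fun k => W (d k)) (W 0) G) => //.
  - by move=> k; exact: mW.
  - by apply: mW; rewrite lexx ler01.
  - by move=> k y; exact: WG.
  move=> y; have cz (a x : R) (u : nat -> R) : (forall k, 0 <= u k <= 1) -> 0 <= x <= 1 ->
      u k @[k --> \oo] --> x -> a * nc (H (u k +i* y)) @[k --> \oo] --> a * nc (H (x +i* y)).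
    move=> u01 xx ux; apply: cvgM; first exact: cvg_cst.
    apply/cvgrPdist_le => e e0; have [r r0 Hr] := Hcont (z := x +i* y) xx e0.
    move/cvgrPdist_lt: ux => /(_ r r0); apply: filterS => k hk.
    apply: (le_trans (nc_dist _ _)); rewrite ncBC; apply: Hr => //=.
    by rewrite subrr expr0n addr0 sqrtr_sqr distrC.
  apply: cvgD; first by apply: cz => //; rewrite lexx ler01.
  rewrite subr0; apply: (@cz _ 1 (fun k => 1 - d k)) => //; first by rewrite lexx ler01.
  by rewrite -[X in _ --> X]subr0; apply: cvgB => //; exact: cvg_cst.
have -> : \int[mu]_y (2 / s * nc (H (0 +i* y)) + 2 / (1 - s) * nc (H (1 +i* y))) =
    \int[mu]_y W 0 y by rewrite /W subr0.
apply: (cvgr_to_ge lim); apply: nearW => k; apply/ler_addgt0Pr => e e0.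
pose T := Num.max 1 (2 * B / e).
have T1 : 1 <= T by rewrite le_max lexx.
apply: (le_trans (strip_mean_rect (d0 k) (ds k) (ds' k) T1)).
rewrite addrC; apply: lerD; last first.
  have T0 : 0 < T by lra.
  by rewrite ler_pdivrMr// [leRHS]mulrC -ler_pdivrMr// /T le_max lexx orbT.
apply: itg_le_full => [|y]; last exact: W0.
apply: (@dominated_integrable R _ (measurableTypeR R) mu _ G) => //; first exact: mW.
by move=> y; exact: WG.
Qed.

End strip_mean.

(** * The complex exponential *)
Section cexp.
Context {R : realType}.
Local Notation C := (R[i]).
Local Notation nc := (@Normc.normc R).
Local Open Scope complex_scope.

Lemma is_derive_eps (f : R -> R) (x d : R) : is_derive x 1 f d ->
  forall e, 0 < e -> exists2 r, 0 < r & forall h, `|h| < r ->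
    `|f (x + h) - f x - d * h| <= e * `|h|.
Proof.
move=> [df <-] e e0; have := df; rewrite /derivable => /cvgrPdist_le/(_ e e0).
rewrite /dnbhs /within /= => /nbhs_ballP[r /= r0 Hr]; exists r => // h hr.
have [->|h0] := eqVneq h 0; first by rewrite addr0 subrr mulr0 subr0 normr0 mulr0.
have := Hr h; rewrite /ball /= sub0r normrN => /(_ hr h0).
rewrite /derive; set L := lim _; rewrite /GRing.scale /= mulr1 (addrC h x) => Hd.
have -> : f (x + h) - f x - L * h = - ((L - h^-1 * (f (x + h) - f x)) * h).
  by field.
by rewrite normrN normrM ler_wpM2r.
Qed.

Definition cexp (z : C) : C :=
  (expR (Re z) * cos (Im z)) +i* (expR (Re z) * sin (Im z)).

Lemma cexpD z w : cexp (z + w) = cexp z * cexp w.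
Proof.
case: z w => a b [c d]; rewrite /cexp /= expRD cosD sinD; simpc.
by congr (_ +i* _); ring.
Qed.

Lemma nc_cexp z : nc (cexp z) = expR (Re z).
Proof.
rewrite /cexp /= !exprMn -mulrDr cos2Dsin2 mulr1 sqrtr_sqr ger0_norm//; exact: expR_ge0.
Qed.

Lemma cdiff_cexp0 : cdiff cexp 0.
Proof.
exists 1 => e e0; pose e1 := Num.min 1 (e / 8).
have e10 : 0 < e1 by rewrite lt_min ltr01 divr_gt0.
have [e1a e1b] : e1 <= 1 /\ e1 <= e / 8 by rewrite !ge_min !lexx orbT.
have [r1 r10 H1] := is_derive_eps (is_derive_expR (0 : R)) e10.
have [r2 r20 H2] := is_derive_eps (is_derive_cos (0 : R)) e10.
have [r3 r30 H3] := is_derive_eps (is_derive_sin (0 : R)) e10.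
exists (Num.min (Num.min r1 r2) (Num.min r3 (Num.min 1 (e / 16)))).
  by rewrite !lt_min r10 r20 r30 ltr01 divr_gt0.
move=> h; rewrite add0r mul1r; move: h => [a b] hh.
have ha := le_lt_trans (Re_le_nc _) hh; have hb := le_lt_trans (Im_le_nc _) hh.
rewrite /= !lt_min in ha hb; move: ha hb =>  /andP[/andP[a1 _] /and3P[_ a4 a5]] /andP[/andP[_ b2] /andP[b3 _]].
have := H1 a a1; have := H2 b b2; have := H3 b b3.
rewrite !add0r expR0 cos0 sin0 !mul1r oppr0 mul0r !subr0 !addr0.
set E := expR a; set c := cos b; set S := sin b => h3 h2 h1.
have c1 : `|c| <= 1 by rewrite ler_norml cos_geN1 cos_le1.
have S1 : `|S| <= 1 by rewrite ler_norml sin_geN1 sin_le1.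
have na : `|a| <= nc (a +i* b) by exact: (Re_le_nc (a +i* b)).
have nb : `|b| <= nc (a +i* b) by exact: (Im_le_nc (a +i* b)).
set n := nc (a +i* b) in na nb *; have a0 := normr_ge0 a; have b0 := normr_ge0 b.
have cexp0 : cexp 0 = 1 by rewrite /cexp /= expR0 cos0 sin0 mulr0 mulr1.
rewrite cexp0; apply: (le_trans (nc_le _)); rewrite /cexp /= -/E -/c -/S.
have -> : E * c - 1 - a = (E - 1 - a) * c + (1 + a) * (c - 1) by ring.
have -> : E * S - 0 - b = (E - 1 - a) * S + (1 + a) * (S - b) + a * b by ring.
have n0 : 0 <= n by exact: le_trans na.
have a2 : `|1 + a| <= 2 by apply: (le_trans (ler_normD _ _)); rewrite normr1; lra.
have M1 u : `|u| <= 1 -> `|(E - 1 - a) * u| <= e / 8 * n.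
  move=> u1; rewrite normrM; apply: (@le_trans _ _ (e1 * n * 1)); last by rewrite mulr1 ler_wpM2r.
  by apply: ler_pM => //; apply: (le_trans h1); rewrite ler_pM2l.
have M2 u : `|u| <= e1 * `|b| -> `|(1 + a) * u| <= 2 * (e / 8 * n).
  by move=> u1; rewrite normrM; apply: ler_pM => //; apply: (le_trans u1); apply: ler_pM => //; lra.
have M3 : `|a * b| <= e / 16 * n by rewrite normrM; apply: ler_pM => //; lra.
have := M1 _ c1; have := M1 _ S1; have := M2 _ h2; have := M2 _ h3 => m1 m2 m3 m4.
apply: (@le_trans _ _ (e / 8 * n + 2 * (e / 8 * n) + (e / 8 * n + 2 * (e / 8 * n) + e / 16 * n))).
  apply: lerD; first exact: (le_trans (ler_normD _ _) (lerD m4 m2)).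
  apply: (le_trans (ler_normD _ _)); apply: lerD M3.
  exact: (le_trans (ler_normD _ _) (lerD m3 m1)).
by nra.
Qed.

Lemma cdiff_cexp z : cdiff cexp z.
Proof.
have [d H] := cdiff_cexp0; exists (cexp z * d) => e e0.
have n0 : 0 < nc (cexp z) by rewrite nc_cexp expR_gt0.
have e1 : 0 < e / nc (cexp z) by rewrite divr_gt0.
have [r r0 Hr] := H _ e1; exists r => // h hr.
have z1 : cexp z = cexp z * cexp 0 by rewrite -cexpD addr0.
rewrite cexpD {2}z1 -mulrA -!mulrBr ncM.
have := Hr h hr; rewrite add0r => k.
rewrite -(ler_pM2l n0) in k; apply: (le_trans k).
by rewrite mulrA mulrCA mulfV ?mulr1// gt_eqF.
Qed.

Lemma cdiff_scale f (a z : C) : cdiff f (a * z) -> cdiff (fun z => f (a * z)) z.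
Proof.
move=> [d H]; exists (d * a) => e e0; have a1 : 0 < nc a + 1 by rewrite ltr_wpDl ?nc_ge0.
have e1 : 0 < e / (nc a + 1) by rewrite divr_gt0.
have [r r0 Hr] := H _ e1; exists (r / (nc a + 1)) => [|h]; first by rewrite divr_gt0.
rewrite ltr_pdivlMr// mulrC => hr.
have ah : nc (a * h) <= (nc a + 1) * nc h by rewrite ncM ler_wpM2r ?nc_ge0// lerDl.
have k := Hr (a * h) (le_lt_trans ah hr); rewrite mulrDr -mulrA; apply: (le_trans k).
apply: (@le_trans _ _ (e / (nc a + 1) * ((nc a + 1) * nc h))).
  by rewrite ler_pM2l.
by rewrite mulrA divfK// gt_eqF.
Qed.

Lemma cdiff_cont f z : cdiff f z -> forall e, 0 < e ->
  exists2 r, 0 < r & forall w, nc (w - z) < r -> nc (f w - f z) <= e.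
Proof.
move=> /cdiff_bound[K K0 [r r0 Hr]] e e0.
exists (Num.min r (e / K)) => [|w]; first by rewrite lt_min r0 divr_gt0.
rewrite lt_min => /andP[h1 h2].
have := Hr _ h1; rewrite (addrC z) subrK => k.
by apply: (le_trans k); rewrite mulrC -ler_pdivlMr// ltW.
Qed.

End cexp.

(** * Flat functions *)
Section bump.
Context {R : realType}.

(** These continuations by 0 of u^(-j) exp(- 1 / u) are stable under
    differentiation, which makes smoothness an induction. *)
Definition flat (j : nat) (u : R) : R := if 0 < u then u^-1 ^+ j * expR (- u^-1) else 0.

Lemma flat_ge0 j u : 0 <= flat j u.
Proof. by rewrite /flat; case: ifP => // u0; rewrite mulr_ge0 ?expR_ge0 ?exprn_ge0 ?invr_ge0 ?ltW. Qed.

Lemma flat_le_fact j (v : R) : 0 <= v -> v ^+ j.+1 * expR (- v) <= (j.+1)`!%:R.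
Proof.
move=> v0; rewrite expRN ler_pdivrMr ?expR_gt0// -ler_pdivrMl ?ltr0n ?fact_gt0// mulrC.
by apply: le_trans (expR_ge1Dxn j v0); rewrite lerDr.
Qed.

Lemma flat0_le1 u : flat 0 u <= 1.
Proof.
rewrite /flat; case: ifP => // u0; rewrite expr0 mul1r -expR0 ler_expR oppr_le0 invr_ge0.
exact: ltW.
Qed.

Lemma flat2_le2 u : flat 2 u <= 2.
Proof.
rewrite /flat; case: ifP => // u0; have := @flat_le_fact 1 u^-1.
by rewrite invr_ge0 => /(_ (ltW u0)).
Qed.

(** The quadratic bound makes the derivative at 0 vanish. *)
Lemma flat_le_sqr j u : flat j u <= (j.+2)`!%:R * u ^+ 2.
Proof.
rewrite /flat; case: ifP => [u0|_]; last by rewrite mulr_ge0 ?ler0n ?sqr_ge0.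
have := @flat_le_fact j.+1 u^-1; rewrite invr_ge0 => /(_ (ltW u0)) h.
rewrite -ler_pdivrMr ?exprn_gt0//; apply: le_trans h.
rewrite -exprVn; set v := u^-1; rewrite le_eqVlt; apply/orP; left; apply/eqP.
by rewrite !exprS; ring.
Qed.

Lemma is_derive_of_eps (f : R -> R) (x d : R) :
  (forall e, 0 < e -> exists2 r, 0 < r & forall h, `|h| < r ->
    `|f (x + h) - f x - d * h| <= e * `|h|) -> is_derive x 1 f d.
Proof.
move=> H.
have L : (fun h : R => h^-1 *: ((f \o shift x) (h *: 1) - f x)) @ 0^' --> d.
  apply/cvgrPdist_le => e /H[r r0 Hr]; rewrite /dnbhs /within /=.
  apply/nbhs_ballP; exists r => //= h; rewrite /ball /= sub0r normrN => hr h0.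
  have := Hr h hr; rewrite /GRing.scale /= mulr1 (addrC h x).
  have -> : f (x + h) - f x - d * h = - ((d - h^-1 * (f (x + h) - f x)) * h) by field.
  by rewrite normrN normrM ler_pM2r ?normr_gt0.
by split; [apply/cvg_ex; exists d|rewrite /derive; apply: cvg_lim].
Qed.

Lemma flat_derivative_identity j (w E : R) :
  w ^+ j * (E * w ^+ 2) + E * (j%:R * w ^+ j.-1 * - w ^+ 2) =
  w ^+ j.+2 * E - j%:R * (w ^+ j.+1 * E).
Proof. by case: j => [|i] /=; rewrite !exprS; ring. Qed.

Lemma is_derive_flat j (u : R) : is_derive u 1 (flat j) (flat j.+2 u - j%:R * flat j.+1 u).
Proof.
apply: is_derive_of_eps => e e0; have [u0|u0|u0] := ltgtP u 0.
- exists (- u) => [|h hu]; first by rewrite oppr_gt0.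
  have [h1 h2] : - - u < h /\ h < - u by apply/andP; rewrite -ltr_norml.
  have n1 : (0 < u) = false by apply/negbTE; rewrite -leNgt ltW.
  have n2 : (0 < u + h) = false by apply/negbTE; rewrite -leNgt; lra.
  by rewrite /flat n1 n2 !mulr0 !subr0 mul0r subrr normr0 mulr_ge0// ltW.
- pose g (t : R) := t^-1 ^+ j * expR (- t^-1).
  have dV : is_derive u 1 (fun t : R => t^-1) (- (u ^+ 2)^-1).
    have := @is_deriveV R id u 1 1; rewrite gt_eqF// => /(_ isT _).
    by rewrite /GRing.scale /= mulr1.
  have dg : is_derive u 1 g (flat j.+2 u - j%:R * flat j.+1 u).
    have dX : is_derive u 1 (fun t : R => t^-1 ^+ j) (j%:R * u^-1 ^+ j.-1 * (- (u ^+ 2)^-1)).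
      have := is_deriveX j dV; rewrite exprfctE; exact.
    have dE : is_derive u 1 (fun t : R => expR (- t^-1)) (expR (- u^-1) * (u ^+ 2)^-1).
      have := is_deriveN dV => dN; have := is_derive1_comp (is_derive_expR _) dN.
      by rewrite /= opprK.
    have h := is_deriveM dX dE; rewrite mulrfctE in h; apply: is_derive_eq h _; rewrite /flat u0 /GRing.scale /=.
    by rewrite -exprVn; exact: flat_derivative_identity.
  have [r r0 Hr] := is_derive_eps dg e0.
  exists (Num.min r u) => [|h]; first by rewrite lt_min r0.
  rewrite lt_min => /andP[hr hu]; have := Hr h hr.
  have h1 : 0 < u + h by have := hu; rewrite ltr_norml; lra.
  by rewrite /flat /g h1 u0.
have K0 : 0 < (j.+2)`!%:R :> R by rewrite ltr0n fact_gt0.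
exists (e / (j.+2)`!%:R) => [|h]; first by rewrite divr_gt0.
rewrite ltr_pdivlMr// => hK; rewrite u0 add0r.
have f0 i : flat i 0 = 0 by rewrite /flat ltxx.
rewrite !f0 mulr0 !subr0 mul0r subr0 ger0_norm ?flat_ge0//.
apply: (le_trans (flat_le_sqr j h)).
by rewrite -real_normK ?num_real// expr2 mulrA ler_wpM2r// mulrC ltW.
Qed.

Lemma continuous_flat j : continuous (flat j).
Proof.
move=> u; apply/differentiable_continuous/derivable1_diffP.
by have [] := is_derive_flat j u.
Qed.

Section Ck.
Context {n : nat}.
Local Notation V := 'rV[R]_n.
Implicit Types f g : V -> R.

Lemma Ck_continuous k f : Ck k f -> continuous f.
Proof. by case: k => [//|k []]. Qed.

Lemma Ck_pred k f : Ck k.+1 f -> Ck k f.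
Proof.
elim: k f => [|k IH] f [cf df]; first exact: cf.
by split => // i; have [dfi Dfi] := df i; split => //; exact: IH.
Qed.

Lemma Ck_cst k (a : R) : Ck k (fun _ : V => a).
Proof.
elim: k a => [|k IH] a; first exact: cst_continuous.
split; first exact: cst_continuous.
move=> i; split => [x|]; first exact: derivable_cst.
have -> : (fun x : V => 'D_(basis_rV i) (fun _ : V => a) x) = fun=> 0.
  by apply/funext => x; exact: derive_cst.
exact: IH.
Qed.

Lemma Ck_add k f g : Ck k f -> Ck k g -> Ck k (fun x => f x + g x).
Proof.
elim: k f g => [|k IH] f g; first by move=> cf cg x; apply: continuousD; [exact: (cf x)|exact: (cg x)].
move=> [cf df] [cg dg]; split; first by move=> x; apply: continuousD; [exact: (cf x)|exact: (cg x)].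
move=> i; have [dfi Dfi] := df i; have [dgi Dgi] := dg i.
split => [x|]; first exact: derivableD.
rewrite (_ : (fun x => _) = fun x => 'D_(basis_rV i) f x + 'D_(basis_rV i) g x); first exact: IH.
by apply/funext => x; exact: deriveD.
Qed.

Lemma Ck_mul k f g : Ck k f -> Ck k g -> Ck k (fun x => f x * g x).
Proof.
elim: k f g => [|k IH] f g; first by move=> cf cg x; apply: continuousM; [exact: (cf x)|exact: (cg x)].
move=> Cf Cg; have [cf df] := Cf; have [cg dg] := Cg.
split; first by move=> x; apply: continuousM; [exact: (cf x)|exact: (cg x)].
move=> i; have [dfi Dfi] := df i; have [dgi Dgi] := dg i.
split => [x|]; first exact: derivableM.
rewrite (_ : (fun x => _) = fun x => f x * 'D_(basis_rV i) g x + g x * 'D_(basis_rV i) f x).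
  by apply: Ck_add; apply: IH => //; exact: Ck_pred.
by apply/funext => x; rewrite (deriveM (dfi x) (dgi x)).
Qed.

Lemma is_derive_coord (i j : 'I_n) (x : V) :
  is_derive x (basis_rV i) (fun x : V => x ord0 j) (j == i)%:R.
Proof.
apply: is_derive_of_line; apply: is_derive_of_eps => e e0; exists 1 => // h _.
rewrite !mxE eqxx /=; set d := (j == i)%:R.
have -> : x ord0 j + (0 + h) * d - (x ord0 j + 0 * d) - d * h = 0 by ring.
by rewrite normr0 mulr_ge0// ltW.
Qed.

Lemma Ck_coord k (j : 'I_n) : Ck k (fun x : V => x ord0 j).
Proof.
case: k => [|k]; first by move=> x; exact: coord_continuous.
split; first by move=> x; exact: coord_continuous.
move=> i; split => [x|]; first by have [] := is_derive_coord i j x.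
rewrite (_ : (fun x => _) = fun=> (j == i)%:R); first exact: Ck_cst.
by apply/funext => x; have [_] := is_derive_coord i j x.
Qed.

Lemma Ck_sum k (I : Type) (r : seq I) (F : I -> V -> R) : (forall i, Ck k (F i)) ->
  Ck k (fun x => \sum_(i <- r) F i x).
Proof.
move=> CF; elim: r => [|i r IH].
  by under eq_fun do rewrite big_nil; exact: Ck_cst.
by under eq_fun do rewrite big_cons; exact: Ck_add.
Qed.

Lemma is_derive_flat_comp j (q : V -> R) (x v : V) (dq : R) : is_derive x v q dq ->
  is_derive x v (flat j \o q) ((flat j.+2 (q x) - j%:R * flat j.+1 (q x)) * dq).
Proof.
move=> qd; apply: is_derive_of_line.
have q0 : is_derive (0 : R) 1 (fun t => q (x + t *: v)) dq.
  by apply: is_derive_line; rewrite scale0r addr0.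
have := @is_derive1_comp R (flat j) (fun t => q (x + t *: v)) 0 _ _ (is_derive_flat j _) q0.
by rewrite scale0r addr0.
Qed.

(** The induction on k runs over all j at once, as a derivative of [flat j]
    involves [flat j.+1] and [flat j.+2]. *)
Lemma Ck_flat_comp k j (q : V -> R) : (forall k, Ck k q) -> Ck k (flat j \o q).
Proof.
move=> Cq; have cq := Ck_continuous (Cq 0%N).
have cc i : continuous (flat i \o q).
  by move=> x; apply: continuous_comp; [exact: cq|exact: continuous_flat].
elim: k j => [|k IH] j; first exact: cc.
split; first exact: cc.
move=> i; have [_ /(_ i)[dq Dq]] := Cq k.+1.
have D x := is_derive_flat_comp j (derivableP (dq x)).
split => [x|]; first by have [] := D x.
rewrite (_ : (fun x => _) = fun x => ((flat j.+2 \o q) x + (- j%:R) * (flat j.+1 \o q) x) *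
  'D_(basis_rV i) q x).
  by apply: Ck_mul => //; apply: Ck_add => //; apply: Ck_mul => //; exact: Ck_cst.
by apply/funext => x; have [_ ->] := D x; rewrite mulNr.
Qed.

End Ck.
End bump.

(** * Fields that concentrate on a hyperplane *)
Section bump_field.
Context {R : realType} {m : nat}.
Local Notation n := m.+1.
Local Notation V := 'rV[R]_n.
Local Notation leb := (lebesgue_rV R n).
Variable lam : R.

(** Positive exactly inside an ellipsoid of half-width 1 / lam in the
    direction of the first coordinate and 1 in the others. *)
Definition ellq (x : V) : R :=
  1 - \sum_i (if i == ord0 then lam ^+ 2 else 1) * x ord0 i ^+ 2.

Definition bump_field (x : V) : V := flat 0 (ellq x) *: basis_rV ord0.

(** The divergence divided by lam, which stays bounded as lam grows. *)
Definition bump_div (x : V) : R := - (2 * lam * x ord0 ord0 * flat 2 (ellq x)).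

Lemma Ck_ellq k : Ck k ellq.
Proof.
have -> : ellq = (fun x => 1 + (-1) *
    \sum_i (if i == ord0 then lam ^+ 2 else 1) * (x ord0 i * x ord0 i)).
  by apply/funext => x; rewrite mulN1r /ellq; under eq_bigr do rewrite expr2.
apply: Ck_add; first exact: Ck_cst.
apply: Ck_mul; first exact: Ck_cst.
apply: (@Ck_sum R n k _ (index_enum 'I_n)) => i; apply: Ck_mul; first exact: Ck_cst.
by apply: Ck_mul; exact: Ck_coord.
Qed.

Lemma is_derive_ellq x : is_derive x (basis_rV ord0) ellq (- (2 * lam ^+ 2 * x ord0 ord0)).
Proof.
apply: is_derive_of_line; apply: is_derive_of_eps => e e0.
have l1 : 0 < lam ^+ 2 + 1 by rewrite ltr_wpDl ?sqr_ge0.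
exists (e / (lam ^+ 2 + 1)) => [|h]; first by rewrite divr_gt0.
rewrite ltr_pdivlMr// add0r scale0r addr0 => hr.
have -> : ellq (x + h *: basis_rV ord0) - ellq x - - (2 * lam ^+ 2 * x ord0 ord0) * h =
    - (lam ^+ 2 * h ^+ 2).
  rewrite /ellq !big_ord_recl /= !mxE eqxx /= mulr1.
  have -> : \sum_(i < m) (if lift ord0 i == ord0 then lam ^+ 2 else 1) *
      (x + h *: basis_rV ord0) ord0 (lift ord0 i) ^+ 2 =
     \sum_(i < m) (if lift ord0 i == ord0 then lam ^+ 2 else 1) * x ord0 (lift ord0 i) ^+ 2.
    by apply: eq_bigr => i _; rewrite !mxE /= mulr0 addr0.
  by ring.
have hh : h ^+ 2 = `|h| * `|h| by rewrite -expr2 real_normK ?num_real.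
rewrite normrN ger0_norm; last by rewrite (mulr_ge0 (sqr_ge0 lam) (sqr_ge0 h)).
rewrite hh mulrA ler_wpM2r// (le_trans _ (ltW hr))// mulrC ler_wpM2l// lerDl.
exact: ler01.
Qed.

Lemma bump_fieldE x i : bump_field x ord0 i = (i == ord0)%:R * flat 0 (ellq x).
Proof. by rewrite /bump_field !mxE eqxx /= mulrC. Qed.

Lemma divergence_bump x : divergence bump_field x = lam * bump_div x.
Proof.
rewrite /divergence big_ord_recl big1 ?addr0 => [|i _].
  have -> : (fun z => bump_field z ord0 ord0) = flat 0 \o ellq.
    by apply/funext => z; rewrite bump_fieldE eqxx mul1r.
  have [_ ->] := is_derive_flat_comp 0 (is_derive_ellq x).
  by rewrite /bump_div mul0r subr0; ring.
have -> : (fun z => bump_field z ord0 (lift ord0 i)) = cst 0.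
  by apply/funext => z; rewrite bump_fieldE mul0r.
exact: derive_cst.
Qed.

Lemma enorm_bump_le1 x : enorm (bump_field x) <= 1.
Proof.
rewrite /bump_field enormZ ger0_norm ?flat_ge0// -[leRHS]mulr1.
apply: ler_pM; rewrite ?flat_ge0 ?enorm_ge0 ?flat0_le1//.
apply: (le_trans (enorm_le_sum _)); rewrite big_ord_recl big1 ?addr0 => [|i _].
  by rewrite mxE eqxx normr1.
by rewrite mxE /= normr0.
Qed.

Hypothesis lam_ge1 : 1 <= lam.

Lemma ellq_coord_le i x : 0 < ellq x -> `|x ord0 i| <= 1.
Proof.
have l1 := lam_ge1.
rewrite /ellq subr_gt0 (bigD1 i)//= => h.
have c1 j : 1 <= (if j == ord0 :> 'I_n then lam ^+ 2 else 1).
  by case: ifP => // _; rewrite expr_ge1//; lra.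
have s0 : 0 <= \sum_(j < n | j != i) (if j == ord0 then lam ^+ 2 else 1) * x ord0 j ^+ 2.
  by apply: sumr_ge0 => j _; rewrite mulr_ge0 ?sqr_ge0// (le_trans _ (c1 j)).
have : x ord0 i ^+ 2 <= 1.
  apply: (@le_trans _ _ ((if i == ord0 then lam ^+ 2 else 1) * x ord0 i ^+ 2)); last by apply: le_trans (ltW h); rewrite lerDl.
  by rewrite ler_peMl ?sqr_ge0.
by rewrite -real_normK ?num_real// expr_le1.
Qed.

Lemma ellq_lam_le x : 0 < ellq x -> `|lam * x ord0 ord0| <= 1.
Proof.
rewrite /ellq subr_gt0 big_ord_recl /= => h.
have s0 : 0 <= \sum_(i < m) (if lift ord0 i == ord0 then lam ^+ 2 else 1) *
    x ord0 (lift ord0 i) ^+ 2.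
  by apply: sumr_ge0 => j _; rewrite mulr_ge0 ?sqr_ge0.
have : (lam * x ord0 ord0) ^+ 2 <= 1 by rewrite exprMn; lra.
by rewrite -real_normK ?num_real// expr_le1.
Qed.

Lemma test_field_bump : test_field bump_field.
Proof.
split=> [i k|].
  have -> : (fun x => bump_field x ord0 i) = (fun x => (i == ord0)%:R * (flat 0 \o ellq) x).
    by apply/funext => x; rewrite bump_fieldE.
  apply: Ck_mul; first exact: Ck_cst.
  by apply: Ck_flat_comp => k'; exact: Ck_ellq.
pose K := [set x : V | forall i, `[(-1)%R, 1%R]%classic (x ord0 i)].
have cK : compact K by apply: (@rV_compact R n (fun=> `[(-1)%R, 1%R]%classic)) => i; exact: segment_compact.
apply: (@subclosed_compact _ _ K) => //; first exact: closed_closure.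
have clK : closed K by apply: compact_closed => //; exact: norm_hausdorff.
apply: (subset_trans _ clK); apply: closureS => x /= phix i; rewrite /= in_itv /= -ler_norml.
apply: ellq_coord_le; rewrite ltNge; apply: contraNN phix => q0.
by rewrite /bump_field /flat ltNge q0 scale0r.
Qed.

Lemma bump_div_le4 x : `|bump_div x| <= 4.
Proof.
rewrite /bump_div normrN /flat; case: ifP => [q0|_]; last by rewrite mulr0 normr0.
have h1 := ellq_lam_le q0; have h2 := flat2_le2 (ellq x); rewrite /flat q0 in h2.
have h3 := @flat_ge0 R 2 (ellq x); rewrite /flat q0 in h3.
rewrite -(mulrA 2) normrM normrM (ger0_norm h3) ger0_norm//.
by rewrite (_ : 4 = 2 * 1 * 2); [apply: ler_pM => //; rewrite ?mulr_ge0// ler_pM2l|ring].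
Qed.

Lemma bump_div_support (x : V) : lam * `|x ord0 ord0| > 1 -> bump_div x = 0.
Proof.
move=> h; rewrite /bump_div /flat; case: ifP => [/ellq_lam_le|_]; last by rewrite mulr0 oppr0.
by rewrite normrM ger0_norm; [rewrite leNgt h|exact: le_trans lam_ge1].
Qed.

Lemma measurable_bump_div : measurable_fun [set: V] bump_div.
Proof.
apply: continuous_measurable_rV; apply: (Ck_continuous (k := 0)).
have -> : bump_div = (fun x => (- (2 * lam)) * (x ord0 ord0 * (flat 2 \o ellq) x)).
  by apply/funext => x; rewrite /bump_div /=; ring.
apply: Ck_mul; first exact: Ck_cst.
apply: Ck_mul; first exact: Ck_coord.
by apply: Ck_flat_comp => k'; exact: Ck_ellq.
Qed.

End bump_field.

(** * Pairing integrable functions with bounded ones *)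
Section pairing.
Context {R : realType} {n : nat}.
Local Notation C := (R[i]).
Local Notation nc := (@Normc.normc R).
Local Notation V := 'rV[R]_n.
Local Notation leb := (lebesgue_rV R n).
Local Open Scope complex_scope.
Implicit Types g h : V -> C.

Lemma Re_addC (z w : C) : Re (z + w) = Re z + Re w.
Proof. by case: z w => ? ? []. Qed.

Lemma Im_addC (z w : C) : Im (z + w) = Im z + Im w.
Proof. by case: z w => ? ? []. Qed.

Lemma Re_mulC (z w : C) :
  Re (z * w) = Re z * Re w - Im z * Im w.
Proof. by case: z w => ? ? []. Qed.

Lemma Im_mulC (z w : C) :
  Im (z * w) = Re z * Im w + Im z * Re w.
Proof. by case: z w => ? ? []. Qed.

Lemma L1_add g h : L1 g -> L1 h -> L1 (g + h).
Proof.
move=> [g1 g2] [h1 h2]; split.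
  by under eq_fun do rewrite Re_addC EFinD; exact: (integrableD measurableT g1 h1).
by under eq_fun do rewrite Im_addC EFinD; exact: (integrableD measurableT g2 h2).
Qed.

Lemma L1_scale a g : L1 g -> L1 (a *: g).
Proof.
move=> [g1 g2]; split.
  have := integrableB measurableT (integrableZl measurableT (Re a) g1)
    (integrableZl measurableT (Im a) g2).
  by congr (leb.-integrable _ _); apply/funext => x /=; rewrite Re_mulC EFinB !EFinM.
have := integrableD measurableT (integrableZl measurableT (Re a) g2)
  (integrableZl measurableT (Im a) g1).
by congr (leb.-integrable _ _); apply/funext => x /=; rewrite Im_mulC EFinD !EFinM.
Qed.

Lemma L1_Re_measurable g : L1 g -> measurable_fun setT (fun x => Re (g x)).
Proof. by move=> [/integrableP[/measurable_EFinP]]. Qed.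

Lemma L1_Im_measurable g : L1 g -> measurable_fun setT (fun x => Im (g x)).
Proof. by move=> [_ /integrableP[/measurable_EFinP]]. Qed.

Lemma L1_nc_integrable g : L1 g -> leb.-integrable setT (EFin \o (fun x => nc (g x))).
Proof.
move=> Lg; have [g1 g2] := Lg.
apply: (@dominated_integrable _ _ _ _ _ (fun x => `|Re (g x)| + `|Im (g x)|)).
- have E : (fun x => nc (g x)) =
      (fun x => Num.sqrt (Re (g x) ^+ 2 + Im (g x) ^+ 2)).
    by apply/funext => x; case: (g x).
  rewrite E; apply: (measurableT_comp (continuous_measurable_fun (@sqrt_continuous R))).
  by apply: measurable_funD; apply: measurable_funX; [exact: L1_Re_measurable|exact: L1_Im_measurable].
- have := integrableD measurableT (integrable_norm g1) (integrable_norm g2).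
  by congr (leb.-integrable _ _).
- by move=> x; rewrite ger0_norm ?nc_ge0// nc_le.
Qed.

Lemma L1_normE g : L1 g -> L1_norm g = (\int[leb]_x nc (g x))%:E.
Proof. by move=> Lg; rewrite /Rintegral fineK// integrable_fin_num//; exact: L1_nc_integrable. Qed.

Lemma L1_norm_ge0 g : (0 <= L1_norm g)%E.
Proof. by apply: integral_ge0 => x _; rewrite lee_fin nc_ge0. Qed.

Variables (psi : V -> R) (K : R).
Hypotheses (mpsi : measurable_fun setT psi) (K_gt0 : 0 < K) (psiK : forall x, `|psi x| <= K).

Definition pairing g : C := cintegral setT (fun x => g x * (psi x)%:C).

Lemma pairingE g : pairing g =
  (\int[leb]_x (Re (g x) * psi x)) +i* (\int[leb]_x (Im (g x) * psi x)).
Proof.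
rewrite /pairing /cintegral; congr (_ +i* _).
  by under eq_Rintegral do rewrite Re_mulC /= mulr0 subr0.
by under eq_Rintegral do rewrite Im_mulC /= mulr0 add0r.
Qed.

Lemma integrable_mul_bounded (u : V -> R) : leb.-integrable setT (EFin \o u) ->
  leb.-integrable setT (EFin \o (fun x => u x * psi x)).
Proof.
move=> iu; apply: (@dominated_integrable _ _ _ _ _ (fun x => K * `|u x|)).
- by apply: measurable_funM => //; case/integrableP: iu => /measurable_EFinP.
- exact: (integrableZl measurableT K (integrable_norm iu)).
- by move=> x; rewrite normrM mulrC ler_wpM2r.
Qed.

Lemma pairingD g h : L1 g -> L1 h -> pairing (g + h) = pairing g + pairing h.
Proof.
move=> [g1 g2] [h1 h2]; rewrite !pairingE.
have -> : \int[leb]_x (Re ((g + h) x) * psi x) =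
    \int[leb]_x (Re (g x) * psi x) + \int[leb]_x (Re (h x) * psi x).
  rewrite -(RintegralD measurableT (integrable_mul_bounded g1) (integrable_mul_bounded h1)).
  by apply: eq_Rintegral => x _; rewrite Re_addC mulrDl.
have -> : \int[leb]_x (Im ((g + h) x) * psi x) =
    \int[leb]_x (Im (g x) * psi x) + \int[leb]_x (Im (h x) * psi x).
  rewrite -(RintegralD measurableT (integrable_mul_bounded g2) (integrable_mul_bounded h2)).
  by apply: eq_Rintegral => x _; rewrite Im_addC mulrDl.
by simpc.
Qed.

Lemma pairingZ a g : L1 g -> pairing (a *: g) = a * pairing g.
Proof.
move=> [g1 g2]; rewrite !pairingE.
have i1 := integrable_mul_bounded g1; have i2 := integrable_mul_bounded g2.
have iZ (k : R) (u : V -> R) : leb.-integrable setT (EFin \o u) ->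
    leb.-integrable setT (EFin \o (fun x => k * u x)).
  by move=> iu; exact: (integrableZl measurableT k iu).
case: a => a b.
have -> : \int[leb]_x (Re (((a +i* b) *: g) x) * psi x) =
    a * \int[leb]_x (Re (g x) * psi x) - b * \int[leb]_x (Im (g x) * psi x).
  rewrite -(RintegralZl a measurableT i1) -(RintegralZl b measurableT i2).
  rewrite -(RintegralB measurableT (iZ a _ i1) (iZ b _ i2)).
  by apply: eq_Rintegral => x _; rewrite Re_mulC /= mulrBl !mulrA.
have -> : \int[leb]_x (Im (((a +i* b) *: g) x) * psi x) =
    a * \int[leb]_x (Im (g x) * psi x) + b * \int[leb]_x (Re (g x) * psi x).
  rewrite -(RintegralZl a measurableT i2) -(RintegralZl b measurableT i1).
  rewrite -(RintegralD measurableT (iZ a _ i2) (iZ b _ i1)).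
  by apply: eq_Rintegral => x _; rewrite Im_mulC /= mulrDl !mulrA.
by simpc.
Qed.

Lemma pairing_le g : L1 g -> ((nc (pairing g) / (2 * K))%:E <= L1_norm g)%E.
Proof.
move=> Lg; have [g1 g2] := Lg; rewrite L1_normE// lee_fin.
have K0 := K_gt0; rewrite ler_pdivrMr ?mulr_gt0//; apply: (le_trans (nc_le _)).
have ig := L1_nc_integrable Lg.
have bd (u : V -> R) : leb.-integrable setT (EFin \o u) -> (forall x, `|u x| <= nc (g x)) ->
    `|\int[leb]_x (u x * psi x)| <= K * \int[leb]_x nc (g x).
  move=> iu ub; rewrite -(RintegralZl K measurableT ig).
  apply: dominated_normr_Rintegral.
  - by case/integrableP: (integrable_mul_bounded iu) => /measurable_EFinP.
  - exact: (integrableZl measurableT K ig).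
  - by move=> x; rewrite normrM mulrC ler_pM.
rewrite pairingE /=; apply: (le_trans (lerD (bd _ g1 _) (bd _ g2 _))).
- by move=> x; exact: Re_le_nc.
- by move=> x; exact: Im_le_nc.
- by apply: le_of_eq; ring.
Qed.

End pairing.

(** * Pairing along an admissible function *)
Section sum_norm.
Context {R : realType} {n : nat}.
Local Notation C := (R[i]).
Local Notation nc := (@Normc.normc R).
Local Notation V := 'rV[R]_n.
Local Notation leb := (lebesgue_rV R n).
Local Notation H1 := (hardy1 R n).
Local Notation BVn := (BV R n).
Local Notation E01 := (sum_space H1 BVn).
Local Open Scope complex_scope.
Implicit Types g h : V -> C.

Lemma variation_ge (D : (V -> V) -> V -> R) (phi : V -> V) g : test_field phi ->
  (forall x, enorm (phi x) <= 1) ->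
  ((nc (cintegral setT (fun x => g x * (D phi x)%:C)))%:E <= Defs.variation D g)%E.
Proof. by move=> t1 t2; apply: ereal_sup_ubound; exists phi. Qed.

Lemma test_field0 : test_field (fun _ : V => 0).
Proof.
split=> [i k|].
  rewrite (_ : (fun _ => _) = fun=> 0); first exact: Ck_cst.
  by apply/funext => x; rewrite mxE.
rewrite (_ : [set _ | _] = set0); first by rewrite closure0; exact: compact0.
by apply/seteqP; split => // x /=; rewrite eqxx.
Qed.

Lemma variation_ge0 D g : (0 <= Defs.variation D g)%E.
Proof.
have z1 x : enorm ((fun _ : V => 0) x : V) <= 1.
  by rewrite /enorm big1 ?sqrtr0// => i _; rewrite mxE expr0n.
by apply: le_trans (@variation_ge D _ g test_field0 z1); rewrite lee_fin nc_ge0.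
Qed.

Lemma sum_space_L1 g : carrier E01 g -> L1 g.
Proof. by move=> [x0 [L0 _] [x1 [L1' _] <-]]; exact: L1_add. Qed.

Variables (psi : V -> R) (K : R).
Hypotheses (mpsi : measurable_fun setT psi) (K_gt0 : 0 < K) (psiK : forall x, `|psi x| <= K).

(** Both endpoint norms dominate the norm of L^1. *)
Lemma pairing_sum_le g : ((nc (pairing psi g) / (2 * K))%:E <= subspace_norm E01 g)%E.
Proof.
apply: le_ereal_inf_tmp => _ [x0 [x1 [[L0 _] [L1' _] -> ->]]].
have K2 : 0 <= (2 * K)^-1 by rewrite invr_ge0 mulr_ge0// ltW.
rewrite (pairingD mpsi psiK L0 L1').
apply: (@le_trans _ _ ((nc (pairing psi x0) / (2 * K))%:E + (nc (pairing psi x1) / (2 * K))%:E)%E).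
  by rewrite -EFinD lee_fin -mulrDl ler_wpM2r// ncD.
apply: leeD.
  apply: (le_trans (pairing_le mpsi K_gt0 psiK L0)); rewrite /= leeDl//.
  by apply: integral_ge0 => x _; rewrite lee_fin sqrtr_ge0.
apply: (le_trans (pairing_le mpsi K_gt0 psiK L1')); rewrite /= leeDl//.
exact: variation_ge0.
Qed.

Lemma pairing_small g e : (subspace_norm E01 g < (e / (2 * K))%:E)%E -> nc (pairing psi g) < e.
Proof.
move=> h; have := le_lt_trans (pairing_sum_le g) h.
by rewrite lte_fin ltr_pM2r// invr_gt0 mulr_gt0.
Qed.

Lemma near_complex (z : C) (P : set C) : (\forall w \near z, P w) ->
  exists2 r : R, 0 < r & forall w, nc (w - z) < r -> P w.
Proof.
move=> /nbhs_ballP[e /= e0 He].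
have [eE r0] : e = (Re e)%:C /\ 0 < Re e.
  by clear He; move: e0; case: e => a b /andP[/eqP /= ->].
exists (Re e) => // w hw; apply: He; rewrite /ball /=.
have -> : `|z - w| = (nc (w - z))%:C by rewrite distrC normc_def; case: (w - z).
by rewrite eE ltcR.
Qed.

Lemma ecvg0_lt (T : Type) (G : set_system T) (FG : Filter G) (f : T -> \bar R) (e : R) : 0 < e ->
  f x @[x --> G] --> 0%E -> \forall x \near G, (f x < e%:E)%E.
Proof.
move=> e0 fG; apply: (fG [set y | (y < e%:E)%E]).
by apply: open_nbhs_nbhs; split; [exact: open_ereal_lt_ereal|rewrite /= lte_fin].
Qed.

Section along_strip.
Variable F : C -> V -> C.
Hypothesis Fcar : forall z, strip z -> carrier E01 (F z).

Let phi z := pairing psi (F z).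

Let phiB z w : strip z -> strip w -> phi w - phi z = pairing psi (F w - F z).
Proof.
move=> /Fcar/sum_space_L1 Lz /Fcar/sum_space_L1 Lw.
have -> : F w - F z = F w + (-1) *: F z by rewrite scaleN1r.
rewrite (pairingD mpsi psiK Lw (L1_scale (-1) Lz)) (pairingZ mpsi psiK _ Lz).
by rewrite mulN1r.
Qed.

Lemma pairing_strip_cont : continuous_on_strip H1 BVn F ->
  forall z, strip z -> forall e, 0 < e -> exists2 r, 0 < r &
    forall w, strip w -> nc (w - z) < r -> nc (phi w - phi z) <= e.
Proof.
move=> Fc z zs e e0; have e1 : 0 < e / (2 * K) by rewrite divr_gt0// mulr_gt0.
have [r r0 Hr] := near_complex (P := fun w => strip w ->
  (subspace_norm E01 (F w - F z)%R < (e / (2 * K))%:E)%E) (ecvg0_lt _ e1 (Fc z zs)).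
exists r => // w ws wz; rewrite phiB//; apply/ltW/pairing_small.
exact: Hr.
Qed.

Lemma pairing_strip_diff : holomorphic_on_strip H1 BVn F ->
  forall z, strip_interior z -> cdiff phi z.
Proof.
move=> Fh z zs; have [d dE Fd] := Fh z zs; exists (pairing psi d) => e e0.
have e1 : 0 < e / (2 * K) by rewrite divr_gt0// mulr_gt0.
have [r r0 Hr] := near_complex (P := fun h : C => h != 0 ->
  (subspace_norm E01 (h^-1 *: (F (z + h) - F z) - d)%R < (e / (2 * K))%:E)%E) (ecvg0_lt _ e1 Fd).
have /andP[z0 z1] := zs.
exists (Num.min r (Num.min (Re z) (1 - Re z))) => [|h].
  by rewrite !lt_min r0 z0 subr_gt0.
rewrite !lt_min => /and3P[hr h1 h2]; have [->|h0] := eqVneq h 0.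
  by rewrite addr0 subrr mulr0 subr0 nc0 mulr0.
have zs' : strip z by rewrite /strip /= !ltW.
have zhs : strip (z + h).
  have := Re_le_nc h; rewrite ler_norml /strip /= Re_addC => /andP[h3 h4].
  by apply/andP; split; lra.
have := Hr h; rewrite subr0 => /(_ hr h0) => hs.
have Lzh := sum_space_L1 (Fcar zhs); have Lz := sum_space_L1 (Fcar zs').
have Ld := sum_space_L1 dE.
have LB : L1 (F (z + h) - F z) by rewrite -scaleN1r; apply: L1_add => //; exact: L1_scale.
have -> : phi (z + h) - phi z - pairing psi d * h =
    h * pairing psi (h^-1 *: (F (z + h) - F z) - d).
  have -> : h^-1 *: (F (z + h) - F z) - d = h^-1 *: (F (z + h) - F z) + (-1) *: d.
    by rewrite scaleN1r.
  rewrite (pairingD mpsi psiK (L1_scale _ LB) (L1_scale _ Ld)).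
  rewrite (pairingZ mpsi psiK _ LB) (pairingZ mpsi psiK _ Ld) -phiB//.
  by field.
rewrite ncM mulrC ler_wpM2r ?nc_ge0//; exact/ltW/pairing_small.
Qed.

Lemma pairing_strip_bound M : (forall z, strip z -> (subspace_norm E01 (F z) <= M%:E)%E) ->
  forall z, strip z -> nc (phi z) <= 2 * K * M.
Proof.
move=> FM z zs; have := le_trans (pairing_sum_le (F z)) (FM z zs).
by rewrite lee_fin ler_pdivrMr ?mulr_gt0// mulrC.
Qed.

End along_strip.
End sum_norm.

(** * The boundary line of functions of bounded variation *)
Section right_line.
Context {R : realType} {m : nat}.
Local Notation n := m.+1.
Local Notation C := (R[i]).
Local Notation nc := (@Normc.normc R).
Local Notation V := 'rV[R]_n.
Local Notation leb := (lebesgue_rV R n).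
Local Open Scope complex_scope.
Implicit Types g : V -> C.

Lemma bump_pairing_le (lam : R) g : 1 <= lam -> L1 g ->
  ((lam * nc (pairing (bump_div lam) g))%:E <= Defs.variation divergence g)%E.
Proof.
move=> l1 Lg; have l0 : 0 <= lam by apply: le_trans l1.
apply: le_trans (variation_ge divergence g (test_field_bump l1) (enorm_bump_le1 lam)).
have -> : lam * nc (pairing (bump_div lam) g) = nc (lam%:C * pairing (bump_div lam) g).
  by rewrite ncM nc_real ger0_norm.
rewrite lee_fin.
rewrite -(pairingZ (measurable_bump_div lam) (bump_div_le4 lam) _ Lg) /pairing.
apply: le_of_eq; congr (nc (cintegral _ _)).
apply/funext => x; rewrite divergence_bump rmorphM /= mulrCA.
by rewrite mulrA.
Qed.

(** Near a time t0 the pairings differ from those at t0 by at most 1, as the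
    variation of G t - G t0 is small. Compactness of a segment and the decay at
    both ends give a bound for all t; it serves all lam as every field
    tests the same variation. *)
Lemma bump_pairing_bounded (G : R -> V -> C) : C0_line (BV R n) G ->
  exists M : R, forall t lam, 1 <= lam -> lam * nc (pairing (bump_div lam) (G t)) <= M.
Proof.
move=> [GBV Gc Gp Gm].
pose P (M t : R) := forall lam, 1 <= lam -> lam * nc (pairing (bump_div lam) (G t)) <= M.
have LG t : L1 (G t) by have [] := GBV t.
have small (g : V -> C) : L1 g -> (subspace_norm (BV R n) g < 1%:E)%E -> forall lam, 1 <= lam ->
    lam * nc (pairing (bump_div lam) g) <= 1.
  move=> Lg h lam l1; rewrite -lee_fin; apply: (le_trans (bump_pairing_le l1 Lg)).
  apply: le_trans (ltW h); rewrite /= addeC leeDl//; exact: L1_norm_ge0.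
have [A A0 PA] : exists2 A, 0 <= A & forall t, A < `|t| -> P 1 t.
  have := ecvg0_lt _ ltr01 Gp; rewrite /= => -[A1 [_ H1]].
  have := ecvg0_lt _ ltr01 Gm; rewrite /= => -[A2 [_ H2]].
  exists (Num.max `|A1| `|A2|) => [|t]; first by rewrite le_max normr_ge0.
  rewrite gt_max => /andP[t1 t2] lam l1; apply: small => //.
  have [t0|t0] := leP 0 t.
    by apply: H1; rewrite (le_lt_trans (ler_norm _))// -(ger0_norm t0).
  by apply: H2; move: t2; rewrite (ltr0_norm t0) ltrNr => /lt_le_trans; apply; rewrite lerNl ler_normr lexx orbT.
have K1 (t0 : R) : \forall t \near t0 & M \near +oo, P M t.
  have [v0 Hv0] : exists v0, forall lam, 1 <= lam ->
      lam * nc (pairing (bump_div lam) (G t0)) <= v0.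
    have [_ vlt] := GBV t0; have v0 := variation_ge0 divergence (G t0).
    exists (fine (Defs.variation divergence (G t0))) => lam l1.
    rewrite -lee_fin fineK; first exact: bump_pairing_le.
    by rewrite ge0_fin_numE.
  exists ([set t | (subspace_norm (BV R n) (G t - G t0)%R < 1%:E)%E], [set M | v0 + 1 < M]).
    split => /=; first exact: (ecvg0_lt _ ltr01 (Gc t0)).
    by exists (v0 + 1); split => //; exact: num_real.
  move=> [t M] /= [h1 h2] lam l1; apply: le_trans (ltW h2).
  have L1 : L1 (G t - G t0) by rewrite -scaleN1r; apply: L1_add => //; exact: L1_scale.
  have k1 := small _ L1 h1 lam l1; have k2 := Hv0 lam l1.
  have -> : G t = (G t - G t0) + G t0 by rewrite subrK.
  rewrite (pairingD (measurable_bump_div lam) (bump_div_le4 lam) L1 (LG t0)).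
  apply: (@le_trans _ _ (lam * (nc (pairing (bump_div lam) (G t - G t0)) +
      nc (pairing (bump_div lam) (G t0))))).
    by rewrite ler_wpM2l ?ncD//; apply: le_trans l1.
  by rewrite mulrDr; lra.
have cA : compact `[- A, A]%classic by exact: segment_compact.
have [M0 [_ HM]] : \forall M \near +oo, `[- A, A]%classic `<=` P M.
  have/compact_near_coveringP nc := cA; apply: nc => t _; exact: K1.
exists (Num.max 1 (M0 + 1)) => t lam l1; have [tA|tA] := leP `|t| A.
  apply: (@le_trans _ _ (M0 + 1)); last by rewrite le_max lexx orbT.
  by apply: (HM (M0 + 1) _ t) => //; [rewrite ltrDl|rewrite /= in_itv /= -ler_norml].
by apply: (@le_trans _ _ 1); [exact: PA|rewrite le_max lexx].
Qed.

End right_line.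

(** * Pairing the concentrating fields with fixed functions *)
Section bump_limits.
Context {R : realType} {m : nat}.
Local Notation n := m.+1.
Local Notation C := (R[i]).
Local Notation nc := (@Normc.normc R).
Local Notation V := 'rV[R]_n.
Local Notation leb := (lebesgue_rV R n).
Local Open Scope complex_scope.

Lemma bump_div_cvg0 (x : V) : bump_div k.+1%:R x @[k --> \oo] --> (0 : R).
Proof.
have [x0|x0] := eqVneq (x ord0 ord0) 0.
  rewrite (_ : (fun k : nat => _) = cst 0); first exact: cvg_cst.
  by apply/funext => k; rewrite /bump_div x0 mulr0 mul0r oppr0.
have x0' : 0 < `|x ord0 ord0| by rewrite normr_gt0.
apply/cvgrPdist_le => e e0; exists (Num.truncn `|x ord0 ord0|^-1).+1 => // k /= hk.
rewrite bump_div_support ?subrr ?normr0 ?(ltW e0)//; first by rewrite ler1n.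
rewrite -ltr_pdivrMr// div1r; apply: (lt_le_trans (truncnS_gt _)).
by rewrite ler_nat (leq_trans hk).
Qed.

Lemma Rintegral_bump_cvg0 (u : V -> R) : leb.-integrable setT (EFin \o u) ->
  \int[leb]_x (u x * bump_div k.+1%:R x) @[k --> \oo] --> (0 : R).
Proof.
move=> iu; have mu : measurable_fun setT u by case/integrableP: iu => /measurable_EFinP.
have := @Rintegral_dominated_cvg _ V R leb (fun k x => u x * bump_div k.+1%:R x) (fun=> 0)
  (fun x => 4 * `|u x|).
rewrite /Rintegral integral0 /= => H; apply: H.
- by move=> k; apply: measurable_funM => //; exact: measurable_bump_div.
- exact: measurable_cst.
- exact: (integrableZl measurableT 4 (integrable_norm iu)).
- by move=> k x; rewrite normrM mulrC ler_wpM2r//; exact: bump_div_le4.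
- move=> x; rewrite -[X in _ --> X](mulr0 (u x)); apply: cvgM; first exact: cvg_cst.
  exact: bump_div_cvg0.
Qed.

Lemma pairing_bump_cvg0 (g : V -> C) : L1 g ->
  nc (pairing (bump_div k.+1%:R) g) @[k --> \oo] --> (0 : R).
Proof.
move=> [g1 g2]; have c1 := Rintegral_bump_cvg0 g1; have c2 := Rintegral_bump_cvg0 g2.
have c3 : `|\int[leb]_x (Re (g x) * bump_div k.+1%:R x)| +
    `|\int[leb]_x (Im (g x) * bump_div k.+1%:R x)| @[k --> \oo] --> (0 : R).
  rewrite -[X in _ --> X]addr0 -{1 2}(@normr0 R R); apply: cvgD; exact: cvg_norm.
apply: (squeeze_cvgr _ _ c3); last exact: cvg_cst.
by apply: nearW => k; rewrite nc_ge0 pairingE (le_trans (nc_le _)).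
Qed.

Variable s : R.
Hypotheses (s_gt0 : 0 < s) (s_lt1 : s < 1).

Lemma asing_mul_ge0 t : 0 <= t * asing s t.
Proof.
rewrite /asing; case: ifP => _; last by rewrite mulr0.
by rewrite mulrA (mulrC t) -normrEsg mulr_ge0 ?powR_ge0.
Qed.

Lemma fsing_bump_le0 (lam : R) (x : V) : 0 <= lam -> fsing s x * bump_div lam x <= 0.
Proof.
move=> l0; rewrite /fsing /bump_div mulrN oppr_le0.
have -> : asing s (x ord0 ord0) * bexp (tail_rV x) *
    (2 * lam * x ord0 ord0 * flat 2 (ellq lam x)) =
  (x ord0 ord0 * asing s (x ord0 ord0)) * (2 * lam * bexp (tail_rV x) * flat 2 (ellq lam x)).
  by ring.
by apply: mulr_ge0; [exact: asing_mul_ge0|rewrite !mulr_ge0 ?bexp_ge0 ?flat_ge0].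
Qed.

Lemma measurable_box_rV k (a b : 'I_k -> R) :
  measurable [set x : 'rV[R]_k | forall i, x ord0 i \in `[a i, b i]].
Proof.
rewrite (_ : [set x | _] = \bigcap_(i in [set: 'I_k])
    ((fun x : 'rV[R]_k => x ord0 i) @^-1` `[a i, b i])); last first.
  by apply/seteqP; split => [x Bx i _|x Bx i]; [exact: Bx|exact: (Bx i I)].
apply: fin_bigcap_measurable; first exact: finite_finset.
by move=> i _; rewrite -[X in measurable X]setTI; exact: measurable_coord.
Qed.

Let w : R := (2 * n%:R)^-1.

Let w_gt0 : 0 < w. Proof. by rewrite invr_gt0 mulr_gt0. Qed.

Let w_le : w <= 2^-1.
Proof. by rewrite lef_pV2 ?posrE ?mulr_gt0// ler_peMr// ler1n. Qed.

Let mw_le : m%:R * w <= 2^-1.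
Proof.
rewrite /w invfM mulrA ler_pdivrMr// mulrC ler_wpM2l ?invr_ge0//.
by rewrite ler_nat.
Qed.

Lemma fsing_bump_box (lam : R) (x : V) : 1 <= lam ->
  lam^-1 / 4 <= x ord0 ord0 <= lam^-1 / 2 -> (forall i : 'I_m, 0 <= x ord0 (lift ord0 i) <= w) ->
  expR (- 3) / 2 * lam `^ (1 - s) <= - (fsing s x * bump_div lam x).
Proof.
move=> l1 /andP[x1 x2] xi; have l0 : 0 < lam by apply: lt_le_trans l1.
have li0 : 0 < lam^-1 by rewrite invr_gt0.
have li1 : lam^-1 <= 1 by rewrite invf_le1.
have t0 : 0 < x ord0 ord0 by apply: lt_le_trans x1; rewrite divr_gt0.
set t := x ord0 ord0 in x1 x2 t0 *.
have tl : t <= lam^-1 by lra.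
have aE : asing s t = t `^ (s - 1).
  rewrite /asing gtr0_norm// gtr0_sg// mul1r ifT//; lra.
have aL : lam `^ (1 - s) <= asing s t.
  rewrite aE -(opprB 1 s) powRN -div1r ler_pdivlMr ?powR_gt0// -powRM ?(ltW l0) ?(ltW t0)//.
  have le1 : lam * t <= 1 by rewrite mulrC -ler_pdivlMr// div1r.
  have := @ge0_ler_powR R (1 - s) _ (lam * t) 1; rewrite powR1; apply => //.
  - by have := s_lt1; lra.
  - by rewrite nnegrE mulr_ge0// ltW.
  - by rewrite nnegrE.
have lt2 : 2^-1 <= 2 * lam * t.
  have : lam * (lam^-1 / 4) <= lam * t by rewrite ler_wpM2l// ltW.
  by rewrite mulrA mulfV ?gt_eqF// mul1r; lra.
have W2 := w_le; have MW := mw_le; have w0 := w_gt0.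
have bE : expR (- 1) <= bexp (tail_rV x).
  rewrite ler_expR lerN2 /l1norm; apply: (@le_trans _ _ (\sum_(i < m) w)).
    apply: ler_sum => i _; rewrite mxE; have /andP[h1 h2] := xi i.
    by rewrite ger0_norm.
  by rewrite sumr_const card_ord -mulr_natl; lra.
have [q1 q2] : 2^-1 <= ellq lam x /\ ellq lam x <= 1.
  rewrite /ellq big_ord_recl /= -/t; split.
    have h1 : lam ^+ 2 * t ^+ 2 <= 4^-1.
      have lt1 : lam * t <= 2^-1.
        have : lam * t <= lam * (lam^-1 / 2) by rewrite ler_wpM2l// ltW.
        by rewrite mulrA mulfV ?gt_eqF// mul1r; lra.
      have lt0 : 0 <= lam * t by rewrite mulr_ge0// ltW.
      by rewrite -exprMn; nra.
    have h2 : \sum_(i < m) (if lift ord0 i == ord0 then lam ^+ 2 else 1) * x ord0 (lift ord0 i) ^+ 2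
        <= 4^-1.
      apply: (@le_trans _ _ (\sum_(i < m) w * 2^-1)).
        apply: ler_sum => i _; rewrite /= mul1r expr2; have /andP[h1' h2] := xi i.
        by apply: ler_pM => //; apply: le_trans W2.
      by rewrite sumr_const card_ord -[_ *+ m]mulr_natl mulrA; lra.
    lra.
  have h1 : 0 <= lam ^+ 2 * t ^+ 2 by rewrite -exprMn sqr_ge0.
  have h2 : 0 <= \sum_(i < m) (if lift ord0 i == ord0 then lam ^+ 2 else 1) *
      x ord0 (lift ord0 i) ^+ 2.
    by apply: sumr_ge0 => i _; rewrite /= mul1r sqr_ge0.
  lra.
have fE : expR (- 2) <= flat 2 (ellq lam x).
  have q0 : 0 < ellq lam x by lra.
  rewrite /flat q0 -[leLHS]mul1r; apply: ler_pM; rewrite ?expR_ge0//.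
    by rewrite exprn_ege1// invf_ge1.
  by rewrite ler_expR lerN2 invf_ple ?posrE//; lra.
have -> : - (fsing s x * bump_div lam x) =
    bexp (tail_rV x) * flat 2 (ellq lam x) * (2 * lam * t) * asing s t.
  by rewrite /fsing /bump_div -/t; ring.
have -> : expR (- 3) / 2 = expR (- 1) * expR (- 2) * 2^-1 :> R.
  by rewrite -expRD; congr (expR _ / _); ring.
apply: ler_pM => //; rewrite ?mulr_ge0 ?expR_ge0 ?invr_ge0 ?powR_ge0//.
apply: ler_pM => //; rewrite ?mulr_ge0 ?expR_ge0 ?invr_ge0//.
by apply: ler_pM => //; rewrite expR_ge0.
Qed.

(** The integrand has a constant sign, and it is of the order lam^(1 - s) on a
    box of volume of the order 1 / lam next to the hyperplane. *)
Lemma pairing_fsing_ge : exists2 c, 0 < c & forall lam, 1 <= lam ->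
  c * lam `^ (- s) <= nc (pairing (bump_div lam) (fun x : V => (fsing s x)%:C)).
Proof.
exists (expR (- 3) / 8 * w ^+ m) => [|lam l1].
  by rewrite mulr_gt0 ?exprn_gt0 ?w_gt0// divr_gt0// expR_gt0.
have l0 : 0 < lam by apply: lt_le_trans l1.
have li0 : 0 < lam^-1 by rewrite invr_gt0.
have ifs := integrable_fsing s_gt0 m.
pose u (x : V) := - (fsing s x * bump_div lam x).
have iu : leb.-integrable setT (EFin \o u).
  have := integrableN (integrable_mul_bounded (measurable_bump_div lam)
    (bump_div_le4 lam) ifs).
  by congr (leb.-integrable _ _).
have u0 x : 0 <= u x by rewrite oppr_ge0 fsing_bump_le0// ltW.
apply: (@le_trans _ _ (\int[leb]_x u x)); last first.
  rewrite pairingE; apply: le_trans (Re_le_nc _).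
  have -> : \int[leb]_x u x = - \int[leb]_x (fsing s x * bump_div lam x).
    rewrite -[RHS]mulN1r -(RintegralZl (-1) measurableT
      (integrable_mul_bounded (measurable_bump_div lam) (bump_div_le4 lam) ifs)).
    by apply: eq_Rintegral => x _; rewrite mulN1r.
  by rewrite (le_trans (ler_norm _))// normrN.
pose a (i : 'I_n) := if i == ord0 then lam^-1 / 4 else 0.
pose b (i : 'I_n) := if i == ord0 then lam^-1 / 2 else w.
have ab i : a i <= b i by rewrite /a /b; case: ifP => _; [lra|exact/ltW/w_gt0].
pose B := [set x : V | forall i, x ord0 i \in `[a i, b i]].
have mB : measurable B by exact: measurable_box_rV.
pose k := expR (- 3) / 2 * lam `^ (1 - s).
have volB : leb B = (lam^-1 / 4 * w ^+ m)%:E.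
  rewrite /B lebesgue_rV_box// big_ord_recl /a /b /=; congr (_%:E).
  congr (_ * _); first by field; rewrite gt_eqF.
  rewrite (eq_bigr (fun=> w)) => [|i _]; last by rewrite subr0.
  by rewrite prodr_const card_ord.
have kB x : B x -> k <= u x.
  move=> Bx; apply: fsing_bump_box => //.
    by have := Bx ord0; rewrite /a /b eqxx in_itv.
  by move=> i; have := Bx (lift ord0 i); rewrite /a /b in_itv.
have E1 : (k%:E * leb B <= \int[leb]_x (u x)%:E)%E.
  rewrite -(integral_cst leb mB).
  apply: (@le_trans _ _ (\int[leb]_(x in B) (u x)%:E)%E).
    apply: ge0_le_integral => //.
    - by move=> x _; rewrite lee_fin /k mulr_ge0 ?powR_ge0// divr_ge0 ?expR_ge0.
    - by case/integrableP: (integrableS measurableT mB (@subsetT _ _) iu).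
  apply: ge0_subset_integral => //; first by case/integrableP: iu.
  by move=> x _; rewrite lee_fin.
rewrite -lee_fin /Rintegral fineK; last exact: (integrable_fin_num measurableT iu).
apply: le_trans E1; rewrite volB -EFinM lee_fin /k.
have -> : lam `^ (- s) = lam `^ (1 - s) * lam^-1.
  rewrite powRB ?(gt_eqF l0) ?implybT// powRr1 ?(ltW l0)// powRN.
  by rewrite mulrAC mulfV ?gt_eqF// mul1r.
by apply: le_of_eq; field; rewrite gt_eqF.
Qed.

End bump_limits.

(** * The contradiction *)
Section weight.
Context {R : realType}.
Local Notation C := (R[i]).
Local Notation nc := (@Normc.normc R).
Local Open Scope complex_scope.

(** The power mu^z with mu = e^l moves weight from one boundary line to the
    other; the factor (z + 1)^(-2) makes bounded functions integrable. *)
Definition strip_weight (l : R) (z : C) : C :=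
  cexp (l%:C * z) * (pole (-1) z * pole (-1) z).

Lemma cdiff_strip_weight l z : 0 <= Re z -> cdiff (strip_weight l) z.
Proof.
move=> z0; have pz : cdiff (pole (-1)) z.
  apply: cdiff_inv_lin; apply/eqP => ze; move: z0; rewrite ze /=; lra.
apply: cdiffM; last exact: cdiffM.
by apply: cdiff_scale; exact: cdiff_cexp.
Qed.

Lemma nc_strip_weight l x y : nc (strip_weight l (x +i* y)) =
  expR (l * x) * ((x + 1) ^+ 2 + y ^+ 2)^-1.
Proof.
rewrite /strip_weight !ncM nc_cexp ReM_real; congr (_ * _).
rewrite /pole ncV complex_subC opprK -invfM -expr2 /=; congr (_^-1).
by rewrite sqr_sqrtr// addr_ge0 ?sqr_ge0.
Qed.

Lemma strip_weight_le l x y : 0 <= x <= 1 ->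
  nc (strip_weight l (x +i* y)) <= (1 + expR l) / (1 + y ^+ 2).
Proof.
move=> /andP[x0 x1]; rewrite nc_strip_weight; apply: ler_pM.
- exact: expR_ge0.
- by rewrite invr_ge0 addr_ge0 ?sqr_ge0.
- have [l0|l0] := leP 0 l.
    by apply: (@le_trans _ _ (expR l)); [rewrite ler_expR ler_piMr|rewrite lerDr].
  apply: (@le_trans _ _ 1); last by rewrite lerDl expR_ge0.
  by rewrite -expR0 ler_expR nmulr_rle0.
have p1 : 0 < 1 + y ^+ 2 by rewrite ltr_pwDl ?sqr_ge0.
rewrite lef_pV2 ?posrE//; last by rewrite (lt_le_trans p1)// lerD2r; nra.
by rewrite lerD2r; nra.
Qed.

Lemma strip_cont_mul (f g : C -> C) (z : C) :
  (forall e, 0 < e -> exists2 r, 0 < r &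
    forall w, strip w -> nc (w - z) < r -> nc (f w - f z) <= e) ->
  (forall e, 0 < e -> exists2 r, 0 < r &
    forall w, nc (w - z) < r -> nc (g w - g z) <= e) ->
  forall e, 0 < e -> exists2 r, 0 < r &
    forall w, strip w -> nc (w - z) < r -> nc (f w * g w - f z * g z) <= e.
Proof.
move=> cf cg e e0; have D0 : 0 < 1 + nc (g z) + nc (f z).
  by have := nc_ge0 (f z); have := nc_ge0 (g z); lra.
pose d := Num.min 1 (e / (1 + nc (g z) + nc (f z))).
have d0 : 0 < d by rewrite lt_min ltr01 divr_gt0.
have [r r0 Hr] := cf d d0; have [q q0 Hq] := cg d d0.
exists (Num.min r q) => [|w ws]; first by rewrite lt_min r0.
rewrite lt_min => /andP[/(Hr _ ws) fr /Hq gr].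
have -> : f w * g w - f z * g z =
    (f w - f z) * (g w - g z) + ((f w - f z) * g z + f z * (g w - g z)) by ring.
apply: (@le_trans _ _ (d * 1 + (d * nc (g z) + nc (f z) * d))).
  apply: (le_trans (ncD _ _)); apply: lerD.
    rewrite ncM; apply: ler_pM; rewrite ?nc_ge0//.
    by apply: (le_trans gr); rewrite ge_min lexx.
  by apply: (le_trans (ncD _ _)); rewrite !ncM; apply: lerD; rewrite ?ler_wpM2r ?ler_wpM2l ?nc_ge0.
have -> : d * 1 + (d * nc (g z) + nc (f z) * d) = d * (1 + nc (g z) + nc (f z)) by ring.
by rewrite -ler_pdivlMr// ge_min lexx orbT.
Qed.

End weight.

Section not_interpolated.
Context {R : realType} {m : nat}.
Local Notation n := m.+1.
Local Notation C := (R[i]).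
Local Notation nc := (@Normc.normc R).
Local Notation mu := (@lebesgue_measure R).
Local Notation V := 'rV[R]_n.
Local Notation H1 := (hardy1 R n).
Local Notation BVn := (BV R n).
Local Notation E01 := (sum_space H1 BVn).
Local Open Scope complex_scope.
Variables (s : R) (F : C -> V -> C).
Hypotheses (s_gt0 : 0 < s) (s_lt1 : s < 1) (Fint : interp_functions H1 BVn F).

Let Fcar z : strip z -> carrier E01 (F z).
Proof. by case: Fint => h _ _ _ _; exact: h. Qed.

Let FL1 z : strip z -> L1 (F z).
Proof. by move=> /Fcar/sum_space_L1. Qed.

Let strip_itv (x y : R) : 0 <= x <= 1 -> strip ((x +i* y) : C). Proof. by []. Qed.

Let Hk (l : R) (k : nat) (z : C) : C :=
  pairing (bump_div k.+1%:R) (F z) * strip_weight l z.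

Let Hk_diff l k z : 0 < Re z < 1 -> cdiff (Hk l k) z.
Proof.
move=> zs; apply: cdiffM; last by apply: cdiff_strip_weight; case/andP: zs => /ltW.
have hol : holomorphic_on_strip H1 BVn F by case: Fint.
have mb := measurable_bump_div (m := m) (k.+1%:R : R); have k4 : 0 < (4 : R) by [].
  have kb := @bump_div_le4 R m k.+1%:R.
exact: (pairing_strip_diff mb k4 kb Fcar hol zs).
Qed.

Let Hk_cont l k z : 0 <= Re z <= 1 -> forall e : R, 0 < e ->
  exists2 r : R, 0 < r & forall w : C, 0 <= Re w <= 1 -> nc (w - z) < r ->
    nc (Hk l k w - Hk l k z) <= e.
Proof.
move=> zs; apply: strip_cont_mul; last first.
  by apply: cdiff_cont; apply: cdiff_strip_weight; case/andP: zs.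
have con : continuous_on_strip H1 BVn F by case: Fint => _ _ [].
have mb := measurable_bump_div (m := m) (k.+1%:R : R); have k4 : 0 < (4 : R) by [].
  have kb := @bump_div_le4 R m k.+1%:R.
exact: (pairing_strip_cont mb k4 kb Fcar con zs).
Qed.

Let Hk_bound : exists2 M : R, 0 <= M & forall l k x y, 0 <= x <= 1 ->
  nc (Hk l k (x +i* y)) <= (M * (1 + expR l)) / (1 + y ^+ 2).
Proof.
have [M HM] : bounded_on_strip H1 BVn F by case: Fint => _ _ [].
have HM' z : strip z -> (subspace_norm E01 (F z) <= `|M|%:E)%E.
  by move=> /HM h; apply: (le_trans h); rewrite lee_fin ler_norm.
exists (2 * 4 * `|M|) => [|l k x y x01]; first by rewrite !mulr_ge0.
rewrite /Hk ncM -mulrA; apply: ler_pM; rewrite ?nc_ge0//; last exact: strip_weight_le.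
have mb := measurable_bump_div (m := m) (k.+1%:R : R); have k4 : 0 < (4 : R) by [].
  have kb := @bump_div_le4 R m k.+1%:R.
exact: (pairing_strip_bound mb k4 kb HM' (strip_itv y x01)).
Qed.

Let Hk_integrable l k x : 0 <= x <= 1 ->
  mu.-integrable setT (EFin \o (fun y => nc (Hk l k (x +i* y)))).
Proof.
move=> x01; have [M M0 HM] := Hk_bound.
apply: (@dominated_integrable R _ (measurableTypeR R) mu _
  (fun y => 1 * (M * (1 + expR l) * (1 + y ^+ 2)^-1))).
- exact: (strip_measurable (@Hk_cont l k) x01).
- exact: integrable_inv1sqr.
- by move=> y; rewrite ger0_norm ?nc_ge0// mul1r; exact: HM.
Qed.

Let Hk_left l : \int[mu]_y nc (Hk l k (0 +i* y)) @[k --> \oo] --> (0 : R).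
Proof.
have [M M0 HM] := Hk_bound; have z01 : 0 <= (0 : R) <= 1 by rewrite lexx ler01.
have H := @Rintegral_dominated_cvg _ (measurableTypeR R) R mu
  (fun k y => nc (Hk l k (0 +i* y))) (fun=> 0)
  (fun y => 1 * (M * (1 + expR l) * (1 + y ^+ 2)^-1)).
have zE : \int[mu]_(y in [set: measurableTypeR R]) ((fun=> 0) y : R) = 0.
  by rewrite /Rintegral integral0.
rewrite zE in H; apply: H.
- by move=> k; exact: (strip_measurable (@Hk_cont l k) z01).
- exact: measurable_cst.
- exact: integrable_inv1sqr.
- by move=> k y; rewrite ger0_norm ?nc_ge0// mul1r; exact: HM.
move=> y; have c := pairing_bump_cvg0 (FL1 (strip_itv y z01)).
have E : (fun k => nc (Hk l k (0 +i* y))) = (fun k =>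
    nc (pairing (bump_div k.+1%:R) (F (0 +i* y))) * nc (strip_weight l (0 +i* y))).
  by apply/funext => k; rewrite /Hk ncM.
set k0 := nc (strip_weight _ _) in E *; rewrite /= E.
have h : nc (pairing (bump_div k.+1%:R) (F (0 +i* y))) * k0 @[k --> \oo] --> 0 * k0.
  by apply: cvgM; [exact: c|exact: cvg_cst].
by rewrite mul0r in h.
Qed.

Let J : R := \int[mu]_y (1 * (1 * (1 + y ^+ 2)^-1)).

Let Hk_right : exists2 M : R, 0 <= M & forall A k, 0 < A ->
  \int[mu]_y nc (Hk (ln (k.+1%:R * A)) k (1 +i* y)) <= A * M.
Proof.
have C0 : C0_line BVn (fun t => F (1 +i* t)) by case: Fint.
have [M HM] := bump_pairing_bounded C0.
have M0 : 0 <= M by apply: le_trans (HM 0 1 (lexx _)); rewrite mulr_ge0 ?nc_ge0.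
have p1 (y : R) : 0 < 1 + y ^+ 2 by rewrite ltr_pwDl ?sqr_ge0.
have J0 : 0 <= J by apply: Rintegral_ge0 => y _; rewrite !mul1r invr_ge0 ltW.
exists (M * J) => [|A k A0]; first exact: mulr_ge0.
have o1 : 0 <= (1 : R) <= 1 by rewrite ler01 lexx.
set l := ln _; have El : expR l = k.+1%:R * A by rewrite lnK// posrE mulr_gt0.
rewrite mulrA -(RintegralZl (A * M) measurableT (integrable_inv1sqr 1 1)).
apply: le_Rintegral => //; first exact: Hk_integrable.
  by have := integrable_inv1sqr (A * M) (1 * 1); congr (mu.-integrable _ _); apply/funext => y /=; rewrite !mul1r.
move=> y _; rewrite /Hk ncM nc_strip_weight mulr1 El !mul1r.
have -> : nc (pairing (bump_div k.+1%:R) (F (1 +i* y))) *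
    (k.+1%:R * A * ((1 + 1) ^+ 2 + y ^+ 2)^-1) =
  A * (k.+1%:R * nc (pairing (bump_div k.+1%:R) (F (1 +i* y)))) * ((1 + 1) ^+ 2 + y ^+ 2)^-1.
  by ring.
apply: ler_pM.
- by rewrite !mulr_ge0 ?nc_ge0 ?(ltW A0).
- by rewrite invr_ge0 addr_ge0 ?sqr_ge0.
- by rewrite ler_pM2l// HM// ler1n.
have q1 : (1 : R) <= (1 + 1) ^+ 2 by lra.
by rewrite lef_pV2 ?posrE ?lerD2r// (lt_le_trans (p1 y))// lerD2r.
Qed.

(** Take l = ln (lam A). On Re z = 1 the factor lam A of the weight meets
    pairings of size M / lam; on Re z = 0 the weight has modulus at most 1 and
    the pairings vanish in the limit. *)
Lemma interp_pairing_le : exists M : R, forall A, 0 < A ->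
  forall c, (forall k : nat, c * k.+1%:R `^ (- s) <= nc (pairing (bump_div k.+1%:R) (F s%:C))) ->
  0 <= c -> c * A `^ s <= M * A.
Proof.
have s0 := s_gt0; have s1 := s_lt1.
have [M M0 HM] := Hk_right.
exists (8 / s * (2 / (1 - s) * M)) => A A0 c Hc c0.
have ineq k : s / 8 * (c * A `^ s) <=
    2 / s * \int[mu]_y nc (Hk 0 k (0 +i* y)) + 2 / (1 - s) * (A * M).
  have lam0 : 0 < k.+1%:R :> R by [].
  set l := ln (k.+1%:R * A).
  have [B B0 HB] := Hk_bound.
  have key := @strip_mean R s _ (Hk l k) s_gt0 s_lt1 (@Hk_diff l k) (@Hk_cont l k) (HB l k).
  have E0 : (fun y => nc (Hk l k (0 +i* y))) = (fun y => nc (Hk 0 k (0 +i* y))).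
    by apply/funext => y; rewrite /Hk [LHS]ncM [RHS]ncM !nc_strip_weight !mulr0.
  have i0 := @Hk_integrable l k 0 _; have i1 := @Hk_integrable l k 1 _.
  have z01 : 0 <= (0 : R) <= 1 by rewrite lexx ler01.
  have o01 : 0 <= (1 : R) <= 1 by rewrite lexx ler01.
  have iZ (a : R) u : mu.-integrable setT (EFin \o u) ->
      mu.-integrable setT (EFin \o (fun y => a * u y)).
    by move=> iu; exact: (integrableZl measurableT a iu).
  rewrite (RintegralD measurableT (iZ _ _ (i0 z01)) (iZ _ _ (i1 o01))) in key.
  rewrite (RintegralZl _ measurableT (i0 z01)) (RintegralZl _ measurableT (i1 o01)) E0 in key.
  have c2 : 0 <= 2 / (1 - s) by rewrite divr_ge0//; lra.
  apply: (@le_trans _ _ (s / 2 * nc (Hk l k s%:C))); last first.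
    by apply: (le_trans key); rewrite lerD2l ler_wpM2l// HM.
  have -> : s / 8 * (c * A `^ s) = s / 2 * (c * A `^ s * 4^-1) by field.
  rewrite ler_wpM2l ?divr_ge0//; first lra.
  have Ew : nc (strip_weight l s%:C) = expR (l * s) * ((s + 1) ^+ 2 + 0 ^+ 2)^-1.
    exact: nc_strip_weight.
  rewrite /Hk ncM Ew expr0n addr0.
  have -> : expR (l * s) = k.+1%:R `^ s * A `^ s.
    rewrite -powRM ?(ltW A0) ?ler0n// /powR mulf_eq0 (gt_eqF A0) (gt_eqF lam0) /=.
    by rewrite mulrC.
  have -> : c * A `^ s / 4 = (c * k.+1%:R `^ (- s)) * (k.+1%:R `^ s * A `^ s * 4^-1).
    have p0 : k.+1%:R `^ s != 0 :> R by rewrite gt_eqF// powR_gt0.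
    by rewrite powRN; field.
  apply: ler_pM => //; rewrite ?mulr_ge0 ?powR_ge0 ?invr_ge0//.
  rewrite ler_wpM2l ?mulr_ge0 ?powR_ge0// lef_pV2 ?posrE ?exprn_gt0//; last lra.
  nra.
have lim : 2 / s * (\int[mu]_y nc (Hk 0 k (0 +i* y))) + 2 / (1 - s) * (A * M)
    @[k --> \oo] --> 2 / s * 0 + 2 / (1 - s) * (A * M).
  apply: cvgD; last exact: cvg_cst.
  by apply: cvgM; [exact: cvg_cst|exact: Hk_left].
have h : s / 8 * (c * A `^ s) <= 2 / s * 0 + 2 / (1 - s) * (A * M).
  by apply: (cvgr_to_ge lim); exact: nearW.
rewrite mulr0 add0r in h.
have -> : 8 / s * (2 / (1 - s) * M) * A = 8 / s * (2 / (1 - s) * (A * M)) by ring.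
have s8 : 0 < 8 / s by rewrite divr_gt0.
rewrite -(ler_pM2l s8) in h; apply: le_trans h.
by apply: le_of_eq; field; rewrite gt_eqF.
Qed.

End not_interpolated.

(** As A tends to 0, A^s is not O(A). *)
Lemma fsing_not_interp (R : realType) (m : nat) (s : R) : 0 < s -> s < 1 ->
  ~ complex_interp (hardy1 R m.+1) (BV R m.+1) s (fun x : 'rV[R]_m.+1 => (fsing s x)%:C%C).
Proof.
move=> s0 s1 [F Fint Fs].
have [M HM] := interp_pairing_le s0 s1 Fint.
have [c c0 Hc] := pairing_fsing_ge (m := m) s0 s1.
have key A : 0 < A -> c * A `^ s <= M * A.
  move=> A0; apply: HM => //; last exact: ltW.
  by move=> k; rewrite Fs; apply: Hc; rewrite ler1n.
have M0 : 0 < M.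
  have := key 1 ltr01; rewrite powR1 /= !mulr1; exact: lt_le_trans c0.
have t0 : 0 < 1 - s by lra.
(* chosen so that M A^(1 - s) = c / 2 *)
pose A := (c / (2 * M)) `^ (1 - s)^-1.
have cM : 0 < c / (2 * M) by rewrite divr_gt0// mulr_gt0.
have A0 : 0 < A by rewrite powR_gt0.
have := key A A0.
have -> : M * A = c / 2 * A `^ s.
  have E : A `^ (1 - s) = c / (2 * M).
    by rewrite /A -powRrM mulVf ?gt_eqF// powRr1// ltW.
  have -> : M * A = M * (A `^ (1 - s) * A `^ s).
    by rewrite -powRD ?subrK ?powRr1 ?(ltW A0)// (gt_eqF A0) implybT.
  by rewrite E; field; rewrite gt_eqF.
have p0 : 0 < A `^ s by rewrite powR_gt0.
by rewrite ler_pM2r//; lra.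
Qed.

Theorem corollary3p2 (R : realType) (n : nat) (n_ge1 : (1 <= n)%N)
    (s : R) (s_gt0 : 0 < s) (s_lt1 : s < 1) (c : R) (c_gt0 : 0 < c) :
  ~ ((BV_frac c s : set ('rV[R]_n -> R[i])) `<=`
     complex_interp (hardy1 R n) (BV R n) s).
Proof.
case: n n_ge1 => // m _ sub.
exact: (fsing_not_interp s_gt0 s_lt1 (sub _ (fsing_BV_frac s_gt0 s_lt1 m c))).
Qed.
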